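(* Let $t\geq 1$ be an integer and let $G$ be a $3$-connected $3t$-regular graph. Let $\mathcal{O}$ be a set of pairwise edge-disjoint cycles of $G$, each of length at least $3$. Then there exists a $t$-factor $F$ of $G$ such that $E(F) \cap E(O)$ is a non-empty matching of $G$ for every $O \in \mathcal{O}$.
   Context: All graphs are finite and loopless but may have parallel edges. A cycle is a connected $2$-regular subgraph; its length is its number of edges. A $t$-factor of $G$ is a spanning $t$-regular subgraph. $3$-connected means $G$ has more than $3$ vertices and remains connected after deleting any at most $2$ vertices. *)

(* Defs.v *)
(* A finite loopless multigraph is given by a vertex finType V,
   an edge finType E, and endpoint maps src tgt : E -> V with src e != tgt e. *)
From mathcomp Require Import all_boot.
Set Implicit Arguments. Unset Strict Implicit. Unset Printing Implicit Defensive.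

Section Graphs.
Variables (V E : finType) (src tgt : E -> V).

Definition loopless : Prop := forall e, src e != tgt e.

Definition incident (e : E) (v : V) : bool := (src e == v) || (tgt e == v).

(* degree of v in the subgraph with edge set F (loopless, so each edge counts once) *)
Definition deg_in (F : {set E}) (v : V) : nat := #|[set e in F | incident e v]|.

Definition adj_in (F : {set E}) : rel V := fun u w =>
  [exists e in F, ((src e == u) && (tgt e == w)) || ((src e == w) && (tgt e == u))].

Definition verts_of (F : {set E}) : {set V} := [set v | [exists e in F, incident e v]].

Definition regular (k : nat) : Prop := forall v, deg_in [set: E] v = k.

Definition connected_minus (S : {set V}) : Prop :=
  forall u w, u \notin S -> w \notin S ->
    connect (fun x y => [&& x \notin S, y \notin S & adj_in [set: E] x y]) u w.

Definition three_connected : Prop :=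
  3 < #|V| /\ forall S : {set V}, #|S| <= 2 -> connected_minus S.

Definition is_cycle (C : {set E}) : Prop :=
  [/\ C != set0,
      (forall v, v \in verts_of C -> deg_in C v = 2)
    & (forall u w, u \in verts_of C -> w \in verts_of C -> connect (adj_in C) u w)].

Definition is_factor (t : nat) (F : {set E}) : Prop := forall v, deg_in F v = t.

Definition is_matching (M : {set E}) : Prop :=
  forall e f, e \in M -> f \in M -> e != f -> ~~ [exists v, incident e v && incident f v].

End Graphs.

(* Main.v *)
(** Call the edges of the cycles in [O] labelled by their cycle.  The theorem is reduced to a
statement about cubic graphs: in a 3-edge-connected cubic graph, if no label class contains both
ends of an edge [e], then some perfect matching contains [e] and an edge of every label class.

For the reduction, three out of four parallel unlabelled edges are deleted as long as possible
(one of them returns to the factor), which lowers [t] by one at two vertices.  Then every vertex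
of degree [3t >= 6] is replaced by a bipartite gadget with [t] more nodes on the side that carries
the [3t] old edges, so that a perfect matching uses exactly [t] of them; the two edges of a
cycle at that vertex share a gadget node, so that at most one of them is used.

The cubic statement is proved by induction.  An edge cut of size 3 or 4 with at least three
vertices on each side splits the graph; perfect matchings of the two closed-up sides are glued.
Otherwise the graph has girth at least 5 when it has at least 8 vertices, and two or four
vertices next to [e] are deleted and the loose ends joined. *)

(* Prescribing an edge is what makes gluing possible: the cut edge used by one side of a 3-edge-cut
   becomes the prescribed edge of the other. The condition on [e] is essential already for two
   vertices joined by three edges, where [e] alone misses the class of the other two. It pays off
   because a vertex of a class not matched along its edge outside the class is matched along the
   class; a class near [e] is therefore often hit by every perfect matching through [e] and can be
   forgotten. Classes are only 2-regular, since a cycle crossing a cut four times may fall apart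
   when one side is closed up. The factor 3 in [3t]: a cubic graph on [2t] vertices has [3t] edges,
   and subdividing all of them gives a bipartite graph with surplus [t] on the side of the
   subdividing nodes. The number four of parallel edges: when [t >= 2], a vertex has at least four
   edges outside a given class. If all of them went to one neighbour, the two gadgets, each divided
   by cutting one edge, could be arranged into a cut of size 2. *)
From Stdlib Require Import Classical.
Require Import Defs.
From mathcomp Require Import all_boot.
From mathcomp Require Import zify.
Set Implicit Arguments. Unset Strict Implicit. Unset Printing Implicit Defensive.

(* Linear arithmetic after generalizing the booleans cast to [nat], which makes [lia] fast. *)
Ltac genb := rewrite ?eqxx /=; repeat match goal with
  |- context [nat_of_bool ?b] => let t := fresh in generalize (leq_b1 b); set t := nat_of_bool b; clearbody t end; clear; lia.

(** * Multigraphs as lists of edges *)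

(* (identifier, end, end) *)
Definition edge := (nat * nat * nat)%type.

(** Degrees, cuts, inner edges and multiplicities are all instances of this one sum, so additivity,
    monotonicity and invariance under [eqg] come once. Labels and matchings are predicates on
    identifiers, hence an edge keeps both when a surgery moves its ends. *)
Fixpoint esum (f : nat -> nat -> nat -> nat) (G : seq edge) : nat :=
  if G is (k, u, w) :: G' then f k u w + esum f G' else 0.

Definition dg (M : pred nat) (v : nat) :=
  esum (fun k u w => (M k && (u == v)) + (M k && (w == v))).
Definition cut (M : pred nat) (A : pred nat) :=
  esum (fun k u w => M k && (A u != A w)).
Definition ins (M : pred nat) (A : pred nat) :=
  esum (fun k u w => M k && (A u && A w)).
Definition cnt (M : pred nat) := esum (fun k _ _ => M k).

Notation deg := (dg xpredT).

Section CubicGraphs.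
Implicit Types (M A : pred nat) (G H : seq edge).

Lemma dgE M v k u w G :
  dg M v ((k, u, w) :: G) = (M k && (u == v)) + (M k && (w == v)) + dg M v G.
Proof. by []. Qed.
Lemma cutE M A k u w G :
  cut M A ((k, u, w) :: G) = (M k && (A u != A w)) + cut M A G.
Proof. by []. Qed.
Lemma insE M A k u w G :
  ins M A ((k, u, w) :: G) = (M k && (A u && A w)) + ins M A G.
Proof. by []. Qed.
Lemma cntE M k u w G : cnt M ((k, u, w) :: G) = M k + cnt M G.
Proof. by []. Qed.
Lemma dg_nil M v : dg M v [::] = 0. Proof. by []. Qed.
Lemma cut_nil M A : cut M A [::] = 0. Proof. by []. Qed.
Lemma ins_nil M A : ins M A [::] = 0. Proof. by []. Qed.
Lemma cnt_nil M : cnt M [::] = 0. Proof. by []. Qed.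
Lemma esum_cat f G1 G2 : esum f (G1 ++ G2) = esum f G1 + esum f G2.
Proof. by elim: G1 => //= -[[k u] w] G ->; rewrite addnA. Qed.
Lemma dg_cat M v G1 G2 : dg M v (G1 ++ G2) = dg M v G1 + dg M v G2.
Proof. exact: esum_cat. Qed.
Lemma cut_cat M A G1 G2 : cut M A (G1 ++ G2) = cut M A G1 + cut M A G2.
Proof. exact: esum_cat. Qed.
Lemma ins_cat M A G1 G2 : ins M A (G1 ++ G2) = ins M A G1 + ins M A G2.
Proof. exact: esum_cat. Qed.
Lemma cnt_cat M G1 G2 : cnt M (G1 ++ G2) = cnt M G1 + cnt M G2.
Proof. exact: esum_cat. Qed.
Definition catE := (dg_cat, cut_cat, ins_cat, cnt_cat).
Definition nilE := (dg_nil, cut_nil, ins_nil, cnt_nil).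
Definition sumE := (dgE, cutE, insE, cntE, nilE, catE).

Lemma eq_esum f g G :
  (forall k u w, (k, u, w) \in G -> f k u w = g k u w) -> esum f G = esum g G.
Proof.
elim: G => //= -[[k u] w] G IH fg; rewrite fg ?mem_head // IH // => k' u' w' h.
by apply: fg; rewrite inE h orbT.
Qed.

Lemma mem_esum f G k u w : (k, u, w) \in G -> f k u w <= esum f G.
Proof.
elim: G => //= -[[k' u'] w'] G IH; rewrite inE => /orP[/eqP[-> -> ->]|/IH h]; lia.
Qed.

Lemma mem_cnt M G k u w : (k, u, w) \in G -> M k -> 0 < cnt M G.
Proof. by move=> /(mem_esum (fun k _ _ => M k)) h Mk; apply: leq_trans h; rewrite Mk. Qed.

Lemma mem_id G k u w : (k, u, w) \in G -> 0 < cnt (pred1 k) G.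
Proof. by move=> h; apply: mem_cnt h _; rewrite /= eqxx. Qed.

Lemma mem_deg G k u w : (k, u, w) \in G -> 0 < deg u G /\ 0 < deg w G.
Proof.
by move=> h; split; apply: leq_trans (mem_esum _ h); rewrite /= eqxx; lia.
Qed.

Lemma cnt_mem M G : 0 < cnt M G -> exists k u w, (k, u, w) \in G /\ M k.
Proof.
elim: G => //= -[[k u] w] G IH; rewrite cntE; case Mk: (M k) => /=.
  by exists k, u, w; rewrite mem_head.
by move=> /IH[k' [u' [w' [h ?]]]]; exists k', u', w'; rewrite inE h orbT.
Qed.

(* Graphs are compared up to reordering and reversing edges, i.e. by all
   orientation-independent sums over their edges. *)
Definition eqg G1 G2 :=
  forall f, (forall k u w, f k u w = f k w u) -> esum f G1 = esum f G2.

Lemma eqg_sym G1 G2 : eqg G1 G2 -> eqg G2 G1.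
Proof. by move=> h f fs; rewrite h. Qed.
Lemma eqg_trans G2 G1 G3 : eqg G1 G2 -> eqg G2 G3 -> eqg G1 G3.
Proof. by move=> h1 h2 f fs; rewrite h1 // h2. Qed.

Lemma eqg_dg G1 G2 M v : eqg G1 G2 -> dg M v G1 = dg M v G2.
Proof. by apply=> k u w; rewrite addnC. Qed.
Lemma eqg_cut G1 G2 M A : eqg G1 G2 -> cut M A G1 = cut M A G2.
Proof. by apply=> k u w; rewrite eq_sym. Qed.
Lemma eqg_ins G1 G2 M A : eqg G1 G2 -> ins M A G1 = ins M A G2.
Proof. by apply=> k u w; rewrite (andbC (A u)). Qed.
Lemma eqg_cnt G1 G2 M : eqg G1 G2 -> cnt M G1 = cnt M G2.
Proof. by apply. Qed.

Lemma pull M v G : 0 < dg M v G -> exists k u H, M k /\ eqg G ((k, v, u) :: H).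
Proof.
elim: G => //= -[[k u] w] G IH; rewrite dgE.
case: (boolP (M k && (u == v))) => [/andP[Mk /eqP ->] _|n1]; first by exists k, w, G.
case: (boolP (M k && (w == v))) => [/andP[Mk /eqP ->] _|n2].
  by exists k, u, G; split=> // f fs /=; rewrite fs.
move=> h; have /IH[k' [u' [H [Mk' e]]]] : 0 < dg M v G by lia.
exists k', u', ((k, u, w) :: H); split=> // f fs /=.
by rewrite (e _ fs) /=; lia.
Qed.

(** A chosen edge contributes once for each end in [A]: twice if it lies inside, once if it crosses.
    Parity arguments and the computation of cuts from inner edges rest on this. *)
Lemma handshake (W : seq nat) M A G : uniq W -> (forall v, v \notin W -> deg v G = 0) ->
  \sum_(v <- W | A v) dg M v G = 2 * ins M A G + cut M A G.
Proof.
move=> uW; have h1 u : u \in W -> \sum_(v <- W | A v) (u == v : nat) = A u.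
  move=> uin; rewrite big_mkcond (bigD1_seq u) //= eqxx big1_seq; first by case: (A u).
  by move=> v /andP[vu _]; rewrite eq_sym (negbTE vu); case: (A v).
elim: G => [_|[[k u] w] G IH dW]; first by rewrite big1 // => v _; rewrite sumE.
have uw : (u \in W) && (w \in W).
  apply/andP; split; apply/negPn/negP => /dW; rewrite dgE eqxx /=; lia.
case/andP: uw => uin win.
have dW' v : v \notin W -> deg v G = 0 by move=> /dW; rewrite dgE; lia.
rewrite !sumE; under eq_bigr do rewrite dgE.
rewrite !big_split /= IH //.
case: (M k) => /=; last by rewrite !big1_eq; lia.
by rewrite !h1 //; lia.
Qed.

(** A 3-edge-connected cubic multigraph on the vertices [W]. A side of a cut is any predicate on
    vertex names; only its trace on [W] counts, so [wf_cut] asks for a vertex of [W] on each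
    side. *)
Record wf (W : seq nat) (G : seq edge) : Prop := Wf {
  wf_uniq : uniq W;
  wf_deg : forall v, deg v G = 3 * (v \in W);
  wf_ids : forall k, cnt (pred1 k) G <= 1;
  wf_cut : forall (A : pred nat) u w, u \in W -> w \in W -> A u -> ~~ A w -> 3 <= cut xpredT A G }.

Lemma cubic_handshake W G A : uniq W -> (forall v, deg v G = 3 * (v \in W)) ->
  3 * count A W = 2 * ins xpredT A G + cut xpredT A G.
Proof.
move=> uW dW; rewrite -(@handshake W) //; last by move=> v vW; rewrite dW (negbTE vW).
rewrite big_seq_cond (eq_bigr (fun _ => 3)); last first.
  by move=> v /andP[vW _]; rewrite dW vW.
by rewrite -big_seq_cond big_const_seq iter_addn_0.
Qed.

Lemma wf_handshake W G A : wf W G -> 3 * count A W = 2 * ins xpredT A G + cut xpredT A G.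
Proof. by move=> wG; apply: cubic_handshake; [apply: wf_uniq wG|apply: wf_deg wG]. Qed.

(** As [x] is matched by [i], the link [i1] is not in [M'], and [i2] alone decides: if the link from
    [d] to [c2] is used, it is replaced by [i2] and [i5]; otherwise [i3] matches [b] with [c]. So
    exactly one of [i3] and [i5] is used, whatever [M'] is. Links inherit identifiers of deleted
    edges, which keeps identifiers unique. *)
Lemma lift (i x y i1 b i2 d i3 c i4 c1 i5 c2 : nat) H M' :
  let G := [:: (i, x, y), (i1, x, b), (i2, b, d), (i3, b, c), (i4, c, c1), (i5, c, c2) & H] in
  let G' := [:: (i, x, y), (i1, x, c1), (i2, d, c2) & H] in
  (forall k, cnt (pred1 k) G <= 1) -> deg b H = 0 -> deg c H = 0 -> b != c ->
  b \notin [:: x; y; d; c1; c2] -> c \notin [:: x; y; d; c1; c2] ->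
  M' i -> dg M' x G' = 1 ->
  exists M : pred nat,
    [/\ M i /\ ~~ M i1, forall v, dg M v G = if v \in [:: b; c] then 1 else dg M' v G',
        forall k u w, (k, u, w) \in H -> M k = M' k,
        M i3 = ~~ M' i2 & M i5 = M' i2].
Proof.
move=> G G' ids b0 c0 bc; rewrite !inE !negb_or => /and5P[bx b_y bd bc1 bc2].
move=> /and5P[cx c_y cd cc1 cc2] M'i; rewrite !dgE M'i eqxx /= => dx.
have idi k : (i == k) + (i1 == k) + (i2 == k) + (i3 == k) + (i4 == k) + (i5 == k)
   + cnt (pred1 k) H <= 1 by have := ids k; rewrite !cntE /=; lia.
pose M k := if k == i3 then ~~ M' i2 else if k == i5 then M' i2 else
            if k == i4 then false else M' k.
have [i_3 i_4 i_5] : [/\ i != i3, i != i4 & i != i5].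
  by split; apply/eqP => h; have := idi i; rewrite h; clear; genb.
have [i13 i14 i15] : [/\ i1 != i3, i1 != i4 & i1 != i5].
  by split; apply/eqP => h; have := idi i1; rewrite h; clear; genb.
have [i23 i24 i25] : [/\ i2 != i3, i2 != i4 & i2 != i5].
  by split; apply/eqP => h; have := idi i2; rewrite h; clear; genb.
have [i43 i45 i53] : [/\ i4 != i3, i4 != i5 & i5 != i3].
  split; apply/eqP => h; [have := idi i4|have := idi i4|have := idi i5]; rewrite h; clear; genb.
have MH0 k u w : (k, u, w) \in H -> M k = M' k.
  move=> kH; have h1 := mem_id kH; rewrite /M.
  have [-> -> ->] // : [/\ (k == i3) = false, (k == i5) = false & (k == i4) = false].
  by split; apply/eqP => h; have := idi k; rewrite -h eqxx; move: h1; clear; genb.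
have MH v : dg M v H = dg M' v H by apply: eq_esum => k u w /MH0 ->.
have Mi : M i = true by rewrite /M (negbTE i_3) (negbTE i_4) (negbTE i_5).
have Mi1 : M i1 = false.
  rewrite /M (negbTE i13) (negbTE i14) (negbTE i15).
  by case h: (M' i1) => //; move: dx; rewrite h; clear; genb.
have M'i1 : M' i1 = false by move: Mi1; rewrite /M (negbTE i13) (negbTE i14) (negbTE i15).
have Mi2 : M i2 = M' i2 by rewrite /M (negbTE i23) (negbTE i24) (negbTE i25).
have Mi3 : M i3 = ~~ M' i2 by rewrite /M eqxx.
have Mi4 : M i4 = false by rewrite /M (negbTE i43) (negbTE i45) eqxx.
have Mi5 : M i5 = M' i2 by rewrite /M (negbTE i53) eqxx.
exists M; split=> //; first by rewrite Mi Mi1.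
move=> v; rewrite !dgE Mi Mi1 Mi2 Mi3 Mi4 Mi5 M'i M'i1 MH !inE.
have z b' : deg b' H = 0 -> dg M' b' H = 0.
  move=> h; apply/eqP; rewrite -leqn0 -h /dg; elim: (H) => //= -[[k u] w] H'; clear; case: (M' k) => /=; genb.
case: (eqVneq v b) => [->|vb] /=.
  rewrite (z _ b0) ?eqxx ![_ == b]eq_sym ?(negbTE bx) ?(negbTE b_y) ?(negbTE bd) ?(negbTE bc1).
  by rewrite ?(negbTE bc2) ?(negbTE bc); case: (M' i2).
case: (eqVneq v c) => [->|vc] /=.
  rewrite (z _ c0) ?eqxx ![_ == c]eq_sym ?(negbTE cx) ?(negbTE c_y) ?(negbTE cd) ?(negbTE cc1).
  by rewrite ?(negbTE cc2) ?(negbTE bc); case: (M' i2).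
rewrite !andbF.
by case: (M' i2) => /=; genb.
Qed.

Lemma leq_esum f g G : (forall k u w, f k u w <= g k u w) -> esum f G <= esum g G.
Proof. by move=> h; elim: G => //= -[[k u] w] G IH; rewrite leq_add. Qed.

Lemma esumD f g G : esum (fun k u w => f k u w + g k u w) G = esum f G + esum g G.
Proof. by elim: G => //= -[[k u] w] G ->; lia. Qed.

Definition mul (a b : nat) :=
  esum (fun _ u w => ((u == a) && (w == b)) || ((u == b) && (w == a)) : nat).
Definition loops := esum (fun _ u w => u == w : nat).

Lemma mulE a b k u w G :
  mul a b ((k, u, w) :: G) = (((u == a) && (w == b)) || ((u == b) && (w == a))) + mul a b G.
Proof. by []. Qed.
Lemma loopsE k u w G : loops ((k, u, w) :: G) = (u == w) + loops G.
Proof. by []. Qed.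
Lemma eqg_mul a b G1 G2 : eqg G1 G2 -> mul a b G1 = mul a b G2.
Proof. by apply=> k u w; rewrite orbC (andbC (w == a)) (andbC (w == b)). Qed.
Lemma eqg_loops G1 G2 : eqg G1 G2 -> loops G1 = loops G2.
Proof. by apply=> k u w; rewrite eq_sym. Qed.

Lemma mulC a b G : mul a b G = mul b a G.
Proof. by apply: eq_esum => k u w _; rewrite orbC. Qed.

Lemma eqg_cons e G1 G2 : eqg G1 G2 -> eqg (e :: G1) (e :: G2).
Proof. by case: e => [[k u] w] h f fs /=; rewrite h. Qed.
Lemma eqg_swap e1 e2 G : eqg (e1 :: e2 :: G) (e2 :: e1 :: G).
Proof. by case: e1 => [[k u] w]; case: e2 => [[k' u'] w'] f fs /=; lia. Qed.
Lemma eqg_flip k u w G : eqg ((k, u, w) :: G) ((k, w, u) :: G).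
Proof. by move=> f fs /=; rewrite fs. Qed.

(* Proves that [G] and a reordering of it agree, from [E : eqg G _] and [e : eqg H _]. *)
Ltac regraph E e := let f := fresh in let fs := fresh in intros f fs; rewrite (E f fs) /= ?(e f fs) /=;
  repeat match goal with |- context [f ?k ?a ?b] => match goal with |- context [f k b a] =>
    tryif constr_eq a b then fail else rewrite (fs k a b) end end; clear; lia.

Ltac distinct := repeat match goal with
  | h : is_true (?a != ?b) |- context [?a == ?b] => rewrite (negbTE h)
  | h : is_true (?a != ?b) |- context [?b == ?a] => rewrite [b == a]eq_sym (negbTE h) end.

Lemma cutC M A G : cut M (predC A) G = cut M A G.
Proof. by apply: eq_esum => k u w _ /=; case: (A u); case: (A w). Qed.

Lemma eq_cut M A A' G : (forall v, 0 < deg v G -> A v = A' v) -> cut M A G = cut M A' G.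
Proof. by move=> h; apply: eq_esum => k u w /mem_deg[hu hw]; rewrite !h. Qed.
Lemma eq_ins M A A' G : (forall v, 0 < deg v G -> A v = A' v) -> ins M A G = ins M A' G.
Proof. by move=> h; apply: eq_esum => k u w /mem_deg[hu hw]; rewrite !h. Qed.

Lemma dg_le M v G : dg M v G <= deg v G.
Proof. by apply: leq_esum => k u w; case: (M k) => /=; clear; genb. Qed.

(** * Small cuts and short cycles in 3-edge-connected cubic graphs *)

Section Wf.
Variables (W : seq nat) (G : seq edge).
Hypothesis wG : wf W G.

Lemma wf_in v : (0 < deg v G) = (v \in W).
Proof. by rewrite (wf_deg wG); case: (v \in W). Qed.

Lemma wf_mem k u w H : eqg G ((k, u, w) :: H) -> u \in W /\ w \in W.
Proof.
by move=> e; split; rewrite -wf_in (eqg_dg _ _ e) dgE eqxx /=; clear; genb.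
Qed.

Lemma count_split A : count A W + count (predC A) W = size W.
Proof. exact: count_predC. Qed.

Lemma wf_cut_count A : 0 < count A W -> count A W < size W -> 3 <= cut xpredT A G.
Proof.
rewrite -has_count => /hasP[u uW Au]; rewrite -(count_predC A) -{1}[count A W]addn0 ltn_add2l.
by rewrite -has_count => /hasP[w wW Aw]; apply: wf_cut wG _ _ _ uW wW Au Aw.
Qed.

Lemma count_seq s : uniq s -> {subset s <= W} -> count (mem s) W = size s.
Proof.
move=> us sW; rewrite -size_filter; apply: perm_size; apply: uniq_perm => //.
  by rewrite filter_uniq // (wf_uniq wG).
by move=> v; rewrite mem_filter /=; case: (boolP (v \in s)) => //= /(sW v).
Qed.

Lemma wf_size_even : exists m, size W = 2 * m.
Proof.
have := wf_handshake (fun _ => true) wG; rewrite count_predT.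
have -> : cut xpredT (fun _ => true) G = 0 by elim: (G) => //= -[[k u] w].
by move=> h; exists ((size W)./2); lia.
Qed.

(** A vertex with a loop would be separated by its one remaining edge. *)
Lemma wf_loops : 2 <= size W -> loops G = 0.
Proof.
move=> s2; apply/eqP; rewrite -leqn0 leqNgt; apply/negP => h.
have [k [u [H e]]] : exists k u H, eqg G ((k, u, u) :: H).
  elim: (G) h => //= -[[k u] w] G' IH; rewrite loopsE; case: (eqVneq u w) => [-> _|_ /IH].
    by exists k, w, G'.
  by move=> [k' [u' [H e]]]; exists k', u', ((k, u, w) :: H) => f fs /=; rewrite e //=; lia.
have [uW _] := wf_mem e.
have c1 : count (mem [:: u]) W = 1 by rewrite count_seq // => v; rewrite inE => /eqP ->.
have := wf_handshake (mem [:: u]) wG; have := @wf_cut_count (mem [:: u]); rewrite c1 => /(_ isT s2).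
rewrite (eqg_ins _ _ e) insE !inE eqxx /=; clear; genb.
Qed.

(** Two parallel edges leave at most [6 - 4 = 2] edges around their ends, which is too few for a cut
    unless these ends are all of [W]. *)
Lemma wf_mul a b : 3 <= size W -> a != b -> mul a b G <= 1.
Proof.
move=> s3 ab; case: (boolP ((a \in W) && (b \in W))) => [/andP[aW bW]|nW]; last first.
  suff -> : mul a b G = 0 by [].
  apply/eqP; rewrite -leqn0 leqNgt; apply: contra nW => h.
  rewrite -!wf_in; apply/andP; split; apply: leq_trans h _; apply: leq_esum => k u w;
    by case: (u == a); case: (u == b); case: (w == a); case: (w == b).
have c2 : count (mem [:: a; b]) W = 2.
  by rewrite count_seq //= ?inE ?ab // => v; rewrite !inE => /orP[] /eqP ->.
have := wf_handshake (mem [:: a; b]) wG.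
have := @wf_cut_count (mem [:: a; b]); rewrite c2 => /(_ isT s3).
have : mul a b G <= ins xpredT (mem [:: a; b]) G.
  apply: leq_esum => k u w; rewrite !inE /=.
  by case: (u == a); case: (u == b); case: (w == a); case: (w == b).
lia.
Qed.

(** By the degree count, a side with at most two vertices and at most four cut edges is empty, a
    single vertex, or the two ends of an edge: only trivial small cuts are left. *)
Definition NT := forall A, cut xpredT A G <= 4 -> count A W <= 2 \/ count (predC A) W <= 2.

(** With [k] vertices and at least [k] inner edges the cut has at most [3 * k - 2 * k = k <= 4]
    edges, while both sides have at least three vertices. The cases of interest are triangles and
    squares. *)
Lemma NT_dense s : NT -> uniq s -> {subset s <= W} -> 2 < size s <= 4 -> size s + 3 <= size W ->
  ins xpredT (mem s) G < size s.
Proof.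
move=> nt us sW ss sz; have cs := count_seq us sW; rewrite ltnNge; apply/negP => h.
have := wf_handshake (mem s) wG; rewrite cs => hs.
have := count_split (mem s); rewrite cs => hc.
have /nt[] : cut xpredT (mem s) G <= 4 by lia.
  by rewrite cs; lia.
by lia.
Qed.

Lemma mul_mem a b : 0 < mul a b G -> a \in W /\ b \in W.
Proof.
move=> h; rewrite -!wf_in; split; apply: leq_trans h _; apply: leq_esum => k u w;
    by case: (u == a); case: (u == b); case: (w == a); case: (w == b).
Qed.

Lemma mul_neq u v : 2 <= size W -> 0 < mul u v G -> u != v.
Proof.
move=> /wf_loops l0 h; apply/eqP => uv; suff : 0 < loops G by rewrite l0.
apply: leq_trans h _; apply: leq_esum => k a b; rewrite -uv.
by rewrite orbb; case: (eqVneq a u) => //= ->; rewrite eq_sym.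
Qed.

Lemma no_parallel u v : 3 <= size W -> 2 <= mul u v G -> False.
Proof. by move=> s3 h; have := wf_mul s3 (mul_neq (ltnW s3) (ltnW h)); rewrite leqNgt h. Qed.

Lemma triangle a b c : NT -> 6 <= size W ->
  0 < mul a b G -> 0 < mul b c G -> 0 < mul c a G -> False.
Proof.
move=> nt sz hab hbc hca.
have [aW bW] := mul_mem hab; have [_ cW] := mul_mem hbc.
have ab : a != b by apply: mul_neq; first lia.
have bc : b != c by apply: mul_neq; first lia.
have ca : c != a by apply: mul_neq; first lia.
have /= := @NT_dense [:: a; b; c] nt; rewrite !inE negb_or ab bc (eq_sym a c) ca /=.
move=> /(_ isT) h; have : ins xpredT (mem [:: a; b; c]) G < 3.
  by apply: h => //= v; rewrite !inE => /or3P[] /eqP ->.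
(* No edge joins two of the three pairs at once, so the multiplicities add up inside the triple. *)
suff : mul a b G + mul b c G + mul c a G <= ins xpredT (mem [:: a; b; c]) G by lia.
rewrite -!esumD; apply: leq_esum => k u w; rewrite !inE; move: ab bc ca; clear => ab bc ca.
have e1 (z p q : nat) : p != q -> (z == p) && (z == q) = false.
  by move=> pq; case: (eqVneq z p) => // ->; apply: negbTE.
move: (e1 u _ _ ab) (e1 u _ _ bc) (e1 u _ _ ca) (e1 w _ _ ab) (e1 w _ _ bc) (e1 w _ _ ca).
by case: (u == a); case: (u == b); case: (u == c) => //=;
   case: (w == a); case: (w == b); case: (w == c).
Qed.

Lemma square a b c d : NT -> 8 <= size W -> a != c -> b != d ->
  0 < mul a b G -> 0 < mul b c G -> 0 < mul c d G -> 0 < mul d a G -> False.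
Proof.
move=> nt sz ac bd hab hbc hcd hda.
have [aW bW] := mul_mem hab; have [_ cW] := mul_mem hbc; have [_ dW] := mul_mem hcd.
have ab : a != b by apply: mul_neq; first lia.
have bc : b != c by apply: mul_neq; first lia.
have cd : c != d by apply: mul_neq; first lia.
have da : d != a by apply: mul_neq; first lia.
have /= := @NT_dense [:: a; b; c; d] nt; rewrite !inE !negb_or ab bc cd ac bd (eq_sym a d) da /=.
move=> /(_ isT) h; have : ins xpredT (mem [:: a; b; c; d]) G < 4.
  apply: h => //; last by clear -sz; lia.
  by move=> v; rewrite !inE => /or4P[] /eqP ->.
suff : mul a b G + mul b c G + mul c d G + mul d a G <= ins xpredT (mem [:: a; b; c; d]) G by lia.
rewrite -!esumD; apply: leq_esum => k u w; rewrite !inE; move: ab bc cd da ac bd; clear => ab bc cd da ac bd.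
have e1 (z p q : nat) : p != q -> (z == p) && (z == q) = false.
  by move=> pq; case: (eqVneq z p) => // ->; apply: negbTE.
move: (e1 u _ _ ab) (e1 u _ _ bc) (e1 u _ _ cd) (e1 u _ _ da) (e1 u _ _ ac) (e1 u _ _ bd).
move: (e1 w _ _ ab) (e1 w _ _ bc) (e1 w _ _ cd) (e1 w _ _ da) (e1 w _ _ ac) (e1 w _ _ bd).
by case: (u == a); case: (u == b); case: (u == c); case: (u == d) => //=;
   case: (w == a); case: (w == b); case: (w == c); case: (w == d).
Qed.

End Wf.

Lemma pull_deg v G n : loops G = 0 -> deg v G = n.+1 ->
  exists k u H, [/\ eqg G ((k, v, u) :: H), u != v, loops H = 0 & deg v H = n].
Proof.
move=> l0 d; have /pull[k [u [H [_ e]]]] : 0 < deg v G by rewrite d.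
exists k, u, H; move: l0 d; rewrite (eqg_loops e) (eqg_dg _ _ e) loopsE dgE eqxx /=.
case: (eqVneq v u) => [->|]; first by [].
by by move=> vu l [d].
Qed.

Lemma pull2 v G : loops G = 0 -> deg v G = 2 ->
  exists k1 u1 k2 u2 H, [/\ eqg G [:: (k1, v, u1), (k2, v, u2) & H],
   loops H = 0 & deg v H = 0].
Proof.
move=> l0 /(pull_deg l0)[k1 [u1 [H1 [e1 _ l1 /(pull_deg l1)]]]].
move=> [k2 [u2 [H2 [e2 _ l2 d2]]]]; exists k1, u1, k2, u2, H2; split=> //.
exact: eqg_trans e1 (eqg_cons _ e2).
Qed.

Lemma leq_esum_in f g G :
  (forall k u w, (k, u, w) \in G -> f k u w <= g k u w) -> esum f G <= esum g G.
Proof.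
elim: G => //= -[[k u] w] G IH h; rewrite leq_add //; first by rewrite h ?mem_head.
by apply: IH => k' u' w' h'; rewrite h // inE h' orbT.
Qed.

(* Deleting vertices and inserting the links [L] keeps the graph 3-edge-connected: a small cut
   extends to a cut of [G] of size at most 4, whose small side can contain at most one link. *)
Section Links.
Variables (W : seq nat) (G : seq edge) (W1 : seq nat) (L H : seq edge).
Hypotheses (wG : wf W G) (nt : NT W G).
Hypotheses (W1W : {subset W1 <= W}) (uW1 : uniq W1).
Hypothesis dW1 : forall v, deg v (L ++ H) = 3 * (v \in W1).
Hypothesis HG : forall A, ins xpredT A H <= ins xpredT A G.
Hypothesis cutG : forall A, exists A' : pred nat,
  (forall v, v \in W1 -> A' v = A v) /\ cut xpredT A' G <= cut xpredT A (L ++ H) + 2.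
Hypothesis loopsL : loops L = 0.
Hypothesis Lnew : forall k p q, (k, p, q) \in L -> mul p q G = 0.
Hypothesis Lsimple : forall p q, mul p q L <= 1.

Let inW1 v : 0 < deg v (L ++ H) -> v \in W1.
Proof. by rewrite dW1; case: (v \in W1). Qed.

(** A link inside a side with at most two vertices has both of them as ends. Links join vertices not
    adjacent in [G] and are never parallel, so [G] has no edge inside this side and [L] just one. *)
Let ins_L A : count A W <= 2 -> 0 < ins xpredT A L ->
  [/\ 1 < count A W, ins xpredT A G = 0 & ins xpredT A L <= 1].
Proof.
move=> cA iA; have [k [p [q [pqL /andP[Ap Aq]]]]] :
    exists k p q, (k, p, q) \in L /\ A p && A q.
  move: iA; clear; elim: L => //= -[[k u] w] L' IH; rewrite insE /=.
  case Auw: (A u && A w) => /=; first by exists k, u, w; rewrite mem_head Auw.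
  by move=> /IH[k' [p [q [h1 h2]]]]; exists k', p, q; rewrite inE h1 orbT.
have [dp dq] := mem_deg pqL.
have pW : p \in W by apply/W1W/inW1; rewrite catE addn_gt0 dp.
have qW : q \in W by apply/W1W/inW1; rewrite catE addn_gt0 dq.
have pq : p != q.
  apply/eqP => e; have := mem_esum (fun _ u w => u == w : nat) pqL.
  by rewrite -/(loops L) loopsL e eqxx.
have c2 : count (mem [:: p; q]) W = 2.
  by rewrite (count_seq wG) //= ?inE ?pq // => v; rewrite !inE => /orP[] /eqP ->.
have Apq v : v \in W -> A v -> (v == p) || (v == q).
  move=> vW Av; apply/negPn/negP => n; suff : 3 <= count A W by move: cA; clear; lia.
  have : count (mem [:: v; p; q]) W <= count A W.
    by apply: sub_count => z; rewrite /= !inE => /or3P[] /eqP ->.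
  rewrite (count_seq wG) //=; first by rewrite !inE n pq.
  by move=> z; rewrite !inE => /or3P[] /eqP ->.
have ins_le G' : (forall v, 0 < deg v G' -> v \in W) -> ins xpredT A G' <= mul p q G' + loops G'.
  move=> G'W; rewrite /mul /loops -esumD; apply: leq_esum_in => k' u w /mem_deg[du dw] /=.
  case Auw: (A u && A w) => //; have /andP[Au Aw] := Auw.
  have := Apq _ (G'W _ du) Au; have := Apq _ (G'W _ dw) Aw.
  case: (eqVneq u w) => [|uw]; first by rewrite addn1.
  case/orP=> /eqP ew; rewrite ew in uw *; case/orP=> /eqP eu; rewrite eu in uw *;
    by rewrite ?eqxx ?orbT // in uw *.
split.
- by rewrite -c2; apply: sub_count => z; rewrite /= !inE => /orP[] /eqP ->.
- apply/eqP; rewrite -leqn0; apply: leq_trans (ins_le G _) _.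
    by move=> v; rewrite (wf_in wG).
  rewrite (Lnew pqL) (wf_loops wG) //; apply: leq_trans (_ : count (mem [:: p; q]) W <= _).
    by rewrite c2.
  exact: count_size.
- apply: leq_trans (ins_le L _) _; last by rewrite loopsL addn0 Lsimple.
  by move=> v dv; apply/W1W/inW1; rewrite catE addn_gt0 dv.
Qed.

(** On a side with [a <= 2] vertices the new cut has [3 * a] edges minus twice the inner ones.
    Without a link inside, there are no more inner edges than in [G], where the cut is at least 3;
    with a link inside, [a = 2] and it is the only inner edge, so the cut has 4 edges. *)
Let links_small A u w : u \in W1 -> w \in W1 -> A u -> ~~ A w ->
  count A W <= 2 -> cut xpredT A (L ++ H) <= 2 -> False.
Proof.
move=> uW wW Au Aw cA cA2.
pose B := [pred v | A v && (v \in W1)].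
have eB : forall v, 0 < deg v (L ++ H) -> A v = B v by move=> v /inW1 h; rewrite /= h andbT.
have cB : count B W <= 2.
  by apply: leq_trans cA; apply: sub_count => v /andP[].
have cBW : count B W = count A W1.
  rewrite -!size_filter; apply: perm_size; apply: uniq_perm.
  - by rewrite filter_uniq // (wf_uniq wG).
  - by rewrite filter_uniq.
  move=> v; rewrite !mem_filter /= -andbA; case: (A v) => //=.
  by case: (boolP (v \in W1)) => //= /W1W ->.
have c0 : 0 < count A W1 by rewrite -has_count; apply/hasP; exists u.
have cl : count B W < size W.
  rewrite -(count_predC B) -[count B W]addn0 -addnA ltn_add2l add0n -has_count.
  by apply/hasP; exists w; [apply: W1W|rewrite /= negb_and Aw].
have := cubic_handshake A uW1 dW1.
have := wf_handshake B wG.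
have := wf_cut_count wG (A := B); rewrite cBW => /(_ c0); rewrite -cBW => /(_ cl).
rewrite -cBW in c0.
have -> : ins xpredT A (L ++ H) = ins xpredT B (L ++ H) by apply: eq_ins.
rewrite catE; have := HG B; have := ins_L cB; case: (ins xpredT B L) => [_|n].
  by move: cB c0 cA2; clear; lia.
move=> /(_ isT)[]; move: cB c0 cA2; clear; lia.
Qed.

Lemma links_cut A u w : u \in W1 -> w \in W1 -> A u -> ~~ A w -> 3 <= cut xpredT A (L ++ H).
Proof.
move=> uW wW Au Aw; rewrite leqNgt; apply/negP; rewrite ltnS => c2.
have [A' [eA' cA']] := cutG A.
have e : cut xpredT A' (L ++ H) = cut xpredT A (L ++ H).
  by apply: eq_cut => v /inW1 /eA'.
have c4 : cut xpredT A' G <= 4 by move: cA' c2; clear; lia.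
case: (nt c4) => cA.
  by apply: (links_small uW wW) cA _; rewrite ?eA' // e.
by apply: (links_small wW uW) cA _; rewrite /= ?eA' ?negbK // cutC e.
Qed.
End Links.

Lemma mul_pair (a b a' b' p q : nat) : a != a' -> a != b' ->
  (((a == p) && (b == q)) || ((a == q) && (b == p))) +
  (((a' == p) && (b' == q)) || ((a' == q) && (b' == p))) <= 1.
Proof.
case: (eqVneq a p) => [<-|ap] /=; case: (eqVneq a q) => [<-|aq] //=.
- by move=> n1 n2; rewrite ![_ == a]eq_sym (negbTE n1) (negbTE n2) ?andbF /=; do ?case: (_ == _).
- by move=> n1 n2; rewrite ![_ == a]eq_sym (negbTE n1) (negbTE n2) ?andbF /=; do ?case: (_ == _).
- by move=> n1 n2; rewrite ![_ == a]eq_sym (negbTE n1) (negbTE n2) ?andbF /=; do ?case: (_ == _).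
- by case: (_ || _).
Qed.

Ltac adjt e := rewrite (eqg_mul _ _ e) !mulE ?eqxx /= ?orbT; genb.

Ltac adjh h e := rewrite (eqg_mul _ _ e) !mulE ?h ?eqxx /= ?orbT; genb.

(* The path [x b c] is deleted; its loose ends are joined by [x c1] and [d c2]. *)
Section Reduction.
Variables (W : seq nat) (G : seq edge) (i x y i1 b i2 d i3 c i4 c1 i5 c2 : nat) (H : seq edge).
Hypotheses (wG : wf W G) (nt : NT W G) (sW : 8 <= size W).
Hypothesis eG : eqg G [:: (i, x, y), (i1, x, b), (i2, b, d), (i3, b, c), (i4, c, c1), (i5, c, c2) & H].

Let W1 := [seq v <- W | v \notin [:: b; c]].
Let G1 := [:: (i, x, y), (i1, x, c1), (i2, d, c2) & H].

Let s2 : 2 <= size W. Proof. by move: sW; clear; lia. Qed.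
Let s3 : 3 <= size W. Proof. by move: sW; clear; lia. Qed.
Let s6 : 6 <= size W. Proof. by move: sW; clear; lia. Qed.
Let irr u v : 0 < mul u v G -> u != v := mul_neq wG s2.
Let par u v : 2 <= mul u v G -> False := no_parallel wG s3.

Lemma red_facts : [/\ b != c, deg b H = 0, deg c H = 0,
  b \notin [:: x; y; d; c1; c2] & c \notin [:: x; y; d; c1; c2]].
Proof.
have xb : 0 < mul x b G by adjt eG.
have bd : 0 < mul b d G by adjt eG.
have bc : 0 < mul b c G by adjt eG.
have cc1 : 0 < mul c c1 G by adjt eG.
have cc2 : 0 < mul c c2 G by adjt eG.
split.
- exact: irr.
- have := wf_deg wG b; rewrite (eqg_dg _ _ eG) !dgE; case: (b \in W); genb.
- have := wf_deg wG c; rewrite (eqg_dg _ _ eG) !dgE; case: (c \in W); genb.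
- rewrite !inE !negb_or; apply/and5P; split; first by rewrite eq_sym irr.
  + apply/eqP => h; apply: (@par x b); adjh h eG.
  + exact: irr.
  + apply/eqP => h; apply: (@par b c); adjh h eG.
  + apply/eqP => h; apply: (@par b c); adjh h eG.
- rewrite !inE !negb_or; apply/and5P; split; [| | |exact: irr|exact: irr].
  + apply/eqP => h; apply: (@par b c); adjh h eG.
  + apply/eqP => h; apply: (triangle wG nt s6 xb bc); adjh h eG.
  + apply/eqP => h; apply: (@par b c); adjh h eG.
Qed.

Lemma red_wf : wf W1 G1.
Proof.
have [bc b0 c0] := red_facts; rewrite !inE !negb_or => /and5P[bx b_y bd bc1 bc2].
move=> /and5P[cx c_y cd cc1 cc2].
have axb : 0 < mul x b G by adjt eG.
have abd : 0 < mul b d G by adjt eG.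
have abc : 0 < mul b c G by adjt eG.
have acc1 : 0 < mul c c1 G by adjt eG.
have acc2 : 0 < mul c c2 G by adjt eG.
have uW1 : uniq W1 by rewrite filter_uniq // (wf_uniq wG).
have dW1 v : deg v G1 = 3 * (v \in W1).
  rewrite mem_filter !inE; case: (eqVneq v b) => [->|vb] /=.
    by rewrite !dgE b0 ![_ == b]eq_sym (negbTE bx) (negbTE b_y) (negbTE bd) (negbTE bc1) (negbTE bc2).
  case: (eqVneq v c) => [->|vc] /=.
    by rewrite !dgE c0 ![_ == c]eq_sym (negbTE cx) (negbTE c_y) (negbTE cd) (negbTE cc1) (negbTE cc2).
  rewrite -(wf_deg wG) (eqg_dg _ _ eG) !dgE ![b == v]eq_sym ![c == v]eq_sym.
  rewrite (negbTE vb) (negbTE vc) /=; genb.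
split=> //.
  by move=> k; apply: leq_trans (wf_ids wG k); rewrite (eqg_cnt _ eG) !cntE; genb.
move=> A u w uW wW Au Aw.
have -> : cut xpredT A G1 = cut xpredT A ([:: (i1, x, c1); (i2, d, c2)] ++ (i, x, y) :: H).
  by rewrite !catE !cutE cut_nil; genb.
apply: (@links_cut W G W1 [:: (i1, x, c1); (i2, d, c2)] ((i, x, y) :: H)) uW wW Au Aw => //.
- by move=> v; rewrite mem_filter => /andP[].
- by move=> v; rewrite -dW1 !catE !dgE dg_nil; genb.
- by move=> A'; rewrite (eqg_ins _ _ eG) !insE; genb.
(* With [b] on the side of [d] and [c] on the side of [c2], the edge [b c] is cut exactly when the
   link [d c2] is, and only [x b] and [c c1] can be cut in addition. *)
- move=> A'; exists (fun v => if v == b then A' d else if v == c then A' c2 else A' v); split.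
    by move=> v; rewrite mem_filter !inE negb_or => /andP[/andP[/negbTE -> /negbTE ->]].
  rewrite (eqg_cut _ _ eG) !catE !cutE cut_nil !eqxx (eq_sym c b) (negbTE bc).
  rewrite ![_ == b]eq_sym (negbTE bx) (negbTE b_y) (negbTE bd) (negbTE bc1) (negbTE bc2).
  rewrite ![_ == c]eq_sym (negbTE cx) (negbTE c_y) (negbTE cd) (negbTE cc1) (negbTE cc2) /=.
  have -> : cut xpredT (fun v => if v == b then A' d else if v == c then A' c2 else A' v) H
     = cut xpredT A' H.
    apply: eq_cut => v dv; case: eqP dv => [->|_]; first by rewrite b0.
    by case: eqP => // ->; rewrite c0.
  rewrite eqxx /=; genb.
- rewrite !loopsE; case: (eqVneq x c1) => [e|_].
    by case: (triangle wG nt s6 axb abc); rewrite e.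
  case: (eqVneq d c2) => [e|//].
  by case: (triangle wG nt s6 abd (_ : 0 < mul d c G)); rewrite mulC // e.
(* An edge of [G] already in the place of a link would close the square [x b c c1] or [d b c c2]. *)
- move=> k p q; rewrite !inE => /orP[] /eqP[_ -> ->]; apply/eqP; rewrite -leqn0 leqNgt; apply/negP.
    move=> h; apply: (square wG nt sW _ bc1 axb abc acc1); first by rewrite eq_sym.
    by rewrite mulC.
  move=> h; apply: (square wG nt sW _ bc2 (_ : 0 < mul d b G) abc acc2).
  + by rewrite eq_sym.
  + by rewrite mulC.
  + by rewrite mulC.
- move=> p q; rewrite !mulE addn0; apply: mul_pair.
    by apply/eqP => h; apply: (@par x b); adjh h eG.
  apply/eqP => e; case: (triangle wG nt s6 axb abc); by rewrite e.
Qed.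
End Reduction.

(** The cut extension for the longer path: given the sides of the six outer neighbours, the four
    deleted vertices can be placed so that the nine edges at them exceed the three links by at most
    2. The witnesses are found by trying all sixteen placements in each of the 64 cases. *)
Lemma path_assignment (x d q u1 u2 p3 : bool) : exists b c p1 p2 : bool,
  (x != b) + (b != d) + (b != c) + (c != p1) + (c != q) + (p1 != u1) + (p1 != p2) +
  (p2 != u2) + (p2 != p3) <= (x != u2) + (u1 != p3) + (d != q) + 2.
Proof.
by case: x; case: d; case: q; case: u1; case: u2; case: p3;
   first [exists false, false, false, false; done | exists true, true, true, true; done
   | exists false, false, false, true; done | exists false, false, true, false; done
   | exists false, true, false, false; done | exists true, false, false, false; done
   | exists false, false, true, true; done | exists true, true, false, false; done
   | exists false, true, true, true; done | exists true, true, true, false; done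
   | exists true, false, false, true; done | exists false, true, true, false; done
   | exists true, false, true, true; done | exists true, true, false, true; done
   | exists true, false, true, false; done | exists false, true, false, true; done].
Qed.

(* The path [b c p1 p2] is deleted; its loose ends are joined by [x u2], [u1 p3] and [d q]. *)
Section Reduction2.
Variables (W : seq nat) (G : seq edge) (i x y i1 b i2 d i3 c i4 p1 i5 q i6 u1 i7 p2 i8 u2 i9 p3 : nat).
Variable H : seq edge.
Hypotheses (wG : wf W G) (nt : NT W G) (sW : 8 <= size W).
Hypothesis eG : eqg G [:: (i, x, y), (i1, x, b), (i2, b, d), (i3, b, c), (i4, c, p1), (i5, c, q),
  (i6, p1, u1), (i7, p1, p2), (i8, p2, u2), (i9, p2, p3) & H].
Hypotheses (yp2 : y != p2) (xu2 : x != u2) (xp3 : x != p3) (nxu2 : mul x u2 G = 0).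

Let rem := [:: b; c; p1; p2].
Let W1 := [seq v <- W | v \notin rem].
Let G1 := [:: (i, x, y), (i1, x, u2), (i6, u1, p3), (i2, d, q) & H].

Let s2 : 2 <= size W. Proof. by move: sW; clear; lia. Qed.
Let s3 : 3 <= size W. Proof. by move: sW; clear; lia. Qed.
Let s6 : 6 <= size W. Proof. by move: sW; clear; lia. Qed.
Let irr u v : 0 < mul u v G -> u != v := mul_neq wG s2.
Let par u v : 2 <= mul u v G -> False := no_parallel wG s3.
Let tri u v w : 0 < mul u v G -> 0 < mul v w G -> 0 < mul w u G -> False.
Proof. by move=> h1 h2 h3; apply: (triangle wG nt s6 h1 h2 h3). Qed.
Let sq u v w z : u != w -> v != z ->
  0 < mul u v G -> 0 < mul v w G -> 0 < mul w z G -> 0 < mul z u G -> False.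
Proof. by move=> n1 n2 h1 h2 h3 h4; apply: (square wG nt sW n1 n2 h1 h2 h3 h4). Qed.

(** Coincidences that would close a cycle of length at most 4 are impossible. Girth 5 does not
    exclude [y = p2] or [x = p3], which would close a 5-cycle [x b c p1 p2]; these have to be
    assumed, and likewise [xu2] and [nxu2], which concern a cycle of length 5 or 6 through [u2]. *)
Lemma red2_facts : [/\ uniq rem, forall v, v \in rem -> deg v H = 0,
  forall v, v \in rem -> v \notin [:: x; y; d; q; u1; u2; p3],
  u1 \notin [:: x; d; q] & x \notin [:: d; q; p3]].
Proof.
have xb : 0 < mul x b G by adjt eG.
have bd : 0 < mul b d G by adjt eG.
have bc : 0 < mul b c G by adjt eG.
have cp1 : 0 < mul c p1 G by adjt eG.
have cq : 0 < mul c q G by adjt eG.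
have pu1 : 0 < mul p1 u1 G by adjt eG.
have p12 : 0 < mul p1 p2 G by adjt eG.
have pu2 : 0 < mul p2 u2 G by adjt eG.
have p23 : 0 < mul p2 p3 G by adjt eG.
have b_c := irr bc; have c_p1 := irr cp1; have p_12 := irr p12.
have b_p1 : b != p1 by apply/eqP => h; apply: (@par b c); adjh h eG.
have c_p2 : c != p2 by apply/eqP => h; apply: (@par c p1); adjh h eG.
have b_p2 : b != p2 by apply/eqP => h; apply: (tri cp1 p12); rewrite -h.
have xc : x != c by apply/eqP => h; apply: (@par b c); adjh h eG.
have cd : c != d by apply/eqP => h; apply: (@par b c); adjh h eG.
have bq : b != q by apply/eqP => h; apply: (@par b c); adjh h eG.
have x_b := irr xb; have b_d := irr bd; have c_q := irr cq.
have p1_u1 := irr pu1; have p2_u2 := irr pu2; have p2_p3 := irr p23.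
have bu1 : b != u1 by apply/eqP => h; apply: (tri bc cp1); rewrite h.
have dp1 : p1 != d by apply/eqP => h; apply: (tri bc cp1); rewrite mulC h.
have qp1 : p1 != q by apply/eqP => h; apply: (@par c p1); adjh h eG.
have qp2 : p2 != q by apply/eqP => h; apply: (tri cp1 p12); rewrite mulC h.
have u1p2 : u1 != p2 by apply/eqP => h; apply: (@par p1 p2); adjh h eG.
have cu1 : c != u1 by apply/eqP => h; apply: (@par c p1); adjh h eG.
have p1u2 : p1 != u2 by apply/eqP => h; apply: (@par p1 p2); adjh h eG.
have p1p3 : p1 != p3 by apply/eqP => h; apply: (@par p1 p2); adjh h eG.
split.
- by rewrite /= !inE !negb_or b_c b_p1 b_p2 c_p1 c_p2 p_12.
- move=> v; rewrite !inE => /or4P[] /eqP ->.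
  + have := wf_deg wG b; rewrite (eqg_dg _ _ eG) !dgE; case: (b \in W); genb.
  + have := wf_deg wG c; rewrite (eqg_dg _ _ eG) !dgE; case: (c \in W); genb.
  + have := wf_deg wG p1; rewrite (eqg_dg _ _ eG) !dgE; case: (p1 \in W); genb.
  + have := wf_deg wG p2; rewrite (eqg_dg _ _ eG) !dgE; case: (p2 \in W); genb.
- move=> v; rewrite !inE => /or4P[] /eqP ->; rewrite !negb_or.
  + have by_ : b != y by apply/eqP => h; apply: (@par x b); adjh h eG.
    have bu2 : b != u2.
      by apply/eqP => h; apply: (sq b_p1 c_p2 bc cp1 p12); rewrite h.
    have bp3 : b != p3.
      by apply/eqP => h; apply: (sq b_p1 c_p2 bc cp1 p12); rewrite h.
    by rewrite eq_sym x_b by_ b_d bq bu1 bu2 bp3.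
  + have cy : c != y.
      by apply/eqP => h; apply: (tri xb bc); rewrite mulC h; adjt eG.
    have cu2 : c != u2 by apply/eqP => h; apply: (tri cp1 p12); rewrite h.
    have cp3 : c != p3 by apply/eqP => h; apply: (tri cp1 p12); rewrite h.
    by rewrite eq_sym xc cy cd c_q cu1 cu2 cp3.
  + have p1x : p1 != x by apply/eqP => h; apply: (tri xb bc); rewrite -h.
    have p1y : p1 != y.
      by apply/eqP => h; apply: (sq xc b_p1 xb bc cp1); rewrite mulC h; adjt eG.
    by rewrite p1x p1y dp1 qp1 p1_u1 p1u2 p1p3.
  + have p2x : p2 != x.
      by apply/eqP => h; apply: (sq b_p1 c_p2 bc cp1 p12); rewrite h.
    have p2d : p2 != d.
      by apply/eqP => h; apply: (sq b_p1 c_p2 bc cp1 p12); rewrite mulC h.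
    by rewrite p2x eq_sym yp2 p2d qp2 eq_sym u1p2 p2_u2 p2_p3.
- rewrite !inE !negb_or; apply/and3P; split.
  + by apply/eqP => h; apply: (sq xc b_p1 xb bc cp1); rewrite -h.
  + by apply/eqP => h; apply: (sq b_p1 cd bc cp1 (z := d)); rewrite -?h // mulC h.
  + by apply/eqP => h; apply: (tri cp1 pu1); rewrite mulC h.
rewrite !inE !negb_or xp3 andbT; apply/andP; split; apply/eqP => h.
  by apply: (@par x b); adjh h eG.
by apply: (tri xb bc); rewrite h.
Qed.

Lemma red2_wf : wf W1 G1.
Proof.
have [ur r0 rn] := red2_facts.
rewrite !inE !negb_or => /and3P[u1x u1d u1q] /and3P[xd xq _].
have rb : b \in rem by rewrite !inE eqxx.
have rc : c \in rem by rewrite !inE eqxx orbT.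
have rp1 : p1 \in rem by rewrite !inE eqxx !orbT.
have rp2 : p2 \in rem by rewrite !inE eqxx !orbT.
have := rn _ rb; rewrite !inE !negb_or.
case/and5P=> bx b_y b_d bq /and3P[bu1 bu2 bp3].
have := rn _ rc; rewrite !inE !negb_or.
case/and5P=> cx cy cd cq /and3P[cu1 cu2 cp3].
have := rn _ rp1; rewrite !inE !negb_or.
case/and5P=> p1x p1y p1d p1q /and3P[p1u1 p1u2 p1p3].
have := rn _ rp2; rewrite !inE !negb_or.
case/and5P=> p2x p2y p2d p2q /and3P[p2u1 p2u2 p2p3].
move: (ur); rewrite /= !inE !negb_or => /and4P[/and3P[bc bp1 bp2] /andP[cp1 cp2] p12 _].
have abd : 0 < mul b d G by adjt eG.
have abc : 0 < mul b c G by adjt eG.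
have acq : 0 < mul c q G by adjt eG.
have apu1 : 0 < mul p1 u1 G by adjt eG.
have ap12 : 0 < mul p1 p2 G by adjt eG.
have ap23 : 0 < mul p2 p3 G by adjt eG.
have u1p3 : u1 != p3 by apply/eqP => h; apply: (tri apu1 (w := p2)); rewrite mulC ?h // mulC.
have dq : d != q by apply/eqP => h; apply: (tri abc acq); rewrite mulC -h.
have uW1 : uniq W1 by rewrite filter_uniq // (wf_uniq wG).
have dW1 v : deg v G1 = 3 * (v \in W1).
  rewrite mem_filter; case: (boolP (v \in rem)) => /= vr.
    have := rn _ vr; rewrite !dgE r0 // !inE !negb_or.
    case/and5P=> /negbTE h1 /negbTE h2 /negbTE h3 /negbTE h4 /and3P[/negbTE h5 /negbTE h6 /negbTE h7].
    by rewrite ![_ == v]eq_sym h1 h2 h3 h4 h5 h6 h7.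
  move: vr; rewrite !inE !negb_or -(wf_deg wG) (eqg_dg _ _ eG) => /and4P[vb vc v1 v2].
  rewrite !dgE ![b == v]eq_sym ![c == v]eq_sym ![p1 == v]eq_sym ![p2 == v]eq_sym.
  rewrite (negbTE vb) (negbTE vc) (negbTE v1) (negbTE v2) /=; genb.
split=> //.
  by move=> k; apply: leq_trans (wf_ids wG k); rewrite (eqg_cnt _ eG) !cntE; genb.
move=> A u w uW wW Au Aw.
pose L := [:: (i1, x, u2); (i6, u1, p3); (i2, d, q)].
have -> : cut xpredT A G1 = cut xpredT A (L ++ (i, x, y) :: H).
  by rewrite !catE !cutE cut_nil; genb.
apply: (@links_cut W G W1 L ((i, x, y) :: H)) uW wW Au Aw => //.
- by move=> v; rewrite mem_filter => /andP[].
- by move=> v; rewrite -dW1 !catE !dgE dg_nil; genb.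
- by move=> A'; rewrite (eqg_ins _ _ eG) !insE; genb.
- move=> A'; have [vb [vc [v1 [v2]]]] := path_assignment (A' x) (A' d) (A' q) (A' u1) (A' u2) (A' p3).
  move=> le; pose B v := if v == b then vb else if v == c then vc else
    if v == p1 then v1 else if v == p2 then v2 else A' v.
  exists B; have BA v : v \notin rem -> B v = A' v.
    by rewrite !inE !negb_or => /and4P[/negbTE h1 /negbTE h2 /negbTE h3 /negbTE h4];
       rewrite /B h1 h2 h3 h4.
  split; first by move=> v; rewrite mem_filter => /andP[/BA].
  have dang v : v \in [:: x; y; d; q; u1; u2; p3] -> B v = A' v.
    by move=> h; apply: BA; apply/negP => /rn; rewrite h.
  have Bb : B b = vb by rewrite /B eqxx.
  have Bc : B c = vc by rewrite /B eq_sym (negbTE bc) eqxx.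
  have Bp1 : B p1 = v1 by rewrite /B eq_sym (negbTE bp1) eq_sym (negbTE cp1) eqxx.
  have Bp2 : B p2 = v2.
    by rewrite /B eq_sym (negbTE bp2) eq_sym (negbTE cp2) eq_sym (negbTE p12) eqxx.
  rewrite (eqg_cut _ _ eG) !catE !cutE cut_nil Bb Bc Bp1 Bp2 !dang ?inE ?eqxx ?orbT //.
  have -> : cut xpredT B H = cut xpredT A' H.
    apply: eq_cut => v dv; apply: BA; apply/negP => /r0 h; by rewrite h in dv.
  by move: le; clear; rewrite /=; genb.
- by rewrite !loopsE (negbTE xu2) (negbTE u1p3) (negbTE dq).
- move=> k a a'; rewrite !inE => /or3P[] /eqP[_ -> ->] //; apply/eqP; rewrite -leqn0 leqNgt; apply/negP => h.
    by apply: (sq (u := u1) (v := p1) (w := p2) (z := p3)); rewrite // 1?eq_sym // mulC.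
  by apply: (sq (u := d) (v := b) (w := c) (z := q)); rewrite // 1?eq_sym // mulC.
- move=> a a'; rewrite !mulE addn0.
  have := @mul_pair x u2 u1 p3 a a'; rewrite eq_sym u1x => /(_ isT xp3).
  have := @mul_pair x u2 d q a a' xd xq.
  have := @mul_pair u1 p3 d q a a' u1d u1q.
  by clear; genb.
Qed.
End Reduction2.

Implicit Types (c : nat -> nat) (W : seq nat) (i x y : nat).

(** * Matchings that hit all label classes *)

(* [c] labels edge identifiers, [0] means unlabelled; label classes are 2-regular but need not be
   connected. *)
Definition cl c j : pred nat := fun k => c k == j.
Definition reg c G := forall j v, 0 < j -> dg (cl c j) v G = 0 \/ dg (cl c j) v G = 2.
Definition unspanned c x y G := forall j, 0 < j -> dg (cl c j) x G = 0 \/ dg (cl c j) y G = 0.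
Definition hit c j M G := 0 < cnt (fun k => M k && (c k == j)) G.
Definition good c M G := forall j, 0 < j -> 0 < cnt (cl c j) G -> hit c j M G.
Definition nlab c := cnt (fun k => 0 < c k).
Definition pm W M G := forall v, v \in W -> dg M v G = 1.
Definition has_edge G i x y := exists H, eqg G ((i, x, y) :: H).

Definition solvable W G i x y c := exists M, [/\ M i, pm W M G & good c M G].

(** The weight 2 per vertex pays for the one new labelled edge that closing up a side of a
    4-edge-cut may create, as this step loses at least one vertex. Labelled edges are counted so
    that erasing a class from an unchanged graph is progress too. *)
Definition solvable_upto n := forall W G i x y c,
  2 * size W + nlab c G <= n -> wf W G -> has_edge G i x y -> reg c G -> unspanned c x y G ->
  solvable W G i x y c.

(** A class that is sure to be hit is erased before the induction hypothesis is applied; neither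
    [unspanned] nor [good] has to consider it any more. *)
Definition drop c j : nat -> nat := fun k => if c k == j then 0 else c k.

Lemma cl_drop c j l k : 0 < l -> cl (drop c j) l k = (l != j) && cl c l k.
Proof.
move=> l0; rewrite /cl /drop; case: (eqVneq (c k) j) => [->|nj].
  by rewrite ltn_eqF // (eq_sym j) andNb.
by case: (eqVneq l j) => // ->; rewrite (negbTE nj).
Qed.

Lemma eq_dg M M' v G : (forall k u w, (k, u, w) \in G -> M k = M' k) -> dg M v G = dg M' v G.
Proof. by move=> h; apply: eq_esum => k u w /h ->. Qed.
Lemma eq_cnt M M' G : (forall k u w, (k, u, w) \in G -> M k = M' k) -> cnt M G = cnt M' G.
Proof. by move=> h; apply: eq_esum => k u w /h ->. Qed.

Lemma dg_drop c j l v G : 0 < l -> dg (cl (drop c j) l) v G = if l == j then 0 else dg (cl c l) v G.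
Proof.
move=> l0; rewrite (@eq_dg _ (fun k => (l != j) && cl c l k)) => [|k u w _]; last exact: cl_drop.
by case: eqP => //= _; elim: (G) => // -[[k u] w] G' IH; rewrite dgE IH.
Qed.

Lemma reg_drop c j G : reg c G -> reg (drop c j) G.
Proof. by move=> h l v l0; rewrite dg_drop //; case: eqP => // _; [left|apply: h]. Qed.
Lemma unspanned_drop c j x y G : unspanned c x y G -> unspanned (drop c j) x y G.
Proof. by move=> h l l0; rewrite !dg_drop //; case: eqP => // _; [left|apply: h]. Qed.

Lemma nlab_drop c j G : 0 < j -> 0 < cnt (cl c j) G -> nlab (drop c j) G < nlab c G.
Proof.
move=> j0; suff : nlab (drop c j) G + cnt (cl c j) G = nlab c G by move=> <-; lia.
rewrite /nlab /cnt -esumD; apply: eq_esum => k u w _; rewrite /drop /cl.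
by case: eqP => [->|]; rewrite ?addn0 // j0.
Qed.

Lemma nlab_drop_le c j G : nlab (drop c j) G <= nlab c G.
Proof. by apply: leq_esum => k u w; rewrite /drop; case: eqP. Qed.

Lemma cnt_drop c j l G : 0 < l -> l != j -> cnt (cl (drop c j) l) G = cnt (cl c l) G.
Proof. by move=> l0 lj; apply: eq_cnt => k u w _; rewrite cl_drop // lj. Qed.

Lemma hit_drop c j l M G : 0 < l -> hit (drop c j) l M G -> hit c l M G.
Proof.
move=> l0 h; apply: leq_trans h _; apply: leq_esum => k u w.
by have := cl_drop c j k l0; rewrite /cl => ->; case: (M k); case: (l != j); case: (c k == l).
Qed.

Lemma good_drop c j M G : hit c j M G -> good (drop c j) M G -> good c M G.
Proof.
move=> hj h l l0 cl0; case: (eqVneq l j) => [->|lj] //.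
by apply: (hit_drop l0 (h l l0 _)); rewrite cnt_drop //.
Qed.

Lemma hit_eqg c j M G1 G2 : eqg G1 G2 -> hit c j M G1 = hit c j M G2.
Proof. by move=> e; rewrite /hit (eqg_cnt _ e). Qed.

Lemma deg3 W G k0 v u0 k1 u1 k2 u2 H : wf W G ->
  eqg G [:: (k0, v, u0), (k1, v, u1), (k2, v, u2) & H] ->
  forall M, dg M v G = M k0 + M k1 + M k2.
Proof.
move=> wG e M; have := wf_deg wG v; rewrite !(eqg_dg _ _ e) !dgE eqxx /=.
have := dg_le M v H.
by case: (u0 == v); case: (u1 == v); case: (u2 == v); case: (v \in W);
  case: (M k0); case: (M k1); case: (M k2) => /=; lia.
Qed.

Lemma pull3 W G k0 v u0 H : wf W G -> 2 <= size W -> eqg G ((k0, v, u0) :: H) ->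
  exists k1 u1 k2 u2 H', eqg H [:: (k1, v, u1), (k2, v, u2) & H'].
Proof.
move=> wG s2 e; have := wf_loops wG s2; rewrite (eqg_loops e) loopsE.
case: (eqVneq v u0) => // vu l0.
have d2 : deg v H = 2.
  have := wf_deg wG v; rewrite (eqg_dg _ _ e) dgE eqxx eq_sym (negbTE vu) /=.
  by case: (v \in W) => /=; lia.
have [k1 [u1 [k2 [u2 [H' [e' _ _]]]]]] := pull2 l0 d2.
by exists k1, u1, k2, u2, H'.
Qed.

(** A vertex of a class has two edges in the class and one outside it. If the outside edge [k] is
    unmatched, the vertex is matched along the class. *)
Lemma hit_at W G c M k v u H j : wf W G -> 2 <= size W -> eqg G ((k, v, u) :: H) -> pm W M G ->
  ~~ M k -> c k != j -> 0 < dg (cl c j) v G -> reg c G -> 0 < j -> hit c j M G.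
Proof.
move=> wG s2 e pM Mk ckj dj rc j0; have [k1 [u1 [k2 [u2 [H' e']]]]] := pull3 wG s2 e.
have e2 := eqg_trans e (eqg_cons _ e').
have [vW _] := wf_mem wG e.
have := pM v vW; rewrite (deg3 wG e2) (negbTE Mk) /=.
move: dj (rc j v j0); rewrite !(deg3 wG e2) /cl (negbTE ckj) /=.
rewrite (hit_eqg _ _ _ e2) /hit !cntE (negbTE Mk) /=.
by case: (c k1 == j); case: (c k2 == j); case: (M k1); case: (M k2) => //= _ [].
Qed.

Section Step.
Variables (n : nat) (W : seq nat) (G : seq edge) (i x y : nat) (c : nat -> nat).
Hypotheses (IH : solvable_upto n) (wG : wf W G) (eG : has_edge G i x y).
Hypotheses (rc : reg c G) (uc : unspanned c x y G).

Lemma solvable_autohit j : 2 * size W + nlab c G <= n.+1 -> 0 < j ->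
  (forall M, M i -> pm W M G -> 0 < cnt (cl c j) G -> hit c j M G) -> 0 < cnt (cl c j) G ->
  solvable W G i x y c.
Proof.
move=> sz j0 h cj; have [|M [Mi pM gM]] := @IH W G i x y (drop c j) _ wG eG (reg_drop _ rc) (unspanned_drop _ uc).
  by have := nlab_drop j0 cj; lia.
by exists M; split=> //; apply: good_drop gM; apply: h.
Qed.
End Step.

Lemma size_rem W s : uniq W -> uniq s -> {subset s <= W} -> size [seq v <- W | v \notin s] + size s = size W.
Proof.
move=> uW us sW; rewrite size_filter -(count_predC (mem s) W) addnC; congr addn.
rewrite -size_filter; apply: perm_size; apply: uniq_perm => //; first by rewrite filter_uniq.
by move=> v; rewrite mem_filter /=; case: (boolP (v \in s)) => //= /(sW v).
Qed.

(** All edges at the deleted path are unlabelled, so the classes of the reduced graph are those of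
    [G]. Two vertices vanish, which lowers the measure by 4. The last clause is the by-product of
    [lift] that hits an erased class containing [i3] and [i5]. *)
Lemma red_solvable n W G i x y i1 b i2 d i3 z i4 z1 i5 z2 H c :
  solvable_upto n -> wf W G -> NT W G -> 8 <= size W -> 2 * size W + nlab c G <= n.+4 ->
  eqg G [:: (i, x, y), (i1, x, b), (i2, b, d), (i3, b, z), (i4, z, z1), (i5, z, z2) & H] ->
  reg c G -> unspanned c x y G ->
  [/\ c i1 = 0, c i2 = 0, c i3 = 0, c i4 = 0 & c i5 = 0] ->
  exists M, [/\ M i, pm W M G, good c M G & M i3 = ~~ M i5].
Proof.
move=> IH wG nt sW sz eG rc uc [ci1 ci2 ci3 ci4 ci5].
have [bz b0 z0 bn zn] := red_facts wG nt sW eG.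
have wG1 := red_wf wG nt sW eG.
set W1 := [seq _ <- W | _] in wG1; set G1 := [:: _, _, _ & H] in wG1.
have bW : b \in W.
  by rewrite -(wf_in wG) (eqg_dg _ _ eG) !dgE; genb.
have zW : z \in W.
  by rewrite -(wf_in wG) (eqg_dg _ _ eG) !dgE; genb.
have sW1 : size W1 + 2 = size W.
  apply: (@size_rem W [:: b; z]); rewrite ?(wf_uniq wG) //= ?inE ?bz //.
  by move=> v; rewrite !inE => /orP[] /eqP ->.
have clG j : 0 < j -> forall v, dg (cl c j) v G1 = dg (cl c j) v G.
  by case: j => // j _ v; rewrite (eqg_dg _ _ eG) !dgE /cl ci1 ci2 ci3 ci4 ci5 /=; genb.
have [||j v j0|j j0|M' [M'i pM' gM']] := @IH W1 G1 i x y c _ wG1.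
- by move: sz; rewrite /nlab (eqg_cnt _ eG) !cntE ci1 ci2 ci3 ci4 ci5 -sW1; clear; lia.
- by exists [:: (i1, x, z1), (i2, d, z2) & H].
- by rewrite clG //; apply: rc.
- by rewrite !clG //; apply: uc.
have xW1 : x \in W1.
  have := wf_deg wG1 x; rewrite !dgE eqxx /=; case: (x \in W1) => //=; clear; lia.
have ids k : cnt (pred1 k) [:: (i, x, y), (i1, x, b), (i2, b, d), (i3, b, z), (i4, z, z1), (i5, z, z2) & H] <= 1.
  by rewrite -(eqg_cnt _ eG); apply: wf_ids wG _.
have [M [[Mi Mi1] dM MH Mi3 Mi5]] := lift ids b0 z0 bz bn zn M'i (pM' x xW1).
exists M; split=> //.
- move=> v vW; rewrite (eqg_dg _ _ eG) dM; case: ifP => // vn.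
  by apply: pM'; rewrite mem_filter vn.
- move=> j j0; rewrite (hit_eqg _ _ _ eG) (eqg_cnt _ eG) => cj.
  have : hit c j M' G1.
    apply: gM' => //; move: cj; rewrite !cntE /cl ci1 ci2 ci3 ci4 ci5.
    by move: j0; clear; case: j => // j _ /=; genb.
  rewrite /hit !cntE ci1 ci2 ci3 ci4 ci5 Mi M'i.
  rewrite (@eq_cnt (fun k => M k && (c k == j)) (fun k => M' k && (c k == j)) H); last first.
    by move=> k u w /MH ->.
  by move: j0; clear; case: j => // j _ /=; rewrite !andbF.
- by rewrite Mi3 Mi5.
Qed.

(** The reduction amounts to two reductions of a two-vertex path, undone one after the other: [p1]
    and [p2] return first, then [b] and [z]. The first lifting already puts one of [i7] and [i9]
    into the matching. *)
Lemma red2_solvable n W G i x y i1 b i2 d i3 z i4 p1 i5 q i6 u1 i7 p2 i8 u2 i9 p3 H c :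
  solvable_upto n -> wf W G -> NT W G -> 8 <= size W -> 2 * size W + nlab c G <= n.+4 ->
  eqg G [:: (i, x, y), (i1, x, b), (i2, b, d), (i3, b, z), (i4, z, p1), (i5, z, q),
         (i6, p1, u1), (i7, p1, p2), (i8, p2, u2), (i9, p2, p3) & H] ->
  y != p2 -> x != u2 -> x != p3 -> mul x u2 G = 0 ->
  reg c G -> unspanned c x y G ->
  [/\ c i1 = 0, c i2 = 0, c i3 = 0, c i4 = 0 & c i5 = 0] ->
  [/\ c i6 = 0, c i7 = 0, c i8 = 0 & c i9 = 0] ->
  exists M, [/\ M i, pm W M G, good c M G & [|| M i5, M i7 | M i9]].
Proof.
move=> IH wG nt sW sz eG yp2 xu2 xp3 nxu2 rc uc [ci1 ci2 ci3 ci4 ci5] [ci6 ci7 ci8 ci9].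
have [ur r0 rn u1n xn] := red2_facts wG nt sW eG yp2 xp3.
have wG1 := red2_wf wG nt sW eG yp2 xu2 xp3 nxu2.
set W1 := [seq _ <- W | _] in wG1; set G2 := [:: _, _, _, _ & H] in wG1.
pose rem := [:: b; z; p1; p2].
have remW : {subset rem <= W}.
  move=> v; rewrite -(wf_in wG) (eqg_dg _ _ eG) !dgE !inE => /or4P[] /eqP ->; genb.
have sW1 : size W1 + 4 = size W by apply: (@size_rem W rem); rewrite ?(wf_uniq wG).
have clG j : 0 < j -> forall v, dg (cl c j) v G2 = dg (cl c j) v G.
  by case: j => // j _ v; rewrite (eqg_dg _ _ eG) !dgE /cl ci1 ci2 ci3 ci4 ci5 ci6 ci7 ci8 ci9 /=; genb.
have [||j v j0|j j0|M' [M'i pM' gM']] := @IH W1 G2 i x y c _ wG1.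
- move: sz; rewrite /nlab (eqg_cnt _ eG) !cntE ci1 ci2 ci3 ci4 ci5 ci6 ci7 ci8 ci9 -sW1; clear; lia.
- by exists [:: (i1, x, u2), (i6, u1, p3), (i2, d, q) & H].
- by rewrite clG //; apply: rc.
- by rewrite !clG //; apply: uc.
have ids k : cnt (pred1 k) [:: (i, x, y), (i1, x, b), (i2, b, d), (i3, b, z), (i4, z, p1), (i5, z, q),
    (i6, p1, u1), (i7, p1, p2), (i8, p2, u2), (i9, p2, p3) & H] <= 1.
  by rewrite -(eqg_cnt _ eG); apply: wf_ids wG _.
have xW1 : x \in W1.
  have := wf_deg wG1 x; rewrite !dgE eqxx /=; case: (x \in W1) => //=; clear; lia.
have rb : b \in rem by rewrite !inE eqxx.
have rz : z \in rem by rewrite !inE eqxx orbT.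
have rp1 : p1 \in rem by rewrite !inE eqxx !orbT.
have rp2 : p2 \in rem by rewrite !inE eqxx !orbT.
have := rn _ rb; rewrite !inE !negb_or => /and5P[bx b_y b_d bq /and3P[bu1 bu2 bp3]].
have := rn _ rz; rewrite !inE !negb_or => /and5P[zx zy zd zq /and3P[zu1 zu2 zp3]].
have := rn _ rp1; rewrite !inE !negb_or => /and5P[p1x p1y p1d p1q /and3P[p1u1 p1u2 p1p3]].
have := rn _ rp2; rewrite !inE !negb_or => /and5P[p2x p2y p2d p2q /and3P[p2u1 p2u2 p2p3]].
move: (ur); rewrite /= !inE !negb_or => /and4P[/and3P[bz bp1 bp2] /andP[zp1 zp2] p12 _].
(* The intermediate graph contains [p1] and [p2], while [b] and [z] are still replaced by links. It
   may have small cuts, but [lift] asks only for degrees and identifiers. *)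
have ids2 k : cnt (pred1 k) [:: (i, x, y), (i1, x, p1), (i6, p1, u1), (i7, p1, p2), (i8, p2, u2),
    (i9, p2, p3), (i2, d, q) & H] <= 1.
  by apply: leq_trans (ids k); rewrite !cntE; genb.
have d1 : deg p1 ((i2, d, q) :: H) = 0.
  by rewrite !dgE r0 // ![_ == p1]eq_sym (negbTE p1d) (negbTE p1q).
have d2 : deg p2 ((i2, d, q) :: H) = 0.
  by rewrite !dgE r0 // ![_ == p2]eq_sym (negbTE p2d) (negbTE p2q).
have n1 : p1 \notin [:: x; y; u1; u2; p3] by rewrite !inE !negb_or p1x p1y p1u1 p1u2 p1p3.
have n2 : p2 \notin [:: x; y; u1; u2; p3] by rewrite !inE !negb_or p2x p2y p2u1 p2u2 p2p3.
have [M1 [[M1i M1i1] dM1 M1H M1i7 M1i9]] := lift ids2 d1 d2 p12 n1 n2 M'i (pM' x xW1).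
pose H1 := [:: (i6, p1, u1), (i7, p1, p2), (i8, p2, u2), (i9, p2, p3) & H].
have db : deg b H1 = 0.
  rewrite /H1 !dgE r0 // ![_ == b]eq_sym.
  by rewrite (negbTE bp1) (negbTE bu1) (negbTE bp2) (negbTE bu2) (negbTE bp3).
have dz : deg z H1 = 0.
  rewrite /H1 !dgE r0 // ![_ == z]eq_sym.
  by rewrite (negbTE zp1) (negbTE zu1) (negbTE zp2) (negbTE zu2) (negbTE zp3).
have nb : b \notin [:: x; y; d; p1; q] by rewrite !inE !negb_or bx b_y b_d bp1 bq.
have nz : z \notin [:: x; y; d; p1; q] by rewrite !inE !negb_or zx zy zd zp1 zq.
have dx : dg M1 x [:: (i, x, y), (i1, x, p1), (i2, d, q) & H1] = 1.
  have := dM1 x; rewrite !inE [x == p1]eq_sym [x == p2]eq_sym (negbTE p1x) (negbTE p2x) /=.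
  by rewrite (pM' x xW1) => <-; rewrite /H1 !dgE; genb.
have [M [[Mi Mi1] dM MH Mi3 Mi5]] := lift ids db dz bz nb nz M1i dx.
exists M; split=> //.
- move=> v vW; rewrite (eqg_dg _ _ eG) dM; case: ifP => // vn.
  have := dM1 v; case: ifP => vn'.
    by move=> <-; rewrite /H1 !dgE; genb.
  rewrite pM' => [<-|]; first by rewrite /H1 !dgE; genb.
  by move: vn vn'; rewrite mem_filter vW !inE andbT !negb_or => /negbT; rewrite negb_or => /andP[-> ->] /negbT; rewrite negb_or.
- move=> j j0; rewrite (hit_eqg _ _ _ eG) (eqg_cnt _ eG) => cj.
  have : hit c j M' G2.
    apply: gM' => //; move: cj; rewrite !cntE /cl ci1 ci2 ci3 ci4 ci5 ci6 ci7 ci8 ci9.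
    by move: j0; clear; case: j => // j _ /=; genb.
  rewrite /hit !cntE ci1 ci2 ci3 ci4 ci5 ci6 ci7 ci8 ci9 Mi M'i.
  rewrite (@eq_cnt (fun k => M k && (c k == j)) (fun k => M' k && (c k == j)) H); last first.
    by move=> k u w kH; rewrite (MH k u w) ?(M1H k u w) // !inE kH !orbT.
  by move: j0; clear; case: j => // j _ /=; rewrite !andbF.
- rewrite Mi5; have -> : M i7 = M1 i7 by apply: (MH _ p1 p2); rewrite !inE eqxx !orbT.
  have -> : M i9 = M1 i9 by apply: (MH _ p2 p3); rewrite !inE eqxx !orbT.
  by rewrite M1i7 M1i9 orNb orbT.
Qed.

(** [L] lists the edges exposed so far. Degree 1 in [L] says that [v] was just reached, so its two
    other edges are still in [H]; exploring the surroundings of the prescribed edge always proceeds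
    this way. *)
Lemma pull_next W G L H v : wf W G -> 2 <= size W -> v \in W -> deg v L = 1 -> eqg G (L ++ H) ->
  exists k1 u1 k2 u2 H', eqg H [:: (k1, v, u1), (k2, v, u2) & H'].
Proof.
move=> wG s2 vW dL e; have := wf_loops wG s2; rewrite (eqg_loops e).
rewrite /loops esum_cat => l0.
have d2 : deg v H = 2.
  by have := wf_deg wG v; rewrite (eqg_dg _ _ e) catE vW dL => -[].
have [|k1 [u1 [k2 [u2 [H' [e' _ _]]]]]] := pull2 _ d2; last by exists k1, u1, k2, u2, H'.
by apply/eqP; move: l0; rewrite /loops; clear; lia.
Qed.

Lemma lab3 (a b c : nat) : (forall j, 0 < j -> (a == j) + (b == j) + (c == j) = 0 \/
    (a == j) + (b == j) + (c == j) = 2) ->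
  [\/ [/\ a = 0, b = 0 & c = 0], [/\ a = 0, 0 < b & c = b],
      [/\ b = 0, 0 < a & c = a] | [/\ c = 0, 0 < a & b = a]].
Proof.
move=> h; case: (posnP a) => [a0|ap]; case: (posnP b) => [b0|bp]; case: (posnP c) => [c0|cp].
- by constructor 1.
- by have := h c cp; rewrite a0 b0 eqxx (ltn_eqF cp) => -[].
- by have := h b bp; rewrite a0 c0 eqxx (ltn_eqF bp) => -[].
- constructor 2; split=> //; have := h b bp; rewrite a0 eqxx (ltn_eqF bp).
  by case: (eqVneq c b) => // _ [].
- by have := h a ap; rewrite b0 c0 eqxx (ltn_eqF ap) => -[].
- constructor 3; split=> //; have := h a ap; rewrite b0 eqxx (ltn_eqF ap).
  by case: (eqVneq c a) => // _ [].
- constructor 4; split=> //; have := h a ap; rewrite c0 eqxx (ltn_eqF ap).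
  by case: (eqVneq b a) => // _ [].
- exfalso; have := h a ap; rewrite eqxx.
  case: (eqVneq b a) => [ba|nba]; case: (eqVneq c a) => [ca|nca] //=; try by case.
  + move=> _; have := h c cp; rewrite eqxx ba eq_sym (negbTE nca) /=; by case.
  + move=> _; have := h b bp; rewrite eqxx ca eq_sym (negbTE nba) /=; by case.
Qed.

(** Degree 3 leaves room for at most one class of degree 2, and the third edge then remains
    unlabelled. *)
Lemma labels_at W G k0 v u0 k1 u1 k2 u2 H c : wf W G ->
  eqg G [:: (k0, v, u0), (k1, v, u1), (k2, v, u2) & H] -> reg c G ->
  [\/ [/\ c k0 = 0, c k1 = 0 & c k2 = 0], [/\ c k0 = 0, 0 < c k1 & c k2 = c k1],
      [/\ c k1 = 0, 0 < c k0 & c k2 = c k0] | [/\ c k2 = 0, 0 < c k0 & c k1 = c k0]].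
Proof.
move=> wG e rc; apply: lab3 => j j0; have := rc j v j0.
by rewrite !(deg3 wG e).
Qed.

Lemma mem_eqg e G : e \in G -> exists H, eqg G (e :: H).
Proof.
elim: G => // e' G IH; rewrite inE => /orP[/eqP ->|/IH[H h]]; first by exists G.
by exists (e' :: H); apply: eqg_trans (eqg_cons _ h) (eqg_swap _ _ _).
Qed.

Lemma next_on_cycle W G L H v k0 u0 c j : wf W G -> reg c G -> 2 <= size W -> v \in W ->
  deg v L = 1 -> eqg G (L ++ H) -> (k0, u0, v) \in L -> c k0 = j -> 0 < j ->
  exists i1 d i2 z H', [/\ eqg H [:: (i1, v, d), (i2, v, z) & H'], c i1 = 0 & c i2 = j].
Proof.
move=> wG rc s2 vW dL e k0L ck0 j0.
have [k1 [u1 [k2 [u2 [H' e']]]]] := pull_next wG s2 vW dL e.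
have [L' eL] := mem_eqg k0L; have fL := eqg_trans eL (eqg_flip _ _ _ _).
have E : eqg G [:: (k0, v, u0), (k1, v, u1), (k2, v, u2) & L' ++ H'].
  by move=> f fs; rewrite (e f fs) esum_cat (fL f fs) (e' f fs) /= esum_cat; clear; lia.
case: (labels_at wG E rc) => -[h1 h2 h3]; try by rewrite -ck0 h1 in j0.
  by exists k1, u1, k2, u2, H'; rewrite h1 h3 ck0.
exists k2, u2, k1, u1, H'; rewrite h1 h3 ck0; split=> //; exact: eqg_trans e' (eqg_swap _ _ _).
Qed.

Lemma nbr_of W G k0 v u0 k1 u1 k2 u2 H w : wf W G ->
  eqg G [:: (k0, v, u0), (k1, v, u1), (k2, v, u2) & H] -> 0 < mul v w G ->
  w \in [:: u0; u1; u2].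
Proof.
move=> wG e; rewrite (eqg_mul _ _ e) !mulE !inE eqxx /=.
have dv : deg v H = 0.
  by have := wf_deg wG v; rewrite (eqg_dg _ _ e) !dgE eqxx /=; case: (v \in W); genb.
have -> : mul v w H = 0.
  apply/eqP; rewrite -leqn0 -dv; apply: leq_esum => k a b.
  by case: (a == v); case: (b == v); case: (a == w); case: (b == w).
apply: contraLR; rewrite !negb_or ![w == _]eq_sym => /and3P[/negbTE n0 /negbTE n1 /negbTE n2].
rewrite n0 n1 n2 /=; by case: (eqVneq v w) => //= vw; rewrite vw n0 n1 n2.
Qed.

Definition on c v G := 0 < dg (fun k => 0 < c k) v G.

Lemma on_cl c j v G : 0 < j -> 0 < dg (cl c j) v G -> on c v G.
Proof.
move=> j0 h; apply: leq_trans h _; apply: leq_esum => k u w; rewrite /cl.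
by case: eqP => [->|_]; rewrite ?j0 //=; clear; genb.
Qed.

Lemma on0 c k v u H : ~~ on c v ((k, v, u) :: H) -> c k = 0.
Proof.
rewrite /on dgE eqxx andbT -eqn0Ngt addn_eq0 => /andP[]; rewrite addn_eq0 => /andP[].
by case: (c k).
Qed.

Lemma on_eqg c v G1 G2 : eqg G1 G2 -> on c v G1 = on c v G2.
Proof. by move=> e; rewrite /on (eqg_dg _ _ e). Qed.

Lemma on0' c k v u G H : eqg G ((k, v, u) :: H) -> ~~ on c v G -> c k = 0.
Proof. by move=> e; rewrite (on_eqg _ _ e) => /on0. Qed.

Lemma on0_mem c k u w L G v : eqg G L -> (k, u, w) \in L -> ~~ on c v G -> v \in [:: u; w] -> c k = 0.
Proof.
move=> e kL; rewrite (on_eqg _ _ e) /on -eqn0Ngt => /eqP d; rewrite !inE => h.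
have := mem_esum (fun k u w => ((0 < c k) && (u == v)) + ((0 < c k) && (w == v))) kL.
rewrite -/(dg (fun k => 0 < c k) v L) d !(eq_sym _ v).
by case: (c k) => //= k'; case/orP: h => ->; clear; genb.
Qed.

Lemma unspanned0 c i x y G H : eqg G ((i, x, y) :: H) -> unspanned c x y G -> c i = 0.
Proof.
move=> e uc; case: (posnP (c i)) => // ci0; have := uc _ ci0.
by rewrite !(eqg_dg _ _ e) !dgE /cl !eqxx /= => -[]; clear; genb.
Qed.

Lemma not_matched W i x y k b G H M : wf W G ->
  eqg G [:: (i, x, y), (k, x, b) & H] -> M i -> pm W M G -> ~~ M k.
Proof.
move=> wG e Mi pM; have [xW _] := wf_mem wG e.
have := pM x xW; rewrite (eqg_dg _ _ e) !dgE Mi eqxx /=.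
by case: (M k) => //; rewrite !andbT /=; genb.
Qed.

(** * Graphs without nontrivial small cuts *)

Section Core.
Variables (n : nat) (W : seq nat) (G : seq edge) (c : nat -> nat).
Hypotheses (IH : solvable_upto n) (wG : wf W G) (nt : NT W G) (sW : 8 <= size W).
Hypotheses (sz : 2 * size W + nlab c G <= n.+1) (rc : reg c G).

Let s2 : 2 <= size W. Proof. by move: sW; clear; lia. Qed.
Let s3 : 3 <= size W. Proof. by move: sW; clear; lia. Qed.
Let s6 : 6 <= size W. Proof. by move: sW; clear; lia. Qed.
Let sz4 : 2 * size W + nlab c G <= n.+4. Proof. by move: sz; clear; lia. Qed.
Let irr u v : 0 < mul u v G -> u != v := mul_neq wG s2.
Let par u v : 2 <= mul u v G -> False := no_parallel wG s3.
Let tri u v w : 0 < mul u v G -> 0 < mul v w G -> 0 < mul w u G -> False.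
Proof. by move=> h1 h2 h3; apply: (triangle wG nt s6 h1 h2 h3). Qed.
Let sq u v w z : u != w -> v != z ->
  0 < mul u v G -> 0 < mul v w G -> 0 < mul w z G -> 0 < mul z u G -> False.
Proof. by move=> n1 n2 h1 h2 h3 h4; apply: (square wG nt sW n1 n2 h1 h2 h3 h4). Qed.

(** The edge [x y] is matched, so [x b] is not, and [b] is matched along its class: this class is
    hit by every admissible matching and can be erased. *)
Lemma core_near i x y k b H : eqg G [:: (i, x, y), (k, x, b) & H] -> unspanned c x y G ->
  ~~ on c x G -> on c b G -> solvable W G i x y c.
Proof.
move=> e uc nx ob.
have e' : eqg G ((k, b, x) :: (i, x, y) :: H).
  by regraph e e.
have ck : c k = 0.
  by apply: (on0' (v := x) (u := b) (H := (i, x, y) :: H)) nx; apply: eqg_trans e' (eqg_flip _ _ _ _).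
have [k1 [u1 [k2 [u2 [H' e2]]]]] := pull3 wG s2 e'.
have e3 := eqg_trans e' (eqg_cons _ e2).
have [j [j0 dj]] : exists j, 0 < j /\ 0 < dg (cl c j) b G.
  move: ob; rewrite /on (deg3 wG e3) ck /=; case: (posnP (c k1)) => [_|h _].
    case: (posnP (c k2)) => [_|h _] //; exists (c k2).
    by rewrite (deg3 wG e3) /cl eqxx; split=> //; lia.
  by exists (c k1); rewrite (deg3 wG e3) /cl eqxx; split=> //; lia.
have cj : 0 < cnt (cl c j) G.
  move: dj; rewrite (deg3 wG e3) (eqg_cnt _ e3) !cntE; lia.
have he : has_edge G i x y by eexists; apply: e.
apply: (solvable_autohit IH wG he rc uc sz j0) cj => M Mi pM _.
apply: (hit_at wG s2 e' pM _ _ dj rc j0); first exact: not_matched wG e Mi pM.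
by rewrite ck; case: (j) j0.
Qed.

(** As [b] is not matched to [x], it is matched to [z1] or [z2]. The other of the two loses its edge
    outside the class and is matched along the class, which is therefore hit without effort. *)
Lemma core_near2 i x y k b k1 z1 k2 z2 H H' j : eqg G [:: (i, x, y), (k, x, b) & H'] ->
  eqg G [:: (k, b, x), (k1, b, z1), (k2, b, z2) & H] -> unspanned c x y G ->
  ~~ on c b G -> 0 < j -> 0 < dg (cl c j) z1 G -> 0 < dg (cl c j) z2 G -> solvable W G i x y c.
Proof.
move=> e e2 uc nb j0 d1 d2.
have e3 : eqg G ((k1, z1, b) :: [:: (k, b, x), (k2, b, z2) & H]).
  by regraph e2 e2.
have e4 : eqg G ((k2, z2, b) :: [:: (k, b, x), (k1, b, z1) & H]).
  by regraph e2 e2.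
have ck1 : c k1 = 0.
  by apply: (on0' (v := b)) nb; apply: eqg_trans e3 (eqg_flip _ _ _ _).
have ck2 : c k2 = 0.
  by apply: (on0' (v := b)) nb; apply: eqg_trans e4 (eqg_flip _ _ _ _).
have cj : 0 < cnt (cl c j) G.
  move: d1; clear; elim: (G) => // -[[a u] w] G' IH'; rewrite dgE cntE.
  by case: (cl c j a) => //= h; apply: IH'.
have he : has_edge G i x y by eexists; apply: e.
apply: (solvable_autohit IH wG he rc uc sz j0) cj => M Mi pM _.
have nk := not_matched wG e Mi pM.
have [bW _] := wf_mem wG e2.
have := pM b bW; rewrite (deg3 wG e2) (negbTE nk) /=.
case M1: (M k1); case M2: (M k2) => // _.
  by apply: (hit_at wG s2 e4 pM _ _ d2 rc j0); rewrite ?M2 // ck2; case: (j) j0.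
by apply: (hit_at wG s2 e3 pM _ _ d1 rc j0); rewrite ?M1 // ck1; case: (j) j0.
Qed.

(** The reduction follows the class [j] through [x]: it deletes the next two vertices [b] and [z] on
    it after erasing [j]. The edges [i3] and [i5] both belong to [j] and exactly one of them is
    used, so [j] is hit. *)
Lemma core_incident i x y H : eqg G ((i, x, y) :: H) -> unspanned c x y G -> on c x G ->
  solvable W G i x y c.
Proof.
move=> e uc ox; have ci := unspanned0 e uc.
have [i1 [b [i1' [b2 [H1 e1]]]]] := pull3 wG s2 e.
have E1 := eqg_trans e (eqg_cons _ e1).
have [j j0 [ci1 ci1']] : exists2 j, 0 < j & c i1 = j /\ c i1' = j.
  case: (labels_at wG E1 rc) => -[h1 h2 h3]; try by rewrite ci in h2.
    by move: ox; rewrite /on (deg3 wG E1) h1 h2 h3.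
  by exists (c i1).
have axy : 0 < mul x y G by adjt E1.
have axb : 0 < mul x b G by adjt E1.
have axb2 : 0 < mul x b2 G by adjt E1.
have xy := irr axy; have xb := irr axb; have xb2 := irr axb2.
have by_ : b != y by apply/eqP => h; apply: (@par x y); adjh h E1.
have bb2 : b != b2 by apply/eqP => h; apply: (@par x b2); adjh h E1.
have bW : b \in W by have [] := mul_mem wG axb.
have db : deg b [:: (i, x, y); (i1, x, b); (i1', x, b2)] = 1.
  by rewrite !dgE dg_nil eqxx; distinct.
have [|i2 [d [i3 [z [H2 [e3 ci2 ci3]]]]]] := next_on_cycle (k0 := i1) (u0 := x) wG rc s2 bW db E1 _ ci1 j0.
  by rewrite !inE eqxx orbT.
have E3 : eqg G ([:: (i, x, y); (i1, x, b); (i1', x, b2); (i2, b, d); (i3, b, z)] ++ H2).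
  by regraph E1 e3.
have abz : 0 < mul b z G by adjt E3.
have bz := irr abz.
have xz : x != z by apply/eqP => h; apply: (@par x b); adjh h E3.
have yz : y != z.
  by apply/eqP => h; apply: (tri axb abz); rewrite -h mulC.
have b2z : b2 != z by apply/eqP => h; apply: (tri axb abz); rewrite -h mulC.
have dz_ : d != z by apply/eqP => h; apply: (@par b z); adjh h E3.
have zW : z \in W by have [] := mul_mem wG abz.
have dz : deg z [:: (i, x, y); (i1, x, b); (i1', x, b2); (i2, b, d); (i3, b, z)] = 1.
  by rewrite !dgE dg_nil eqxx; distinct.
have [|i4 [z1 [i5 [z2 [H3 [e5 ci4 ci5]]]]]] := next_on_cycle (k0 := i3) (u0 := b) wG rc s2 zW dz E3 _ ci3 j0.
  by rewrite !inE eqxx !orbT.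
have E5 : eqg G [:: (i, x, y), (i1, x, b), (i2, b, d), (i3, b, z), (i4, z, z1), (i5, z, z2), (i1', x, b2) & H3].
  by regraph E3 e5.
have sz' : 2 * size W + nlab (drop c j) G <= n.+4.
  by apply: leq_trans sz4; rewrite leq_add2l nlab_drop_le.
have [|M [Mi pM gM M35]] :=
    red_solvable IH wG nt sW sz' E5 (reg_drop j rc) (unspanned_drop j uc).
  by rewrite /drop ci1 ci2 ci3 ci4 ci5 eqxx; split=> //; case: ifP.
exists M; split=> //; apply: good_drop gM.
rewrite (hit_eqg _ _ _ E5) /hit !cntE ci3 ci5 eqxx M35.
by case: (M i5) => /=; clear; genb.
Qed.

(** The class [j] is erased and the path [b z p1 p2], which runs along [j] from [z] on, is deleted;
    one of [i7] and [i9] hits [j]. The only obstacle is that [p2] is adjacent to [b2], the other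
    neighbour of [x], because a link would then duplicate an edge. *)
Lemma core_two i x y i1 b i1' b2 i2 d i3 z i4 p1 i5 q H j :
  eqg G [:: (i, x, y), (i1, x, b), (i1', x, b2), (i2, b, d), (i3, b, z), (i4, z, p1), (i5, z, q) & H] ->
  unspanned c x y G ->
  ~~ on c x G -> ~~ on c y G -> ~~ on c b G -> ~~ on c b2 G ->
  0 < j -> c i4 = j -> c i5 = j -> dg (cl c j) d G = 0 ->
  (forall v, 0 < mul y v G -> v != x -> ~~ on c v G) ->
  solvable W G i x y c \/
  exists p2, [/\ 0 < mul b2 p2 G, 0 < dg (cl c j) p2 G, 0 < mul p1 p2 G & p2 != z].
Proof.
move=> E uc nx ny nb nb2 j0 ci4 ci5 dj yn.
have neq v w : 0 < dg (cl c j) v G -> ~~ on c w G -> w != v.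
  by move=> h; apply: contraNneq => ->; apply: on_cl j0 h.
have neqd v : 0 < dg (cl c j) v G -> d != v by move=> h; apply: contraTneq h => <-; rewrite dj.
have axb : 0 < mul x b G by adjt E.
have axb2 : 0 < mul x b2 G by adjt E.
have abd : 0 < mul b d G by adjt E.
have abz : 0 < mul b z G by adjt E.
have azp : 0 < mul z p1 G by adjt E.
have azq : 0 < mul z q G by adjt E.
have zp1 := irr azp; have bz := irr abz.
have qp1 : q != p1 by apply/eqP => h; apply: (@par z p1); adjh h E.
have jp1 : 0 < dg (cl c j) p1 G by rewrite (eqg_dg _ _ E) !dgE /cl ci4 !eqxx /=; clear; genb.
have p1W : p1 \in W by have [] := mul_mem wG azp.
have dp1 : deg p1 [:: (i, x, y); (i1, x, b); (i1', x, b2); (i2, b, d); (i3, b, z); (i4, z, p1); (i5, z, q)] = 1.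
  rewrite !dgE dg_nil eqxx (negbTE (neq _ _ jp1 nx)) (negbTE (neq _ _ jp1 ny)).
  by rewrite (negbTE (neq _ _ jp1 nb)) (negbTE (neq _ _ jp1 nb2)) (negbTE (neqd _ jp1)) (negbTE zp1) (negbTE qp1).
have [|i6 [u1 [i7 [p2 [H1 [e2 ci6 ci7]]]]]] := next_on_cycle (k0 := i4) (u0 := z) wG rc s2 p1W dp1 E _ ci4 j0.
  by rewrite !inE eqxx !orbT.
have E2 : eqg G ([:: (i, x, y); (i1, x, b); (i1', x, b2); (i2, b, d); (i3, b, z); (i4, z, p1);
   (i5, z, q); (i6, p1, u1); (i7, p1, p2)] ++ H1).
  by regraph E e2.
have apu1 : 0 < mul p1 u1 G by adjt E2.
have ap12 : 0 < mul p1 p2 G by adjt E2.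
have p12 := irr ap12.
have jp2 : 0 < dg (cl c j) p2 G by rewrite (eqg_dg _ _ E2) !dgE /cl ci7 !eqxx /=; clear; genb.
have zp2 : z != p2 by apply/eqP => h; apply: (@par z p1); adjh h E2.
have qp2 : q != p2 by apply/eqP => h; apply: (tri azp ap12); rewrite -h mulC.
have u1p2 : u1 != p2 by apply/eqP => h; apply: (@par p1 p2); adjh h E2.
have p2W : p2 \in W by have [] := mul_mem wG ap12.
case: (posnP (mul b2 p2 G)) => [nb2p2|]; last first.
  by move=> h; right; exists p2; split=> //; rewrite eq_sym.
left.
have dp2 : deg p2 [:: (i, x, y); (i1, x, b); (i1', x, b2); (i2, b, d); (i3, b, z); (i4, z, p1);
   (i5, z, q); (i6, p1, u1); (i7, p1, p2)] = 1.
  rewrite !dgE dg_nil eqxx (negbTE (neq _ _ jp2 nx)) (negbTE (neq _ _ jp2 ny)).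
  rewrite (negbTE (neq _ _ jp2 nb)) (negbTE (neq _ _ jp2 nb2)) (negbTE (neqd _ jp2)).
  by rewrite (negbTE zp2) (negbTE qp2) (negbTE p12) (negbTE u1p2).
have [|i8 [u2 [i9 [p3 [H2 [e4 ci8 ci9]]]]]] := next_on_cycle (k0 := i7) (u0 := p1) wG rc s2 p2W dp2 E2 _ ci7 j0.
  by rewrite !inE eqxx !orbT.
have E4 : eqg G [:: (i, x, y), (i1, x, b), (i2, b, d), (i3, b, z), (i4, z, p1),
   (i5, z, q), (i6, p1, u1), (i7, p1, p2), (i8, p2, u2), (i9, p2, p3), (i1', x, b2) & H2].
  by regraph E2 e4.
have ap2u2 : 0 < mul p2 u2 G by adjt E4.
have jp3 : 0 < dg (cl c j) p3 G by rewrite (eqg_dg _ _ E4) !dgE /cl ci9 !eqxx /=; clear; genb.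
have xnbr w : 0 < mul x w G -> ~~ on c w G.
  move/(nbr_of wG (_ : eqg G [:: (i, x, y), (i1, x, b), (i1', x, b2), (i2, b, d), (i3, b, z), (i4, z, p1), (i5, z, q) & H])).
  by move=> /(_ E); rewrite !inE => /or3P[] /eqP ->.
have yp2 := neq _ _ jp2 ny.
have xu2 : x != u2.
  by apply/eqP => h; have := xnbr p2; rewrite h mulC ap2u2 (on_cl j0 jp2) => /(_ isT).
have xp3 := neq _ _ jp3 nx.
(* The neighbours of [x] are [y], [b] and [b2]. If [u2] is [y], then [y] has a neighbour on a class,
   against [yn]; if it is [b], then [b z p1 p2] is a square; [b2] is excluded in this branch. *)
have xu2n : mul x u2 G = 0.
  apply/eqP; rewrite -leqn0 leqNgt; apply/negP.
  move/(nbr_of wG E); rewrite !inE => /or3P[] /eqP h.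
  - have := yn p2; rewrite -h mulC ap2u2 (on_cl j0 jp2) (eq_sym p2) (neq _ _ jp2 nx).
    by move=> /(_ isT isT).
  - apply: (sq (u := b) (v := z) (w := p1) (z := p2)) => //; last by rewrite -h.
    exact: neq jp1 nb.
  - by move: ap2u2; rewrite h mulC nb2p2.
have sz' : 2 * size W + nlab (drop c j) G <= n.+4.
  by apply: leq_trans sz4; rewrite leq_add2l nlab_drop_le.
have ci1 : c i1 = 0.
  by apply: (on0' (v := x)) nx; apply: eqg_trans E4 (eqg_swap _ _ _).
have [ci2 ci3] : c i2 = 0 /\ c i3 = 0.
  by split; [apply: (on0_mem (u := b) (w := d) E4 _ nb)|apply: (on0_mem (u := b) (w := z) E4 _ nb)];
     rewrite !inE eqxx ?orbT.
have [||M [Mi pM gM M579]] :=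
    red2_solvable IH wG nt sW sz' E4 yp2 xu2 xp3 xu2n (reg_drop j rc) (unspanned_drop j uc).
- by rewrite /drop ci1 ci2 ci3 ci4 ci5 eqxx; split=> //; case: ifP.
- by rewrite /drop ci6 ci7 ci8 ci9 eqxx; split=> //; case: ifP.
exists M; split=> //; apply: good_drop gM.
rewrite (hit_eqg _ _ _ E4) /hit !cntE ci5 ci7 ci9 eqxx.
by move: M579; clear; case: (M i5); case: (M i7); case: (M i9) => //= _; genb.
Qed.

(** Let [d] and [z] be the other neighbours of [b]. If [z] is on no class, the short reduction
    works. If [z] is on a class [j] and [d] is not on [j], the long reduction is tried along [j] in
    both directions; two failures put both further neighbours of [b2] on [j]. If [d] and [z] are
    both on [j], so are both further neighbours of [b]. In the last two situations [core_near2]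
    finishes. *)
Lemma core_far i x y H : eqg G ((i, x, y) :: H) -> unspanned c x y G ->
  ~~ on c x G -> ~~ on c y G ->
  (forall v, 0 < mul y v G -> v != x -> ~~ on c v G) ->
  (forall v, 0 < mul x v G -> v != y -> ~~ on c v G) ->
  solvable W G i x y c.
Proof.
move=> e uc nx ny yn xn.
have [i1 [b [i1' [b2 [H1 e1]]]]] := pull3 wG s2 e.
have E1 := eqg_trans e (eqg_cons _ e1).
have axy : 0 < mul x y G by adjt E1.
have axb : 0 < mul x b G by adjt E1.
have axb2 : 0 < mul x b2 G by adjt E1.
have xb := irr axb; have xb2 := irr axb2.
have by_ : b != y by apply/eqP => h; apply: (@par x y); adjh h E1.
have b2y : b2 != y by apply/eqP => h; apply: (@par x y); adjh h E1.
have bb2 : b2 != b by apply/eqP => h; apply: (@par x b); adjh h E1.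
have nb := xn _ axb by_; have nb2 := xn _ axb2 b2y.
have bW : b \in W by have [] := mul_mem wG axb.
have db : deg b [:: (i, x, y); (i1, x, b); (i1', x, b2)] = 1.
  by rewrite !dgE dg_nil eqxx; distinct.
have near i2 d i3 z H2 :
   eqg H1 [:: (i2, b, d), (i3, b, z) & H2] ->
   solvable W G i x y c \/ exists j, [/\ 0 < j, 0 < dg (cl c j) z G &
     dg (cl c j) d G = 0 -> solvable W G i x y c].
  move=> e2.
  have E2 : eqg G ([:: (i, x, y); (i1, x, b); (i1', x, b2); (i2, b, d); (i3, b, z)] ++ H2).
    by regraph E1 e2.
  have abz : 0 < mul b z G by adjt E2.
  have bz := irr abz.
  have xz : x != z by apply/eqP => h; apply: (@par x b); adjh h E2.
  have yz : y != z by apply/eqP => h; apply: (tri axb abz); rewrite -h mulC.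
  have b2z : b2 != z by apply/eqP => h; apply: (tri axb abz); rewrite -h mulC.
  have dz_ : d != z by apply/eqP => h; apply: (@par b z); adjh h E2.
  have zW : z \in W by have [] := mul_mem wG abz.
  have dz : deg z [:: (i, x, y); (i1, x, b); (i1', x, b2); (i2, b, d); (i3, b, z)] = 1.
    by rewrite !dgE dg_nil eqxx; distinct.
  have [i4 [p [i5 [q [H3 e3]]]]] := pull_next wG s2 zW dz E2.
  have E3 : eqg G [:: (i, x, y), (i1, x, b), (i1', x, b2), (i2, b, d), (i3, b, z), (i4, z, p), (i5, z, q) & H3].
    by regraph E2 e3.
  have [ci2 ci3] : c i2 = 0 /\ c i3 = 0.
    by split; [apply: (on0_mem (u := b) (w := d) E3 _ nb)|apply: (on0_mem (u := b) (w := z) E3 _ nb)];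
     rewrite !inE eqxx ?orbT.
  have ci1 : c i1 = 0.
    by apply: (on0_mem (u := x) (w := b) E3 _ nx); rewrite !inE eqxx ?orbT.
  have E4 : eqg G [:: (i3, z, b), (i4, z, p), (i5, z, q), (i, x, y), (i1, x, b), (i1', x, b2), (i2, b, d) & H3].
    by regraph E3 E3.
  case: (labels_at wG E4 rc) => -[h1 h2 h3]; try by rewrite ci3 in h2.
    have E5 : eqg G [:: (i, x, y), (i1, x, b), (i2, b, d), (i3, b, z), (i4, z, p), (i5, z, q), (i1', x, b2) & H3].
      by regraph E3 E3.
    by left; have [//|M [Mi pM gM _]] := red_solvable IH wG nt sW sz4 E5 rc uc; exists M.
  right; exists (c i4); split=> //.
    by rewrite (eqg_dg _ _ E4) !dgE /cl !eqxx /=; clear; genb.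
  move=> d0; have E3' : eqg G [:: (i, x, y), (i1, x, b), (i1', x, b2), (i2, b, d), (i3, b, z), (i5, z, q), (i4, z, p) & H3].
    by regraph E3 E3.
  case: (core_two E3 uc nx ny nb nb2 h2 _ h3 d0 yn) => // -[p2 [b2p2 jp2 pp2 p2z]].
  case: (core_two E3' uc nx ny nb nb2 h2 h3 _ d0 yn) => // -[q2 [b2q2 jq2 qq2 q2z]].
  have azp : 0 < mul z p G by adjt E3.
  have azq : 0 < mul z q G by adjt E3.
  have pq : p != q by apply/eqP => h; apply: (@par z p); adjh h E3.
  (* Otherwise the two directions along the class meet again in the square [z p p2 q]. *)
  have p2q2 : p2 != q2.
    apply/eqP => h; apply: (sq (u := z) (v := p) (w := p2) (z := q)) => //.
    - by rewrite eq_sym.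
    - by rewrite h mulC.
    - by rewrite mulC.
  have E5 : eqg G ((i1', b2, x) :: [:: (i, x, y), (i1, x, b), (i2, b, d), (i3, b, z), (i4, z, p), (i5, z, q) & H3]).
    by regraph E3 E3.
  have [k1 [w1 [k2 [w2 [H4 e6]]]]] := pull3 wG s2 E5.
  have E6 := eqg_trans E5 (eqg_cons _ e6).
  have E1' : eqg G [:: (i, x, y), (i1', x, b2), (i1, x, b) & H1].
    by regraph E1 E1.
  have off v' : 0 < dg (cl c (c i4)) v' G -> v' == x = false.
    by move=> h; apply/negbTE; apply: contraNneq nx => <-; apply: on_cl h2 h.
  have : p2 \in [:: x; w1; w2] by apply: nbr_of wG E6 b2p2.
  have : q2 \in [:: x; w1; w2] by apply: nbr_of wG E6 b2q2.
  rewrite !inE (off _ jp2) (off _ jq2) /=.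
  have [/andP[j1 j2] _ _|nj] := boolP ((0 < dg (cl c (c i4)) w1 G) && (0 < dg (cl c (c i4)) w2 G)).
    exact: core_near2 E1' E6 uc nb2 h2 j1 j2.
  move=> /orP[] /eqP hq /orP[] /eqP hp; try by rewrite hq hp eqxx in p2q2.
    by rewrite -hq -hp jp2 jq2 in nj.
  by rewrite -hq -hp jp2 jq2 in nj.
have [i2 [d [i3 [z [H2 e2]]]]] := pull_next wG s2 bW db E1.
case: (near _ _ _ _ _ e2) => // -[j [j0 jz hj]].
case: (posnP (dg (cl c j) d G)) => [/hj //|jd].
have E1' : eqg G [:: (i, x, y), (i1, x, b), (i1', x, b2) & H1] by [].
have E7 : eqg G [:: (i1, b, x), (i2, b, d), (i3, b, z), (i, x, y), (i1', x, b2) & H2].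
  by regraph E1 e2.
exact: core_near2 E1' E7 uc nb j0 jd jz.
Qed.

Lemma core i x y H : eqg G ((i, x, y) :: H) -> unspanned c x y G -> solvable W G i x y c.
Proof.
move=> e uc.
have e' := eqg_trans e (eqg_flip i x y H).
have uc' : unspanned c y x G by move=> j j0; have [] := uc j j0; [right|left].
have sym : solvable W G i y x c -> solvable W G i x y c by [].
case: (boolP (on c x G)) => [|nx]; first exact: core_incident e uc.
case: (boolP (on c y G)) => [oy|ny]; first exact/sym/(core_incident e' uc').
have near x' y' H' : eqg G ((i, x', y') :: H') -> unspanned c x' y' G -> ~~ on c x' G ->
   solvable W G i x' y' c \/ (forall v, 0 < mul x' v G -> v != y' -> ~~ on c v G).
  move=> {}e {}uc {}nx; case: (boolP (on c y' G)) => oy'.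
    left; apply: core_incident (eqg_trans e (eqg_flip i x' y' H')) _ oy'.
    by move=> j j0; have [] := uc j j0; [right|left].
  have [i1 [b [i1' [b2 [H1 e1]]]]] := pull3 wG s2 e.
  have E1 := eqg_trans e (eqg_cons _ e1).
  have E1' : eqg G [:: (i, x', y'), (i1', x', b2), (i1, x', b) & H1].
    by regraph E1 E1.
  case: (boolP (on c b G)) => ob; first by left; apply: core_near E1 uc nx ob.
  case: (boolP (on c b2 G)) => ob2; first by left; apply: core_near E1' uc nx ob2.
  by right=> v /(nbr_of wG E1); rewrite !inE => /or3P[] /eqP -> //; rewrite eqxx.
case: (near _ _ _ e uc nx) => // xn.
case: (near _ _ _ e' uc' ny) => [/sym //|yn].
exact: core_far e uc nx ny yn xn.
Qed.
End Core.

(** * Graphs with at most six vertices *)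

Lemma sub_full W s : uniq W -> uniq s -> {subset s <= W} -> size W <= size s -> {subset W <= s}.
Proof.
by move=> uW us sW sz v; have [_ ->] := uniq_min_size us sW sz.
Qed.

Lemma exhausted W G L : wf W G -> forall H, eqg G (L ++ H) ->
  (forall v, v \in W -> 3 <= deg v L) -> H = [::].
Proof.
move=> wG [//|[[k u] w] H] e d3; have := wf_deg wG u.
rewrite (eqg_dg _ _ e) catE dgE eqxx /=; case: (boolP (u \in W)) => [/d3|_] /=; lia.
Qed.

Ltac degrees E := rewrite (eqg_dg _ _ E) !dgE dg_nil !eqxx; distinct; rewrite ?andbT ?andbF; genb.

Section Base.
Variables (W : seq nat) (G : seq edge) (c : nat -> nat) (i x y : nat) (H : seq edge).
Hypotheses (wG : wf W G) (rc : reg c G) (e : eqg G ((i, x, y) :: H)) (uc : unspanned c x y G).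

Let ids L k : eqg G L -> cnt (pred1 k) L <= 1.
Proof. by move=> eL; rewrite -(eqg_cnt _ eL); apply: wf_ids wG _. Qed.

(** Two vertices joined by three edges: any class would meet both ends of [i], so there are no
    classes to hit. *)
Lemma base2 : size W = 2 -> solvable W G i x y c.
Proof.
move=> sW; have s2 : 2 <= size W by rewrite sW.
have [i1 [b [i2 [b2 [H1 e1]]]]] := pull3 wG s2 e.
have E := eqg_trans e (eqg_cons _ e1).
have := wf_loops wG s2; rewrite (eqg_loops E) !loopsE => /eqP.
rewrite !addn_eq0 !eqb0 => /and4P[xy xb xb2 _].
have [xW yW] := wf_mem wG e.
have bW : b \in W by rewrite -(wf_in wG) (eqg_dg _ _ E) !dgE eqxx /=; clear; genb.
have b2W : b2 \in W by rewrite -(wf_in wG) (eqg_dg _ _ E) !dgE eqxx /=; clear; genb.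
have full : {subset W <= [:: x; y]}.
  apply: sub_full; rewrite ?(wf_uniq wG) ?sW //= ?inE ?xy //.
  by move=> v; rewrite !inE => /orP[] /eqP ->.
move: (full _ bW) (full _ b2W); rewrite !inE ![_ == x]eq_sym (negbTE xb) (negbTE xb2) /=.
move=> /eqP by_ /eqP b2y; subst b b2.
have H10 : H1 = [::].
  apply: (@exhausted W G [:: (i, x, y); (i1, x, y); (i2, x, y)]) => // v /full.
  by rewrite !inE => /orP[] /eqP ->; rewrite !dgE eqxx /=; clear; genb.
subst H1; have ci := unspanned0 e uc.
have i1i : (i1 == i) = false.
  by have := ids i E; rewrite !cntE /= eqxx; case: eqP => //; clear; genb.
have i2i : (i2 == i) = false.
  by have := ids i E; rewrite !cntE /= eqxx; case: (i2 == i) => //; clear; genb.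
exists (pred1 i); split=> /=; first by rewrite eqxx.
  move=> v /full; rewrite (eqg_dg _ _ E) !dgE /= i1i i2i eqxx !inE.
  by case/orP=> /eqP ->; rewrite dg_nil eqxx ?(negbTE xy) // eq_sym (negbTE xy).
move=> j j0; rewrite (eqg_cnt _ E) !cntE /cl ci cnt_nil.
have := uc j0; rewrite !(eqg_dg _ _ E) !dgE /cl ci !eqxx (eq_sym y x) (negbTE xy) !dg_nil.
by case: j j0 => // j _; case: (c i1 == _); case: (c i2 == _) => //= -[].
Qed.

(** The graph is the complete graph on four vertices, and the matching consists of [i] and the
    opposite edge. A class cannot meet both [x] and [y], hence is a triangle through that opposite
    edge. *)
Lemma base4 : size W = 4 -> solvable W G i x y c.
Proof.
move=> sW; have s2 : 2 <= size W by rewrite sW.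
have s3 : 3 <= size W by rewrite sW.
have irr u v : 0 < mul u v G -> u != v := mul_neq wG s2.
have par u v : 2 <= mul u v G -> False := no_parallel wG s3.
have [i1 [b [i2 [b2 [H1 e1]]]]] := pull3 wG s2 e.
have E := eqg_trans e (eqg_cons _ e1).
have axy : 0 < mul x y G by adjt E.
have axb : 0 < mul x b G by adjt E.
have axb2 : 0 < mul x b2 G by adjt E.
have xy := irr _ _ axy; have xb := irr _ _ axb; have xb2 := irr _ _ axb2.
have yb : y != b by apply/eqP => h; apply: (@par x y); adjh h E.
have yb2 : y != b2 by apply/eqP => h; apply: (@par x y); adjh h E.
have bb2 : b != b2 by apply/eqP => h; apply: (@par x b); adjh h E.
have [xW yW] := mul_mem wG axy; have [_ bW] := mul_mem wG axb; have [_ b2W] := mul_mem wG axb2.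
have us : uniq [:: x; y; b; b2] by rewrite /= !inE !negb_or xy xb xb2 yb yb2 bb2.
have full : {subset W <= [:: x; y; b; b2]}.
  apply: sub_full; rewrite ?(wf_uniq wG) ?sW //.
  by move=> v; rewrite !inE => /or4P[] /eqP ->.
have db : deg b [:: (i, x, y); (i1, x, b); (i2, x, b2)] = 1.
  by rewrite !dgE dg_nil eqxx; distinct.
have [k1 [u1 [k2 [u2 [H2 e2]]]]] := pull_next wG s2 bW db E.
have [i3 [i4 [H3 E3]]] : exists i3 i4 H3, eqg G ([:: (i, x, y); (i1, x, b); (i2, x, b2);
    (i3, b, y); (i4, b, b2)] ++ H3).
  have E2 : eqg G [:: (i, x, y), (i1, x, b), (i2, x, b2), (k1, b, u1), (k2, b, u2) & H2].
    by regraph E e2.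
  have a1 : 0 < mul b u1 G by adjt E2.
  have a2 : 0 < mul b u2 G by adjt E2.
  have b1 := irr _ _ a1; have b2' := irr _ _ a2.
  have x1 : u1 != x by apply/eqP => h; apply: (@par x b); adjh h E2.
  have x2 : u2 != x by apply/eqP => h; apply: (@par x b); adjh h E2.
  have u12 : u1 != u2 by apply/eqP => h; apply: (@par b u1); adjh h E2.
  have /full := (mul_mem wG a1).2; have /full := (mul_mem wG a2).2.
  rewrite !inE (negbTE x1) (negbTE x2) (eq_sym u1 b) (eq_sym u2 b) (negbTE b1) (negbTE b2') /=.
  move=> /orP[] /eqP h2 /orP[] /eqP h1; try by rewrite h1 h2 eqxx in u12.
    exists k2, k1, H2 => f fs; rewrite (E2 f fs) /= h1 h2; clear; lia.
  by exists k1, k2, H2 => f fs; rewrite (E2 f fs) /= h1 h2.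
have dy : deg y [:: (i, x, y); (i1, x, b); (i2, x, b2); (i3, b, y); (i4, b, b2)] = 2.
  by rewrite !dgE dg_nil eqxx; distinct.
have [i5 [u [H4 [e4 uy _ _]]]] : exists k u H', [/\ eqg H3 ((k, y, u) :: H'), u != y, loops H' = 0 & deg y H' = 0].
  apply: pull_deg; last by have := wf_deg wG y; rewrite (eqg_dg _ _ E3) catE dy yW; clear; lia.
  have := wf_loops wG s2; rewrite (eqg_loops E3) /loops esum_cat; clear; lia.
have E4 : eqg G ([:: (i, x, y); (i1, x, b); (i2, x, b2); (i3, b, y); (i4, b, b2); (i5, y, u)] ++ H4).
  by regraph E3 e4.
have ayu : 0 < mul y u G by adjt E4.
have ub2 : u = b2.
  have /full := (mul_mem wG ayu).2; rewrite !inE (negbTE uy) => /or4P[/eqP h|//|/eqP h|/eqP //].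
    by exfalso; apply: (@par x y); adjh h E4.
  by exfalso; apply: (@par b y); adjh h E4.
subst u; have H40 : H4 = [::].
  apply: (exhausted wG E4) => v /full.
  by rewrite !inE => /or4P[] /eqP ->; rewrite !dgE eqxx /=; clear; genb.
subst H4; have ci := unspanned0 e uc.
have nid k : k \in [:: i1; i2; i3; i5] -> (k == i) = false /\ (k == i4) = false.
  have := ids i E4; have := ids i4 E4; rewrite !cntE /= !eqxx !inE ![i == _]eq_sym ![i4 == _]eq_sym.
  move=> h1 h2; have {h1}: (i1 == i4) + (i2 == i4) + (i3 == i4) + (i5 == i4) = 0 by move: h1; clear; genb.
  have {h2}: (i1 == i) + (i2 == i) + (i3 == i) + (i5 == i) = 0 by move: h2; clear; genb.
  move=> /eqP; rewrite !addn_eq0 !eqb0 -!andbA => /and4P[a1 a2 a3 a5].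
  move=> /eqP; rewrite !addn_eq0 !eqb0 -!andbA => /and4P[c1 c2 c3 c5].
  by case/or4P=> /eqP ->; rewrite ?(negbTE a1) ?(negbTE a2) ?(negbTE a3) ?(negbTE a5)
    ?(negbTE c1) ?(negbTE c2) ?(negbTE c3) ?(negbTE c5).
have i4i : (i4 == i) = false by have := ids i E4; rewrite !cntE /= !eqxx; case: (i4 == i) => //; clear; genb.
have [n1 n1'] := nid i1 (mem_head _ _).
have [n2 n2'] : (i2 == i) = false /\ (i2 == i4) = false by apply: nid; rewrite !inE eqxx orbT.
have [n3 n3'] : (i3 == i) = false /\ (i3 == i4) = false by apply: nid; rewrite !inE eqxx !orbT.
have [n5 n5'] : (i5 == i) = false /\ (i5 == i4) = false by apply: nid; rewrite !inE eqxx !orbT.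
have Dx M : dg M x G = M i + M i1 + M i2 by degrees E4.
have Dy M : dg M y G = M i + M i3 + M i5 by degrees E4.
have Db M : dg M b G = M i1 + M i3 + M i4 by degrees E4.
have Db2 M : dg M b2 G = M i2 + M i4 + M i5 by degrees E4.
exists (pred2 i i4); split=> /=; first by rewrite eqxx.
  move=> v /full; rewrite !inE.
  by case/or4P=> /eqP ->; rewrite ?Dx ?Dy ?Db ?Db2 /= ?n1 ?n1' ?n2 ?n2' ?n3 ?n3' ?n5 ?n5' ?eqxx ?orbT ?i4i.
move=> j j0; rewrite /hit !(eqg_cnt _ E4) !cntE /= /cl ci !cnt_nil n1 n1' n2 n2' n3 n3' n5 n5' eqxx i4i eqxx /=.
have := rc x j0; have := rc y j0; have := rc b j0; have := uc j0.
rewrite !Dx !Dy !Db /cl ci (ltn_eqF j0) /=.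
by case: (c i1 == j); case: (c i2 == j); case: (c i3 == j); case: (c i4 == j); case: (c i5 == j) => //= -[] // ? [] // ? [] // ? [].
Qed.

(** Triangles are excluded, so the graph is complete bipartite with parts [x b3 b4] and [y b b2]. A
    class misses [x] or [y], hence is a 4-cycle, and each such 4-cycle contains [b b3] or
    [b2 b4]. *)
Lemma base6 : NT W G -> size W = 6 -> solvable W G i x y c.
Proof.
move=> nt sW; have s2 : 2 <= size W by rewrite sW.
have s3 : 3 <= size W by rewrite sW.
have s6 : 6 <= size W by rewrite sW.
have irr u v : 0 < mul u v G -> u != v := mul_neq wG s2.
have par u v : 2 <= mul u v G -> False := no_parallel wG s3.
have tri u v w : 0 < mul u v G -> 0 < mul v w G -> 0 < mul w u G -> False.
  by move=> h1 h2 h3; apply: (triangle wG nt s6 h1 h2 h3).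
have [i1 [b [i2 [b2 [H1 e1]]]]] := pull3 wG s2 e.
have E := eqg_trans e (eqg_cons _ e1).
have axy : 0 < mul x y G by adjt E.
have axb : 0 < mul x b G by adjt E.
have axb2 : 0 < mul x b2 G by adjt E.
have xy := irr _ _ axy; have xb := irr _ _ axb; have xb2 := irr _ _ axb2.
have yb : y != b by apply/eqP => h; apply: (@par x y); adjh h E.
have yb2 : y != b2 by apply/eqP => h; apply: (@par x y); adjh h E.
have bb2 : b != b2 by apply/eqP => h; apply: (@par x b); adjh h E.
have [xW yW] := mul_mem wG axy; have [_ bW] := mul_mem wG axb; have [_ b2W] := mul_mem wG axb2.
have dy : deg y [:: (i, x, y); (i1, x, b); (i2, x, b2)] = 1.
  by rewrite !dgE dg_nil eqxx; distinct.
have [i3 [b3 [i4 [b4 [H2 e2]]]]] := pull_next wG s2 yW dy E.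
have E2 : eqg G ([:: (i, x, y); (i1, x, b); (i2, x, b2); (i3, y, b3); (i4, y, b4)] ++ H2).
  by regraph E e2.
have ay3 : 0 < mul y b3 G by adjt E2.
have ay4 : 0 < mul y b4 G by adjt E2.
have y3 := irr _ _ ay3; have y4 := irr _ _ ay4.
have x3 : x != b3 by apply/eqP => h; apply: (@par x y); adjh h E2.
have x4 : x != b4 by apply/eqP => h; apply: (@par x y); adjh h E2.
have b34 : b3 != b4 by apply/eqP => h; apply: (@par y b3); adjh h E2.
have bn3 : b != b3 by apply/eqP => h; apply: (tri _ _ _ axy ay3); rewrite -h mulC.
have bn4 : b != b4 by apply/eqP => h; apply: (tri _ _ _ axy ay4); rewrite -h mulC.
have b2n3 : b2 != b3 by apply/eqP => h; apply: (tri _ _ _ axy ay3); rewrite -h mulC.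
have b2n4 : b2 != b4 by apply/eqP => h; apply: (tri _ _ _ axy ay4); rewrite -h mulC.
have [_ b3W] := mul_mem wG ay3; have [_ b4W] := mul_mem wG ay4.
have us : uniq [:: x; y; b; b2; b3; b4].
  by rewrite /= !inE !negb_or xy xb xb2 x3 x4 yb yb2 y3 y4 bb2 bn3 bn4 b2n3 b2n4 b34.
have full : {subset W <= [:: x; y; b; b2; b3; b4]}.
  apply: sub_full; rewrite ?(wf_uniq wG) ?sW //.
  by move=> v; rewrite !inE => /or4P[||| /or3P[]] /eqP ->.
have step v v' k L H' : v \in W -> deg v L = 1 -> eqg G (L ++ H') -> (k, x, v) \in L -> 0 < mul x v G ->
    0 < mul x v' G -> perm_eq [:: v; v'] [:: b; b2] -> exists k1 k2 H'',
    eqg G (L ++ [:: (k1, v, b3), (k2, v, b4) & H'']).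
  move=> vW dv E3 kL axv axv' pe; have [k1 [u1 [k2 [u2 [H'' e3]]]]] := pull_next wG s2 vW dv E3.
  have E4 : eqg G [:: (k1, v, u1), (k2, v, u2) & L ++ H''].
    by move=> f fs; rewrite (E3 f fs) esum_cat (e3 f fs) /= esum_cat; clear; lia.
  have a1 : 0 < mul v u1 G by adjt E4.
  have a2 : 0 < mul v u2 G by adjt E4.
  have aL : 0 < mul x v L.
    by apply: leq_trans (mem_esum _ kL); rewrite !eqxx.
  have mL : mul x v (L ++ H'') = mul x v L + mul x v H'' by apply: esum_cat.
  have n1 : u1 != x.
    apply/eqP => h; apply: (@par x v); rewrite (eqg_mul _ _ E4) !mulE mL h !eqxx orbT /=.
    by move: aL; clear; genb.
  have n2 : u2 != x.
    apply/eqP => h; apply: (@par x v); rewrite (eqg_mul _ _ E4) !mulE mL h !eqxx orbT /=.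
    by move: aL; clear; genb.
  have u12 : u1 != u2 by apply/eqP => h; apply: (@par v u1); adjh h E4.
  have nb u : 0 < mul v u G -> u != x -> u \in [:: b3; b4].
    move=> au ux; have /full := (mul_mem wG au).2; rewrite !inE (negbTE ux) /=.
    have uy : u == y = false by apply/negbTE/eqP => h; apply: (tri _ _ _ axv au); rewrite h mulC.
    have uv : u == v = false by apply/negbTE; rewrite eq_sym (irr _ _ au).
    have uv' : u == v' = false by apply/negbTE/eqP => h; apply: (tri _ _ _ axv au); rewrite h mulC.
    have := perm_mem pe u; rewrite !inE uv uv' uy /= => /esym /negbT; rewrite negb_or.
    by move=> /andP[/negbTE -> /negbTE ->].
  move: (nb _ a1 n1) (nb _ a2 n2); rewrite !inE => /orP[] /eqP h1 /orP[] /eqP h2;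
    try by rewrite h1 h2 eqxx in u12.
    by exists k1, k2, H'' => f fs; rewrite (E4 f fs) esum_cat /= esum_cat h1 h2; clear; lia.
  by exists k2, k1, H'' => f fs; rewrite (E4 f fs) esum_cat /= esum_cat h1 h2; clear; lia.
have db : deg b [:: (i, x, y); (i1, x, b); (i2, x, b2); (i3, y, b3); (i4, y, b4)] = 1.
  by rewrite !dgE dg_nil eqxx; distinct.
have [||k1 [k2 [H3 E3]]] := step b b2 i1 _ _ bW db E2 _ axb axb2.
- by rewrite !inE eqxx orbT.
- by [].
have db2 : deg b2 [:: (i, x, y); (i1, x, b); (i2, x, b2); (i3, y, b3); (i4, y, b4); (k1, b, b3); (k2, b, b4)] = 1.
  by rewrite !dgE dg_nil eqxx; distinct.
have [||k3 [k4 [H4 E4]]] := step b2 b i2 _ H3 b2W db2 E3 _ axb2 axb.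
- by rewrite !inE eqxx !orbT.
- by rewrite (perm_catC [:: b2] [:: b]).
have H40 : H4 = [::].
  have E5 : eqg G ([:: (i, x, y); (i1, x, b); (i2, x, b2); (i3, y, b3); (i4, y, b4); (k1, b, b3); (k2, b, b4); (k3, b2, b3); (k4, b2, b4)] ++ H4) by [].
  apply: (exhausted wG E5) => v /full.
  by rewrite !inE => /or4P[||| /or3P[]] /eqP ->; rewrite !dgE eqxx /=; clear; genb.
subst H4; have ci := unspanned0 e uc.
have Dx M : dg M x G = M i + M i1 + M i2 by degrees E4.
have Dy M : dg M y G = M i + M i3 + M i4 by degrees E4.
have Db M : dg M b G = M i1 + M k1 + M k2 by degrees E4.
have Db2 M : dg M b2 G = M i2 + M k3 + M k4 by degrees E4.
have Db3 M : dg M b3 G = M i3 + M k1 + M k3 by degrees E4.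
have Db4 M : dg M b4 G = M i4 + M k2 + M k4 by degrees E4.
pose M := pred3 i k1 k4.
have idd := fun k => ids k E4.
have nid k : k \in [:: i1; i2; i3; i4; k2; k3] -> M k = false.
  rewrite /M !inE => /or4P[||| /or3P[]] /eqP -> /=; apply/negbTE; rewrite !negb_or; apply/and3P;
  (split; apply/eqP => h; [have := idd i | have := idd k1 | have := idd k4]);
  by rewrite !cntE /= -h eqxx; clear; genb.
have [n1 n2 n3] : [/\ M i1 = false, M i2 = false & M i3 = false].
  by split; apply: nid; rewrite !inE eqxx ?orbT.
have [n4 n5 n6] : [/\ M i4 = false, M k2 = false & M k3 = false].
  by split; apply: nid; rewrite !inE eqxx ?orbT.
have [m1 m2 m3] : [/\ M i, M k1 & M k4] by rewrite /M /= !eqxx !orbT.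
exists M; split=> //.
  move=> v /full; rewrite !inE => /or4P[||| /or3P[]] /eqP ->;
  by rewrite ?Dx ?Dy ?Db ?Db2 ?Db3 ?Db4 ?n1 ?n2 ?n3 ?n4 ?n5 ?n6 ?m1 ?m2 ?m3.
move=> j j0; rewrite /hit !(eqg_cnt _ E4) !cntE /cl ci !cnt_nil n1 n2 n3 n4 n5 n6 m1 m2 m3 (ltn_eqF j0) /=.
have := uc j0; have := rc x j0; have := rc y j0; have := rc b j0; have := rc b2 j0.
have := rc b3 j0; have := rc b4 j0.
rewrite !Dx !Dy !Db !Db2 !Db3 !Db4 /cl ci (ltn_eqF j0) /=.
case: (c k1 == j) => //; case: (c k4 == j) => //; clear.
by case: (c i1 == j); case: (c i2 == j); case: (c i3 == j); case: (c i4 == j); case: (c k2 == j);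
  case: (c k3 == j) => //= -[] // ? [] // ? [] // ? [] // ? [] // ? [] // ? [].
Qed.
End Base.

(** * Edge cuts of size three and four *)

Definition dropP c (P : pred nat) : nat -> nat := fun k => if P (c k) then 0 else c k.

Lemma cl_dropP c P l k : 0 < l -> cl (dropP c P) l k = ~~ P l && cl c l k.
Proof.
move=> l0; rewrite /cl /dropP; case: (boolP (P (c k))) => h.
  rewrite ltn_eqF //; case: (eqVneq (c k) l) => [<-|]; first by rewrite h.
  by rewrite andbF.
by case: (eqVneq (c k) l) h => [-> ->|]; rewrite ?andbF.
Qed.

Lemma dg_dropP c P l v G : 0 < l -> dg (cl (dropP c P) l) v G = if P l then 0 else dg (cl c l) v G.
Proof.
move=> l0; rewrite (@eq_dg _ (fun k => ~~ P l && cl c l k)) => [|k u w _]; last exact: cl_dropP.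
by case: (P l) => //=; elim: (G) => // -[[k u] w] G' IH; rewrite dgE IH.
Qed.

Lemma cnt_dropP c P l G : 0 < l -> cnt (cl (dropP c P) l) G = if P l then 0 else cnt (cl c l) G.
Proof.
move=> l0; rewrite (@eq_cnt _ (fun k => ~~ P l && cl c l k)) => [|k u w _]; last exact: cl_dropP.
by case: (P l) => //=; elim: (G) => // -[[k u] w] G' IH; rewrite cntE IH.
Qed.

Lemma hit_dropP c P l M G : 0 < l -> hit (dropP c P) l M G -> hit c l M G.
Proof.
move=> l0 h; apply: leq_trans h _; apply: leq_esum => k u w.
by have := cl_dropP c P k l0; rewrite /cl => ->; case: (M k); case: (P l); case: (c k == l).
Qed.

Lemma nlab_dropP c P G : nlab (dropP c P) G <= nlab c G.
Proof. by apply: leq_esum => k u w; rewrite /dropP; case: (P _). Qed.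

Lemma esum0 f G : (forall k u w, (k, u, w) \in G -> f k u w = 0) -> esum f G = 0.
Proof. by move/eq_esum => ->; elim: G => // -[[k u] w]. Qed.

Lemma eqg_mem G k u w H : eqg G ((k, u, w) :: H) -> (k, u, w) \in G \/ (k, w, u) \in G.
Proof.
move=> e; pose f k' u' w' := ((k', u', w') == (k, u, w)) || ((k', u', w') == (k, w, u)) : nat.
have : 0 < esum f G.
  rewrite e /= /f ?eqxx // => k' u' w'; rewrite !xpair_eqE; clear.
  by case: (k' == k); case: (u' == u); case: (u' == w); case: (w' == u); case: (w' == w).
elim: (G) => //= -[[k' u'] w'] G' IH; rewrite /f !inE.
case: eqP => [->|_]; first by rewrite eqxx; left.
case: eqP => [->|_]; first by rewrite eqxx orbT; right.
by move=> /IH[] h; rewrite h !orbT; [left|right].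
Qed.

Definition flip (e : edge) : edge := (e.1.1, e.2, e.1.2).

Lemma esum_flip f X : (forall k u w, f k u w = f k w u) -> esum f (map flip X) = esum f X.
Proof. by move=> fs; elim: X => //= -[[k u] w] X ->; rewrite /= fs. Qed.

(** Edges of the cut are oriented from [A] outwards, so that first ends lie in [A]; the opposite
    side sees them through [flip]. *)
Record splits A G (GA GB X : seq edge) : Prop := Splits {
  sp_eq : eqg G (GA ++ GB ++ X);
  sp_A : forall k u w, (k, u, w) \in GA -> A u /\ A w;
  sp_B : forall k u w, (k, u, w) \in GB -> ~~ A u /\ ~~ A w;
  sp_X : forall k u w, (k, u, w) \in X -> A u /\ ~~ A w }.

Lemma split_exists A G : exists GA GB X, splits A G GA GB X.
Proof.
elim: G => [|[[k u] w] G [GA [GB [X [e hA hB hX]]]]]; first by exists [::], [::], [::]; split.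
have E : eqg ((k, u, w) :: G) ((k, u, w) :: GA ++ GB ++ X) by apply: eqg_cons.
case Au: (A u); case Aw: (A w).
- exists ((k, u, w) :: GA), GB, X; split=> // k' u' w'; rewrite inE => /orP[/eqP[_ -> ->] //|].
  exact: hA.
- exists GA, GB, ((k, u, w) :: X); split=> //.
    by move=> f fs; rewrite (E f fs) /= !esum_cat /=; clear; lia.
  by move=> k' u' w'; rewrite inE => /orP[/eqP[_ -> ->]|/hX //]; rewrite Au Aw.
- exists GA, GB, ((k, w, u) :: X); split=> //.
    by move=> f fs; rewrite (E f fs) /= !esum_cat /= (fs k w u); clear; lia.
  by move=> k' u' w'; rewrite inE => /orP[/eqP[_ -> ->]|/hX //]; rewrite Au Aw.
- exists GA, ((k, u, w) :: GB), X; split=> //.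
    by move=> f fs; rewrite (E f fs) /= !esum_cat /= ?esum_cat; clear; lia.
  by move=> k' u' w'; rewrite inE => /orP[/eqP[_ -> ->]|/hB //]; rewrite Au Aw.
Qed.

Lemma splits_sym A G GA GB X : splits A G GA GB X -> splits (predC A) G GB GA (map flip X).
Proof.
case=> e hA hB hX; split=> [|k u w /hB //|k u w /hA[h1 h2]|k u w /mapP[[[k' u'] w'] /hX[h1 h2] [_ -> ->]]].
- by move=> f fs; rewrite (e f fs) !esum_cat esum_flip //; clear; lia.
- by rewrite /= !negbK.
- by rewrite /= h2 negbK.
Qed.

Section Split.
Variables (A : pred nat) (G GA GB X : seq edge).
Hypothesis sp : splits A G GA GB X.

Lemma dg_splitA M v : A v -> dg M v G = dg M v GA + dg M v X.
Proof.
move=> Av; rewrite (eqg_dg _ _ (sp_eq sp)) !catE; suff -> : dg M v GB = 0 by [].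
apply: esum0 => k u w /(sp_B sp)[nu nw].
have -> : (u == v) = false by apply: contraNF nu => /eqP ->.
have -> : (w == v) = false by apply: contraNF nw => /eqP ->.
by rewrite !andbF.
Qed.

Lemma dg_splitX M v : A v -> dg M v X = esum (fun k u _ => M k && (u == v)) X.
Proof.
move=> Av; apply: eq_esum => k u w /(sp_X sp)[_ nw].
have -> : (w == v) = false by apply: contraNF nw => /eqP ->.
by rewrite andbF addn0.
Qed.

Lemma cut_split M : cut M A G = cnt M X.
Proof.
rewrite (eqg_cut _ _ (sp_eq sp)) !catE.
have -> : cut M A GA = 0.
  by apply: esum0 => k u w /(sp_A sp)[-> ->]; rewrite andbF.
have -> : cut M A GB = 0.
  by apply: esum0 => k u w /(sp_B sp)[/negbTE -> /negbTE ->]; rewrite andbF.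
by apply: eq_esum => k u w /(sp_X sp)[-> /negbTE ->]; rewrite andbT.
Qed.

(** All degrees of a class are even, so their sum over [A] is even, and inner edges are counted
    twice in it. *)
Lemma cross_even W c j : wf W G -> reg c G -> 0 < j -> exists m, cnt (cl c j) X = 2 * m.
Proof.
move=> wG rc j0; rewrite -cut_split.
have [m hm] : exists m, \sum_(v <- W | A v) dg (cl c j) v G = 2 * m.
  elim: (W) => [|v W' [m h]]; first by exists 0; rewrite big_nil.
  rewrite big_cons h; case: (A v); last by exists m.
  by case: (rc j v j0) => ->; [exists m|exists m.+1]; clear; lia.
have := @handshake W (cl c j) A G (wf_uniq wG); rewrite hm => h.
have {}h : 2 * m = 2 * ins (cl c j) A G + cut (cl c j) A G.
  by apply: h => v vW; rewrite (wf_deg wG) (negbTE vW).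
by exists (m - ins (cl c j) A G); move: h; clear; lia.
Qed.

(** Unique identifiers tell which side an edge belongs to, so [M2] can be taken on [GB] and [M1]
    elsewhere; on the cut both agree. *)
Lemma glue W M1 M2 : wf W G ->
  (forall v, v \in W -> A v -> dg M1 v G = 1) -> (forall v, v \in W -> ~~ A v -> dg M2 v G = 1) ->
  (forall k u w, (k, u, w) \in X -> M1 k = M2 k) ->
  exists M, [/\ pm W M G, forall k u w, (k, u, w) \in GA ++ X -> M k = M1 k &
    forall k u w, (k, u, w) \in GB ++ X -> M k = M2 k].
Proof.
move=> wG h1 h2 hX; pose M k := if 0 < cnt (pred1 k) GB then M2 k else M1 k.
have ids k : cnt (pred1 k) GA + (cnt (pred1 k) GB + cnt (pred1 k) X) <= 1.
  by rewrite -!cnt_cat -(eqg_cnt _ (sp_eq sp)); apply: wf_ids wG k.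
have MA k u w : (k, u, w) \in GA ++ X -> M k = M1 k.
  rewrite mem_cat /M => h; case: ifP => // hB; move: (ids k).
  by case/orP: h => /mem_id; move: hB; clear; lia.
have MB k u w : (k, u, w) \in GB ++ X -> M k = M2 k.
  rewrite mem_cat => /orP[h|h]; first by rewrite /M (mem_id h).
  by rewrite -(hX _ _ _ h); apply: (MA k u w); rewrite mem_cat h orbT.
exists M; split=> // v vW; case: (boolP (A v)) => Av.
  rewrite -(h1 v vW Av) !dg_splitA // -!dg_cat; exact: eq_dg.
rewrite -(h2 v vW Av) !(eqg_dg _ _ (sp_eq sp)) !catE.
have z M' : dg M' v GA = 0.
  apply: esum0 => k u w /(sp_A sp)[nu nw].
  have -> : (u == v) = false by apply: contraTF nu => /eqP ->.
  have -> : (w == v) = false by apply: contraTF nw => /eqP ->.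
  by rewrite !andbF.
by rewrite !z -!dg_cat !add0n; apply: eq_dg.
Qed.
End Split.

(* The other side of a 3-edge-cut is contracted to [p]. *)
Lemma contract_wf W G A GA GB k1 u1 w1 k2 u2 w2 k3 u3 w3 p :
  wf W G -> splits A G GA GB [:: (k1, u1, w1); (k2, u2, w2); (k3, u3, w3)] ->
  p \in W -> ~~ A p ->
  let G1 := GA ++ [:: (k1, u1, p); (k2, u2, p); (k3, u3, p)] in
  wf (p :: [seq v <- W | A v]) G1 /\ (forall M v, A v -> dg M v G1 = dg M v G).
Proof.
move=> wG sp pW Ap G1.
have [[A1 B1] [A2 B2] [A3 B3]] : [/\ A u1 /\ ~~ A w1, A u2 /\ ~~ A w2 & A u3 /\ ~~ A w3].
  by split; [apply: (sp_X sp (k := k1))|apply: (sp_X sp (k := k2))|apply: (sp_X sp (k := k3))];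
     rewrite !inE eqxx ?orbT.
have np v : A v -> (p == v) = false by move=> Av; apply: contraNF Ap => /eqP ->.
have dG1 M v : A v -> dg M v G1 = dg M v G.
  move=> Av; rewrite (dg_splitA sp) // (dg_splitX sp) //= catE !dgE dg_nil np //.
  by rewrite !andbF /=; genb.
have zA v : ~~ A v -> deg v GA = 0.
  move=> Av; apply: esum0 => k u w /(sp_A sp)[nu nw].
  have -> : (u == v) = false by apply: contraTF nu => /eqP ->.
  by have -> : (w == v) = false by apply: contraTF nw => /eqP ->.
split=> //; split.
- by rewrite /= mem_filter (negbTE Ap) filter_uniq // (wf_uniq wG).
- move=> v; rewrite inE mem_filter; case: (boolP (A v)) => Av /=.
    by rewrite dG1 // (wf_deg wG) eq_sym np.
  rewrite orbF catE zA // !dgE dg_nil.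
  have n u : A u -> (u == v) = false by move=> Au; apply: contraTF Au => /eqP ->.
  by rewrite (n u1) // (n u2) // (n u3) // eq_sym; case: (v == p).
- move=> k; apply: leq_trans (wf_ids wG k).
  by rewrite (eqg_cnt _ (sp_eq sp)) /G1 !catE !cntE; genb.
(* Giving the whole contracted side the value of [p] turns a cut of the contraction into a cut of
   [G] of the same size. *)
move=> B u w uW wW Bu Bw; pose B' v := if A v then B v else B p.
have BE v : v \in p :: [seq v <- W | A v] -> B' v = B v.
  rewrite inE mem_filter /B' => /orP[/eqP ->|/andP[-> //]]; by rewrite (negbTE Ap).
have <- : cut xpredT B' G = cut xpredT B G1.
  rewrite (eqg_cut _ _ (sp_eq sp)) !catE.
  have -> : cut xpredT B' GA = cut xpredT B GA.
    by apply: eq_esum => k a b /(sp_A sp)[Aa Ab]; rewrite /B' Aa Ab.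
  have -> : cut xpredT B' GB = 0.
    by apply: esum0 => k a b /(sp_B sp)[/negbTE Aa /negbTE Ab]; rewrite /B' Aa Ab eqxx.
  rewrite add0n !cutE /B' A1 A2 A3.
  by rewrite (negbTE B1) (negbTE B2) (negbTE B3).
have WW v : v \in p :: [seq v <- W | A v] -> v \in W.
  by rewrite inE mem_filter => /orP[/eqP ->|/andP[]].
by apply: (wf_cut wG (WW _ uW) (WW _ wW)); rewrite BE.
Qed.

Lemma dg_out M W G v : wf W G -> v \notin W -> dg M v G = 0.
Proof.
move=> wG vW; apply/eqP; rewrite -leqn0; apply: leq_trans (dg_le M v G) _.
by rewrite (wf_deg wG) (negbTE vW).
Qed.

Lemma edge_side A G GA GB X i x y H : splits A G GA GB X -> eqg G ((i, x, y) :: H) -> A x ->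
  if A y then (i, x, y) \in GA \/ (i, y, x) \in GA else (i, x, y) \in X.
Proof.
move=> sp e Ax; have e' := eqg_trans (eqg_sym (sp_eq sp)) e.
case: (eqg_mem e'); rewrite !mem_cat => /or3P[h|h|h].
- by have [_ ->] := sp_A sp h; left.
- by have [] := sp_B sp h; rewrite Ax.
- by have [_ /negbTE ->] := sp_X sp h.
- by have [-> _] := sp_A sp h; right.
- by have [_] := sp_B sp h; rewrite Ax.
- by have [_] := sp_X sp h; rewrite Ax.
Qed.

Lemma has_edge_mem G i x y : (i, x, y) \in G \/ (i, y, x) \in G -> has_edge G i x y.
Proof.
case=> /mem_eqg[H h]; exists H => //; exact: eqg_trans h (eqg_flip _ _ _ _).
Qed.

Lemma hit_sub c j M M' G G' : (forall k u w, (k, u, w) \in G -> M k = M' k) ->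
  (forall f, cnt f G <= cnt f G') -> hit c j M' G -> hit c j M G'.
Proof.
move=> h le; rewrite /hit (@eq_cnt _ (fun k => M k && (c k == j))) => [h'|k u w /h -> //].
exact: leq_trans h' (le _).
Qed.

Lemma cnt_cut M A G : 0 < cut M A G ->
  exists k u w, [/\ (k, u, w) \in G, M k & A u != A w].
Proof.
elim: G => // -[[k u] w] G IH; rewrite cutE; case: (boolP (M k && (A u != A w))) => [/andP[h1 h2] _|_].
  by exists k, u, w; rewrite mem_head.
by move=> /IH[k' [u' [w' [h h1 h2]]]]; exists k', u', w'; rewrite inE h orbT.
Qed.

(** * Solving across a 3-edge-cut *)

Section Cut3.
Variables (n : nat) (W : seq nat) (G : seq edge) (c : nat -> nat).
Hypotheses (IH : solvable_upto n) (wG : wf W G) (rc : reg c G).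
Hypothesis sz : 2 * size W + nlab c G <= n.+1.

Let crossing X : pred nat := fun l => 0 < cnt (cl c l) X.

(** The side of [x] is solved first, with its labels intact; its matching uses exactly one cut edge,
    as it covers [p] once. That edge is prescribed on the other side, where the crossing classes are
    erased because they are already hit; the contracted vertex [q] then lies on no class, which
    gives [unspanned]. If [y] lies across, [x] must avoid the crossing classes, since they pass
    through [p]. *)
Lemma cut3_side A GA GB k1 u1 w1 k2 u2 w2 k3 u3 w3 i x y :
  let X := [:: (k1, u1, w1); (k2, u2, w2); (k3, u3, w3)] in
  splits A G GA GB X -> 3 <= count A W -> 3 <= count (predC A) W ->
  has_edge G i x y -> unspanned c x y G -> A x ->
  (A y \/ forall j, 0 < j -> 0 < cnt (cl c j) X -> dg (cl c j) x G = 0) ->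
  solvable W G i x y c.
Proof.
move=> X sp cA cB [H e] uc Ax xy.
have [p pW Ap] : exists2 p, p \in W & ~~ A p.
  by apply/hasP; rewrite has_count; apply: leq_trans cB.
have [q qW Aq] : exists2 q, q \in W & A q.
  by apply/hasP; rewrite has_count; apply: leq_trans cA.
have nAq : ~~ predC A q by rewrite /= Aq.
have cW := count_predC A W.
have [wA dA] := contract_wf wG sp pW Ap.
have [wB dB] := contract_wf wG (splits_sym sp) qW nAq.
set WA := p :: _ in wA; set G1 := GA ++ _ in wA dA.
set WB := q :: _ in wB; set G2 := GB ++ _ in wB dB.
have cG1 f : cnt f G1 = cnt f (GA ++ X) by rewrite !cnt_cat.
have cG2 f : cnt f G2 = cnt f (GB ++ X) by rewrite !cnt_cat.
have leA f : cnt f (GA ++ X) <= cnt f G.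
  by rewrite (eqg_cnt _ (sp_eq sp)) !cnt_cat; clear; lia.
have leB f : cnt f (GB ++ X) <= cnt f G.
  by rewrite (eqg_cnt _ (sp_eq sp)) !cnt_cat; clear; lia.
have [[A1 _] [A2 _] [A3 _]] : [/\ A u1 /\ ~~ A w1, A u2 /\ ~~ A w2 & A u3 /\ ~~ A w3].
  by split; [apply: (sp_X sp (k := k1))|apply: (sp_X sp (k := k2))|apply: (sp_X sp (k := k3))];
     rewrite !inE eqxx ?orbT.
have [[_ B1] [_ B2] [_ B3]] : [/\ A u1 /\ ~~ A w1, A u2 /\ ~~ A w2 & A u3 /\ ~~ A w3].
  by split; [apply: (sp_X sp (k := k1))|apply: (sp_X sp (k := k2))|apply: (sp_X sp (k := k3))];
     rewrite !inE eqxx ?orbT.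
have EA : eqg G1 [:: (k1, p, u1), (k2, p, u2), (k3, p, u3) & GA].
  by move=> f fs; rewrite esum_cat /= (fs k1 u1) (fs k2 u2) (fs k3 u3); clear; lia.
have EB : eqg G2 [:: (k1, q, w1), (k2, q, w2), (k3, q, w3) & GB].
  by move=> f fs; rewrite esum_cat /= (fs k1 w1) (fs k2 w2) (fs k3 w3); clear; lia.
have dp := deg3 wA EA; have dq := deg3 wB EB.
have cX f : cnt f X = f k1 + f k2 + f k3 by rewrite !cntE cnt_nil; clear; lia.
have regA : reg c G1.
  move=> j v j0; case: (boolP (v \in WA)) => [|vW]; last by left; apply: dg_out wA vW.
  rewrite inE mem_filter => /orP[/eqP -> | /andP[Av _]]; last by rewrite dA //; apply: rc.
  rewrite dp; have [m] := cross_even sp wG rc j0; rewrite cX.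
  by case: (cl c j k1); case: (cl c j k2); case: (cl c j k3) => /=; clear; lia.
pose cB' := dropP c (crossing X).
have dq0 j : 0 < j -> dg (cl cB' j) q G2 = 0.
  move=> j0; rewrite dq !cl_dropP // /crossing cX.
  by case: (cl c j k1); case: (cl c j k2); case: (cl c j k3).
have regB : reg cB' G2.
  move=> j v j0; case: (boolP (v \in WB)) => [|vW]; last by left; apply: dg_out wB vW.
  rewrite inE mem_filter => /orP[/eqP -> | /andP[Av _]]; first by left; apply: dq0.
  by rewrite dB // dg_dropP //; case: ifP => _; [left|apply: rc].
pose y' := if A y then y else p.
have eS := edge_side sp e Ax.
have eA : has_edge G1 i x y'.
  apply: has_edge_mem; rewrite /y' /G1 !mem_cat; case: ifP eS => _; first by case=> ->; [left|right].
  by rewrite /X !inE => /or3P[] /eqP[-> -> _]; left; rewrite eqxx ?orbT.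
have unA : unspanned c x y' G1.
  move=> j j0; rewrite dA // /y'; case: ifP => Ay; first by rewrite dA //; apply: uc.
  rewrite dp; case: xy => [|xy]; first by rewrite Ay.
  case: (posnP (cnt (cl c j) X)) => [h|/(xy j j0) ->]; last by left.
  by right; rewrite -cX.
have nlA : 2 * size WA + nlab c G1 <= n.
  have : size WA = (count A W).+1 by rewrite /= size_filter.
  have : nlab c G1 <= nlab c G by rewrite /nlab cG1 leA.
  by move: cB sz; rewrite -cW; clear; lia.
have nlB : 2 * size WB + nlab cB' G2 <= n.
  have : size WB = (count (predC A) W).+1 by rewrite /= size_filter.
  have : nlab cB' G2 <= nlab c G.
    by apply: leq_trans (nlab_dropP _ _ _) _; rewrite /nlab cG2 leB.
  by move: cA sz; rewrite -cW; clear; lia.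
have [M1 [M1i pM1 gM1]] := IH nlA wA eA regA unA.
have := pM1 p (mem_head _ _); rewrite dp => h1.
have [k [w [kX Mk Mo]]] : exists k w, [/\ (k, w, q) \in G2, M1 k &
    forall M, M k -> M k1 + M k2 + M k3 = 1 -> [/\ M1 k1 = M k1, M1 k2 = M k2 & M1 k3 = M k3]].
  move: h1; case m1: (M1 k1); case m2: (M1 k2); case m3: (M1 k3) => // _.
  - exists k1, w1; rewrite /G2 mem_cat !inE eqxx orbT; split=> // M -> //.
    by case: (M k2); case: (M k3).
  - exists k2, w2; rewrite /G2 mem_cat !inE eqxx !orbT; split=> // M -> //.
    by case: (M k1); case: (M k3).
  - exists k3, w3; rewrite /G2 mem_cat !inE eqxx !orbT; split=> // M -> //.
    by case: (M k1); case: (M k2).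
have eB : has_edge G2 k w q by apply: has_edge_mem; left.
have unB : unspanned cB' w q G2 by move=> j j0; right; apply: dq0.
have [M2 [M2k pM2 gM2]] := IH nlB wB eB regB unB.
have := pM2 q (mem_head _ _); rewrite dq => /(Mo _ M2k)[m1 m2 m3].
have [|||M [pM MA MB]] := glue sp (M1 := M1) (M2 := M2) wG.
- by move=> v vW Av; rewrite -dA //; apply: pM1; rewrite inE mem_filter vW Av orbT.
- by move=> v vW Av; rewrite -dB //; apply: pM2; rewrite inE mem_filter vW /= Av orbT.
- by move=> a b d; rewrite !inE => /or3P[] /eqP[-> _ _].
exists M; split=> //.
  have [u [v iA]] : exists u v, (i, u, v) \in GA ++ X.
    move: eS; case: (A y) => [[] h|h]; [exists x, y|exists y, x|exists x, y]; rewrite mem_cat h ?orbT //.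
  by rewrite (MA _ _ _ iA).
move=> j j0; rewrite (eqg_cnt _ (sp_eq sp)) !cnt_cat => cj.
case: (posnP (cnt (cl c j) GA + cnt (cl c j) X)) => h.
  apply: (hit_sub MB leB); rewrite /hit -cG2; apply: (hit_dropP j0 (P := crossing X)).
  apply: gM2 => //; rewrite cnt_dropP // /crossing cG2 cnt_cat; move: h cj; clear.
  by case: (cnt (cl c j) X) => [|m] /=; lia.
by apply: (hit_sub MA leA); rewrite /hit -cG1; apply: gM1 => //; rewrite cG1 cnt_cat.
Qed.

(** A crossing class uses at least two of the three cut edges. *)
Lemma cross_unique A j l : cut xpredT A G <= 3 -> 0 < j -> 0 < l ->
  0 < cut (cl c j) A G -> 0 < cut (cl c l) A G -> j = l.
Proof.
move=> c3 j0 l0; have [GA [GB [X sp]]] := split_exists A G; move: c3; rewrite !(cut_split sp) => c3.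
have [m hm] := cross_even sp wG rc j0; have [m' hm'] := cross_even sp wG rc l0.
rewrite hm hm' => m0 m0'; apply/eqP/negPn/negP => jl.
suff : cnt (cl c j) X + cnt (cl c l) X <= cnt xpredT X by move: hm hm' m0 m0' c3; clear; lia.
rewrite -esumD; apply: leq_esum => k u w; rewrite /cl.
by case: (eqVneq (c k) j) => [->|]; [rewrite (negbTE jl)|case: (c k == l)].
Qed.

(** If [i] crosses the cut, the construction has to start at an end that is off the crossing class.
    There is at most one such class, and by [unspanned] it misses one of the two ends. *)
Lemma solve_cut3 A i x y : has_edge G i x y -> unspanned c x y G ->
  cut xpredT A G <= 3 -> 3 <= count A W -> 3 <= count (predC A) W -> solvable W G i x y c.
Proof.
move=> e uc cA3 cA cB.
have uc' : unspanned c y x G by move=> j j0; have [] := uc j j0; [right|left].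
have e' : has_edge G i y x by case: e => H e; exists H; apply: eqg_trans e (eqg_flip _ _ _ _).
have c3 : cut xpredT A G = 3.
  apply/eqP; rewrite eqn_leq cA3; apply: (wf_cut_count wG); first by apply: leq_trans cA.
  by rewrite -(count_predC A W); move: cB; clear; lia.
have main A' x' y' : cut xpredT A' G = 3 -> 3 <= count A' W -> 3 <= count (predC A') W ->
   has_edge G i x' y' -> unspanned c x' y' G -> A' x' ->
   (A' y' \/ forall j, 0 < j -> 0 < cut (cl c j) A' G -> dg (cl c j) x' G = 0) ->
   solvable W G i x' y' c.
  move=> {}c3 {}cA {}cB {}e {}uc Ax hyp; have [GA [GB [X sp]]] := split_exists A' G.
  have : cnt xpredT X = 3 by rewrite -(cut_split sp).
  case: X sp => [//|[[k1 u1] w1] X] sp; case: X sp => [//|[[k2 u2] w2] X] sp.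
  case: X sp => [//|[[k3 u3] w3] X] sp; case: X sp => [|[[? ?] ?] ? //] sp _.
  apply: (cut3_side sp cA cB e uc Ax); case: hyp => [|hyp]; [by left|right=> j j0].
  by rewrite -(cut_split sp); apply: hyp.
have cC : cut xpredT (predC A) G = 3 by rewrite cutC.
have cBC : 3 <= count (predC (predC A)) W.
  by rewrite (eq_count (a2 := A)) // => v; rewrite /= negbK.
have across A' x' y' : cut xpredT A' G = 3 -> 3 <= count A' W -> 3 <= count (predC A') W ->
   3 <= count (predC (predC A')) W ->
   has_edge G i x' y' -> has_edge G i y' x' -> unspanned c x' y' G -> unspanned c y' x' G ->
   A' x' -> ~~ A' y' -> solvable W G i x' y' c.
  move=> {}c3 {}cA {}cB {}cBC {}e {}e' {}uc {}uc' Ax Ay.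
  pose P e := [&& 0 < c e.1.1, A' e.1.2 != A' e.2 & 0 < dg (cl c (c e.1.1)) x' G].
  case: (boolP (has P G)) => hP; last first.
    apply: (main A' x' y') => //; right=> j j0 /cnt_cut[k [u [w [kG /eqP ckj Auw]]]].
    apply/eqP; rewrite -leqn0 leqNgt; apply: contra hP => h.
    by apply/hasP; exists (k, u, w) => //; rewrite /P /= ckj j0 Auw h.
  suff: solvable W G i y' x' c by [].
  apply: (main (predC A') y' x'); rewrite ?cutC //=.
  right=> j j0; rewrite cutC => cj.
  have /hasP[[[k u] w] kG /and3P[/= ck Auw dx]] := hP.
  have -> : j = c k.
    apply: (cross_unique (A := A')); rewrite ?c3 //.
    apply: leq_trans (mem_esum _ kG); by rewrite /cl eqxx Auw.
  by have [h|] := uc _ ck; first by rewrite h in dx.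
case Ax: (A x); case Ay: (A y).
- by apply: (main A x y) => //; left.
- by apply: (across A x y); rewrite ?Ax ?Ay.
- suff: solvable W G i y x c by [].
  by apply: (across A y x); rewrite ?Ax ?Ay.
- by apply: (main (predC A) x y); rewrite /= ?Ax ?Ay //; left.
Qed.
End Cut3.

Definition NT3 W G := forall A, cut xpredT A G <= 3 -> count A W <= 2 \/ count (predC A) W <= 2.

(* The other side of a 4-edge-cut is replaced by two adjacent vertices [p] and [q], named after
   two vertices of that side; [i0] names the edge [p q].  Of the crossing labels only those in [K]
   are kept, and [s] is the label of [p q]. *)
Section Complete.
Variables (W : seq nat) (G : seq edge) (A : pred nat) (GA GB : seq edge).
Variables (k1 u1 w1 k2 u2 w2 k3 u3 w3 k4 u4 w4 : nat).
Let X := [:: (k1, u1, w1); (k2, u2, w2); (k3, u3, w3); (k4, u4, w4)].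
Variables (p q i0 : nat).
Hypotheses (wG : wf W G) (nt3 : NT3 W G) (sp : splits A G GA GB X).
Hypotheses (cA : 3 <= count A W) (cB : 3 <= count (predC A) W).
Hypotheses (pW : p \in W) (qW : q \in W) (Ap : ~~ A p) (Aq : ~~ A q) (pq : p != q).
Hypothesis (i0B : 0 < cnt (pred1 i0) GB).

Let G1 := GA ++ [:: (k1, u1, p); (k2, u2, p); (k3, u3, q); (k4, u4, q); (i0, p, q)].
Let W1 := p :: q :: [seq v <- W | A v].

Let ends k u w : (k, u, w) \in X -> A u /\ ~~ A w. Proof. by move=> h; apply: (sp_X sp h). Qed.
Let E1 : A u1 /\ ~~ A w1. Proof. by apply: (ends (k := k1)); rewrite !inE eqxx ?orbT. Qed.
Let E2 : A u2 /\ ~~ A w2. Proof. by apply: (ends (k := k2)); rewrite !inE eqxx ?orbT. Qed.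
Let E3 : A u3 /\ ~~ A w3. Proof. by apply: (ends (k := k3)); rewrite !inE eqxx ?orbT. Qed.
Let E4 : A u4 /\ ~~ A w4. Proof. by apply: (ends (k := k4)); rewrite !inE eqxx ?orbT. Qed.

Let ne u v : ~~ A u -> A v -> (u == v) = false.
Proof. by move=> nu Av; apply: contraNF nu => /eqP ->. Qed.
Let ne' u v : A u -> ~~ A v -> (u == v) = false.
Proof. by move=> Au nv; rewrite eq_sym ne. Qed.

Lemma complete_dg M v : A v -> dg M v G1 = dg M v G.
Proof.
move=> Av; rewrite (dg_splitA sp) // (dg_splitX sp) //= catE !dgE dg_nil !(ne Ap Av) !(ne Aq Av).
by rewrite !andbF /=; genb.
Qed.

Let zA v : ~~ A v -> deg v GA = 0.
Proof.
move=> Av; apply: esum0 => k u w /(sp_A sp)[nu nw].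
by rewrite !ne'.
Qed.

(** A cut with [p] and [q] on the same side is a cut of [G]. A cut of size at most 2 that separates
    them contains [i0] and at most one more edge. It divides [A] into two non-empty parts, each with
    at most three cut edges in [G]; by [NT3] and parity each is a single vertex, but [A] has at
    least three. *)
Lemma complete_wf : wf W1 G1.
Proof.
have [[A1 B1] [A2 B2] [A3 B3] [A4 B4]] := And4 E1 E2 E3 E4.
split.
- by rewrite /= !inE negb_or pq !mem_filter (negbTE Ap) (negbTE Aq) filter_uniq // (wf_uniq wG).
- move=> v; rewrite !inE mem_filter; case: (boolP (A v)) => Av /=.
    by rewrite complete_dg // (wf_deg wG) ![v == _]eq_sym !(ne Ap Av) !(ne Aq Av).
  rewrite orbF /G1 catE zA // !dgE dg_nil (ne' A1) // (ne' A2) // (ne' A3) // (ne' A4) //=.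
  rewrite ![v == _]eq_sym; case: (eqVneq p v) => [pv|_]; last by case: (q == v).
  by rewrite -pv eq_sym (negbTE pq).
- move=> k; apply: leq_trans (wf_ids wG k).
  rewrite (eqg_cnt _ (sp_eq sp)) /G1 !catE !cntE /=.
  case: (eqVneq i0 k) => [<-|_]; last by genb.
  by move: i0B; genb.
move=> B u w uW wW Bu Bw.
have WW v : v \in W1 -> v \in W.
  by rewrite !inE mem_filter => /or3P[/eqP ->|/eqP ->|/andP[]].
have cutD D a b : (forall v, A v -> D v = (B v == a)) -> (forall v, ~~ A v -> D v = b) ->
  cut xpredT D G = cut xpredT B GA + ((B u1 == a) != b) + ((B u2 == a) != b) +
     ((B u3 == a) != b) + ((B u4 == a) != b).
  move=> D1 D2; rewrite (eqg_cut _ _ (sp_eq sp)) !catE.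
  have -> : cut xpredT D GA = cut xpredT B GA.
    apply: eq_esum => k v v' /(sp_A sp)[Av Av']; rewrite !D1 //.
    by case: (a); case: (B v); case: (B v').
  have -> : cut xpredT D GB = 0.
    by apply: esum0 => k v v' /(sp_B sp)[Av Av']; rewrite !D2 // eqxx.
  rewrite !cutE cut_nil !(D1 u1) // !(D1 u2) // !(D1 u3) // !(D1 u4) //.
  by rewrite !(D2 w1) // !(D2 w2) // !(D2 w3) // !(D2 w4) //=; genb.
have -> : cut xpredT B G1 = cut xpredT B GA + (B u1 != B p) + (B u2 != B p) + (B u3 != B q) +
    (B u4 != B q) + (B p != B q).
  by rewrite /G1 catE !cutE cut_nil /=; genb.
case: (boolP (B p == B q)) => Bpq.
  pose D v := if A v then B v == true else B p.
  have <- : cut xpredT D G = cut xpredT B GA + (B u1 != B p) + (B u2 != B p) + (B u3 != B q) +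
    (B u4 != B q) + ~~ true.
    rewrite (cutD D true (B p)) /D; [|by move=> v ->|by move=> v /negbTE ->].
    rewrite -(eqP Bpq) addn0.
    by case: (B u1); case: (B u2); case: (B u3); case: (B u4).
  have DE v : v \in W1 -> D v = B v.
    rewrite !inE mem_filter /D => /or3P[/eqP ->|/eqP ->|/andP[-> _]]; last by case: (B v).
      by rewrite (negbTE Ap).
    by rewrite (negbTE Aq) (eqP Bpq).
  by apply: (wf_cut wG (WW _ uW) (WW _ wW)); rewrite DE.
rewrite leqNgt; apply/negP => lt3.
have small b : (exists v, [/\ v \in W, A v & B v = b]) ->
   cut xpredT B GA + (B u1 == b) + (B u2 == b) + (B u3 == b) + (B u4 == b) <= 3 ->
   count (fun v => A v && (B v == b)) W = 1.
  move=> [v [vW Av Bv]] le3; set D := fun v => _.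
  have cD : cut xpredT D G = cut xpredT B GA + (B u1 == b) + (B u2 == b) + (B u3 == b) + (B u4 == b).
    rewrite (cutD D b false); [|by move=> z; rewrite /D => ->|by move=> z; rewrite /D => /negbTE ->].
    by rewrite !(eq_sym (_ == _) false); case: (B u1 == b); case: (B u2 == b); case: (B u3 == b); case: (B u4 == b).
  have c1 : 0 < count D W by rewrite -has_count; apply/hasP; exists v => //; rewrite /D Av Bv eqxx.
  have cP : count (predC A) W <= count (predC D) W.
    by apply: sub_count => z /= /negbTE h; rewrite /D h.
  have c2 : count D W < size W.
    by rewrite -(count_predC D W) -[X in X < _]addn0 ltn_add2l; apply: leq_trans cP; apply: leq_trans cB.
  have := wf_cut_count wG c1 c2; have := wf_handshake D wG; have : cut xpredT D G <= 3 by rewrite cD.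
  move=> d3; have [] := nt3 d3; last by move: cP cB; clear; lia.
  by move: d3 c1; clear; lia.
have uin k v w' : (k, v, w') \in X -> v \in W.
  move=> kX; have : (k, v, w') \in GA ++ GB ++ X by rewrite !mem_cat kX !orbT.
  by move=> /mem_eqg[H h]; have [] := wf_mem wG (eqg_trans (sp_eq sp) h).
have [u1W u3W] : u1 \in W /\ u3 \in W.
  by split; [apply: (uin k1 u1 w1)|apply: (uin k3 u3 w3)]; rewrite !inE eqxx ?orbT.
have [u2W u4W] : u2 \in W /\ u4 \in W.
  by split; [apply: (uin k2 u2 w2)|apply: (uin k4 u4 w4)]; rewrite !inE eqxx ?orbT.
have cAB : count A W = count (fun v => A v && (B v == B p)) W + count (fun v => A v && (B v == B q)) W.
  rewrite -count_predUI [X in _ = _ + X](eq_count (a2 := pred0)) ?count_pred0 ?addn0; last first.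
    by move=> v /=; case: (A v) => //=; move: Bpq; case: (B v); case: (B p); case: (B q).
  by apply: eq_count => v /=; case: (A v) => //=; move: Bpq; case: (B v); case: (B p); case: (B q).
move: cA; rewrite cAB !small //.
- case: (boolP (B u3 == B q)) => h3; first by exists u3; rewrite (eqP h3).
  case: (boolP (B u4 == B q)) => h4; first by exists u4; rewrite (eqP h4).
  by move: lt3; rewrite h3 h4 /=; clear; genb.
- by move: lt3 Bpq; clear; case: (B u1); case: (B u2); case: (B u3); case: (B u4); case: (B p); case: (B q) => //=; lia.
- case: (boolP (B u1 == B p)) => h3; first by exists u1; rewrite (eqP h3).
  case: (boolP (B u2 == B p)) => h4; first by exists u2; rewrite (eqP h4).
  by move: lt3; rewrite h3 h4 /=; clear; genb.
- by move: lt3 Bpq; clear; case: (B u1); case: (B u2); case: (B u3); case: (B u4); case: (B p); case: (B q) => //=; lia.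
Qed.

Lemma complete_p M : dg M p G1 = M k1 + M k2 + M i0.
Proof.
have e : eqg G1 [:: (k1, p, u1), (k2, p, u2), (i0, p, q) & GA ++ [:: (k3, u3, q); (k4, u4, q)]].
  by move=> f fs; rewrite !esum_cat /= esum_cat /= (fs k1 u1) (fs k2 u2); clear; lia.
exact: deg3 complete_wf e M.
Qed.

Lemma complete_q M : dg M q G1 = M k3 + M k4 + M i0.
Proof.
have e : eqg G1 [:: (k3, q, u3), (k4, q, u4), (i0, q, p) & GA ++ [:: (k1, u1, p); (k2, u2, p)]].
  by move=> f fs; rewrite !esum_cat /= esum_cat /= (fs k3 u3) (fs k4 u4) (fs i0 p); clear; lia.
exact: deg3 complete_wf e M.
Qed.

Variables (n : nat) (c : nat -> nat) (K : pred nat) (s : nat).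
Hypotheses (IH : solvable_upto n) (rc : reg c G) (sz : 2 * size W + nlab c G <= n.+1).

Definition crossing j := 0 < cnt (cl c j) X.
Definition relabel k := if k == i0 then s else dropP c (fun j => crossing j && ~~ K j) k.

Hypothesis s_ok : s = 0 \/ crossing s /\ K s.
Hypothesis K_ok : forall j, 0 < j -> crossing j -> K j ->
  ((c k1 == j) + (c k2 == j) + (s == j) = 0 \/ (c k1 == j) + (c k2 == j) + (s == j) = 2) /\
  ((c k3 == j) + (c k4 == j) + (s == j) = 0 \/ (c k3 == j) + (c k4 == j) + (s == j) = 2).

Let i0GAX k u w : (k, u, w) \in GA ++ X -> (k == i0) = false.
Proof.
move=> h; apply/negbTE/eqP => ki; have := wf_ids wG i0; rewrite (eqg_cnt _ (sp_eq sp)) !cnt_cat.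
by move: h; rewrite mem_cat => /orP[] /mem_id; rewrite ki; move: i0B; clear; lia.
Qed.

Let idX : [/\ k1 != i0, k2 != i0, k3 != i0 & k4 != i0].
Proof.
split; apply/negbT; [apply: (i0GAX (u := u1) (w := w1))|apply: (i0GAX (u := u2) (w := w2))|
  apply: (i0GAX (u := u3) (w := w3))|apply: (i0GAX (u := u4) (w := w4))];
  by rewrite mem_cat !inE eqxx ?orbT.
Qed.

Lemma relabel_dg j v : 0 < j -> A v ->
  dg (cl relabel j) v G1 = if crossing j && ~~ K j then 0 else dg (cl c j) v G.
Proof.
move=> j0 Av; rewrite complete_dg // -(@dg_dropP c (fun j => crossing j && ~~ K j)) //.
rewrite !(dg_splitA sp) // -!dg_cat; apply: eq_dg => k u w kG.
by rewrite /cl /relabel (i0GAX kG).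
Qed.

Lemma relabel_p j : 0 < j -> dg (cl relabel j) p G1 =
  if crossing j && K j then (c k1 == j) + (c k2 == j) + (s == j) else 0.
Proof.
have [/negbTE n1 /negbTE n2 _ _] := idX; move=> j0; rewrite complete_p /cl /relabel n1 n2 eqxx.
have := cl_dropP c (fun j => crossing j && ~~ K j) k1 j0; rewrite /cl => ->.
have := cl_dropP c (fun j => crossing j && ~~ K j) k2 j0; rewrite /cl => ->.
case: (boolP (crossing j)) => cj /=; last first.
  have : cnt (cl c j) X = 0 by apply/eqP; rewrite -leqn0 leqNgt.
  rewrite !cntE /cl => z; have -> : (s == j) = false.
    by case: s_ok => [->|[h _]]; [rewrite ltn_eqF|apply: contraNF cj => /eqP <-].
  by move: z; clear; genb.
rewrite negbK; case: (boolP (K j)) => //= nK; have -> // : (s == j) = false.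
by case: s_ok => [->|[_ h]]; [rewrite ltn_eqF|apply: contraNF nK => /eqP <-].
Qed.

Lemma relabel_q j : 0 < j -> dg (cl relabel j) q G1 =
  if crossing j && K j then (c k3 == j) + (c k4 == j) + (s == j) else 0.
Proof.
have [_ _ /negbTE n1 /negbTE n2] := idX; move=> j0; rewrite complete_q /cl /relabel n1 n2 eqxx.
have := cl_dropP c (fun j => crossing j && ~~ K j) k3 j0; rewrite /cl => ->.
have := cl_dropP c (fun j => crossing j && ~~ K j) k4 j0; rewrite /cl => ->.
case: (boolP (crossing j)) => cj /=; last first.
  have : cnt (cl c j) X = 0 by apply/eqP; rewrite -leqn0 leqNgt.
  rewrite !cntE /cl => z; have -> : (s == j) = false.
    by case: s_ok => [->|[h _]]; [rewrite ltn_eqF|apply: contraNF cj => /eqP <-].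
  by move: z; clear; genb.
rewrite negbK; case: (boolP (K j)) => //= nK; have -> // : (s == j) = false.
by case: s_ok => [->|[_ h]]; [rewrite ltn_eqF|apply: contraNF nK => /eqP <-].
Qed.

(** A kept class may be hit by the new edge [i0] only, which is not an edge of this side in [G]; the
    last clause keeps track of this possibility. *)
Lemma side_solve i x y : has_edge G1 i x y -> unspanned relabel x y G1 ->
  exists M, [/\ M i /\ (forall v, v \in W -> A v -> dg M v G = 1),
    forall j, 0 < j -> ~~ crossing j -> 0 < cnt (cl c j) (GA ++ X) -> hit c j M (GA ++ X),
    M k1 + M k2 + M i0 = 1, M k3 + M k4 + M i0 = 1 &
    forall j, 0 < j -> crossing j -> K j -> hit c j M (GA ++ X) \/ M i0 /\ s = j].
Proof.
move=> e un; have wG1 := complete_wf.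
have rG : reg relabel G1.
  move=> j v j0; case: (boolP (v \in W1)) => [|vW]; last by left; apply: dg_out wG1 vW.
  rewrite !inE mem_filter => /or3P[/eqP ->|/eqP ->|/andP[Av _]].
  - rewrite relabel_p //; case: ifP => [/andP[cj Kj]|_]; last by left.
    by have [] := K_ok j0 cj Kj.
  - rewrite relabel_q //; case: ifP => [/andP[cj Kj]|_]; last by left.
    by have [] := K_ok j0 cj Kj.
  - by rewrite relabel_dg //; case: ifP => _; [left|apply: rc].
have cG1 f : cnt f G1 = cnt f (GA ++ X) + f i0.
  by rewrite /G1 !cnt_cat !cntE !cnt_nil; clear; genb.
(* At least three vertices are replaced by two, which lowers the measure by 2, and [i0] adds at most
   one labelled edge. *)
have szG1 : 2 * size W1 + nlab relabel G1 <= n.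
  have -> : size W1 = (count A W).+2 by rewrite /= size_filter.
  have : nlab relabel G1 <= (nlab c G).+1.
    have h1 : nlab relabel (GA ++ X) <= nlab c G.
      apply: leq_trans (_ : nlab c (GA ++ X) <= _); last first.
        by rewrite /nlab (eqg_cnt _ (sp_eq sp)) !cnt_cat; clear; lia.
      apply: leq_trans (nlab_dropP c (fun j => crossing j && ~~ K j) _).
      rewrite leq_eqVlt; apply/orP; left; apply/eqP; apply: eq_cnt => k u w kG.
      by rewrite /relabel (i0GAX kG).
    by rewrite /nlab cG1; move: h1; rewrite /nlab; genb.
  by move: sz cB; rewrite -(count_predC A W); clear; lia.
have [M [Mi pM gM]] := IH szG1 wG1 e rG un.
have hitE j : 0 < j -> ~~ (crossing j && ~~ K j) -> 0 < cnt (cl c j) (GA ++ X) ->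
  hit c j M (GA ++ X) \/ M i0 /\ s = j.
  move=> j0 nd pj; have : hit relabel j M G1.
    apply: gM => //; rewrite cG1; apply: leq_trans (leq_addr _ _); apply: leq_trans pj _.
    have := cnt_dropP c (fun j => crossing j && ~~ K j) (GA ++ X) j0; rewrite (negbTE nd) => <-.
    by rewrite (@eq_cnt _ (cl relabel j)) // => k u w kG; rewrite /cl /relabel (i0GAX kG).
  rewrite /hit cG1; case: (boolP (M i0 && (relabel i0 == j))) => [/andP[h1 h2] _|_].
    by right; move: h2; rewrite /relabel eqxx => /eqP.
  rewrite addn0 => h; left.
  apply: (hit_dropP j0 (P := fun j => crossing j && ~~ K j)).
  rewrite /hit (@eq_cnt _ (fun k => M k && (relabel k == j))) // => k u w kG.
  by rewrite /relabel (i0GAX kG).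
exists M; split.
- split=> // v vW Av; rewrite -complete_dg //; apply: pM; by rewrite !inE mem_filter Av vW !orbT.
- move=> j j0 ncj pj; have [|//|[_ sj]] := hitE j j0 _ pj; first by rewrite (negbTE ncj).
  by exfalso; case: s_ok => [z|[h _]]; [rewrite -sj z in j0|rewrite -sj h in ncj].
- by rewrite -complete_p; apply: pM; rewrite mem_head.
- by rewrite -complete_q; apply: pM; rewrite !inE eqxx orbT.
move=> j j0 cj Kj; apply: hitE => //; first by rewrite Kj andbF.
by rewrite cnt_cat; apply: leq_trans cj _; rewrite leq_addl.
Qed.
End Complete.

Implicit Types (X : seq edge).

Lemma esum_perm f X Y : perm_eq X Y -> esum f X = esum f Y.
Proof.
have eb Z : esum f Z = \sum_(e <- Z) f e.1.1 e.1.2 e.2.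
  by elim: Z => [|[[k u] w] Z IH]; rewrite ?big_nil // big_cons /= IH.
by move=> p; rewrite !eb (perm_big _ p).
Qed.

Lemma splits_perm A G GA GB X Y : perm_eq X Y -> splits A G GA GB X -> splits A G GA GB Y.
Proof.
move=> p [e hA hB hX]; split=> // [f fs|k u w].
  by rewrite (e f fs) !esum_cat (esum_perm _ p).
by rewrite -(perm_mem p); apply: hX.
Qed.

(** * Matchings of one closed-up side of a 4-edge-cut *)

Section Steps.
Variables (n : nat) (W : seq nat) (G : seq edge) (c : nat -> nat).
Hypotheses (IH : solvable_upto n) (wG : wf W G) (nt3 : NT3 W G) (rc : reg c G).
Hypothesis sz : 2 * size W + nlab c G <= n.+1.

Definition half A GA X (R : pred nat) M :=
  (forall v, v \in W -> A v -> dg M v G = 1) /\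
  (forall j, 0 < j -> R j -> 0 < cnt (cl c j) (GA ++ X) -> hit c j M (GA ++ X)).
Definition crosses X j := 0 < cnt (cl c j) X.
Definition matches X e f M := forall g, g \in X -> M g.1.1 = (g == e) || (g == f).
Definition misses X M := forall g, g \in X -> ~~ M g.1.1.

Section Side.
Variables (A : pred nat) (GA GB : seq edge) (e1 e2 e3 e4 : edge).
Let X := [:: e1; e2; e3; e4].
Hypotheses (sp : splits A G GA GB X) (cA : 3 <= count A W) (cB : 3 <= count (predC A) W).

Let aux : exists p q i0, [/\ p \in W /\ q \in W, ~~ A p /\ ~~ A q, p != q & 0 < cnt (pred1 i0) GB].
Proof.
have sF : size (filter (predC A) W) = count (predC A) W by rewrite size_filter.
move: (filter_uniq (predC A) (wf_uniq wG)) sF cB.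
case E: (filter (predC A) W) => [|p [|q s]] /=; try by move=> _ <-.
rewrite inE negb_or => /andP[/andP[pq _] _] _ _.
have [pW Ap] : p \in W /\ ~~ A p.
  by apply/andP; rewrite andbC -[~~ A p]/(predC A p) -mem_filter E mem_head.
have [qW Aq] : q \in W /\ ~~ A q.
  by apply/andP; rewrite andbC -[~~ A q]/(predC A q) -mem_filter E !inE eqxx orbT.
case EB: GB => [|[[i0 u] w] GB']; last first.
  by exists p, q, i0; split=> //; rewrite cntE /= eqxx.
have := wf_handshake (predC A) wG; have -> : cut xpredT (predC A) G = 4.
  by rewrite cutC (cut_split sp) /X; case: (e1) (e2) (e3) (e4) => [[? ?] ?] [[? ?] ?] [[? ?] ?] [[? ?] ?].
have -> : ins xpredT (predC A) G = 0.
  rewrite (eqg_ins _ _ (sp_eq sp)) EB !catE ins_nil.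
  have -> : ins xpredT (predC A) GA = 0 by apply: esum0 => k u w /(sp_A sp)[/= -> ->].
  by apply: esum0 => k u w /(sp_X sp)[/= -> _].
by move=> h; exfalso; move: cB h; clear; lia.
Qed.

Let uniqX : uniq X.
Proof.
have ids k : cnt (pred1 k) X <= 1.
  by apply: leq_trans (wf_ids wG k); rewrite (eqg_cnt _ (sp_eq sp)) !cnt_cat addnA leq_addl.
elim: (X) ids => [//|[[k u] w] X' IHX] ids; rewrite cons_uniq; apply/andP; split.
  apply/negP => /mem_id h; have := ids k; rewrite cntE /pred1 /= eqxx addnC addn1 ltnS leqNgt => /negP; exact.
by apply: IHX => k'; apply: leq_trans (ids k'); rewrite cntE leq_addl.
Qed.

(** The edges [e1] and [e2] are attached to [p]. If exactly one of them is in class [l], the new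
    edge must carry [l] to keep the class 2-regular at [p], and by parity this also works at [q]. *)
Definition sep l := (c e1.1.1 == l) != (c e2.1.1 == l).

Let cX j : cnt (cl c j) X = (c e1.1.1 == j) + (c e2.1.1 == j) + (c e3.1.1 == j) + (c e4.1.1 == j).
Proof.
rewrite /X /cnt /cl; case: (e1) => [[k1 u1] w1]; case: (e2) => [[k2 u2] w2].
by case: (e3) => [[k3 u3] w3]; case: (e4) => [[k4 u4] w4] /=; clear; lia.
Qed.

Let keep_ok l : exists s, [/\ ~~ sep l -> s = 0, s = 0 \/ crosses X s /\ pred1 l s &
  forall j, 0 < j -> crosses X j -> pred1 l j ->
  ((c e1.1.1 == j) + (c e2.1.1 == j) + (s == j) = 0 \/ (c e1.1.1 == j) + (c e2.1.1 == j) + (s == j) = 2) /\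
  ((c e3.1.1 == j) + (c e4.1.1 == j) + (s == j) = 0 \/ (c e3.1.1 == j) + (c e4.1.1 == j) + (s == j) = 2)].
Proof.
pose s := if sep l then l else 0; exists s; split; first by rewrite /s => /negbTE ->.
  rewrite /s; case: ifP => h; [right|by left]; rewrite /= eqxx; split=> //.
  by rewrite /crosses cX; move: h; rewrite /sep; case: (c e1.1.1 == l); case: (c e2.1.1 == l).
move=> j j0 _ /eqP jl; subst j; have [m] := cross_even sp wG rc j0; rewrite cX /s /sep.
case: (c e1.1.1 == l); case: (c e2.1.1 == l); case: (c e3.1.1 == l); case: (c e4.1.1 == l) => /=;
  rewrite ?eqxx ?(ltn_eqF j0) /=; clear; lia.
Qed.

Let mem4 g : g \in X -> [\/ g = e1, g = e2, g = e3 | g = e4].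
Proof.
rewrite !inE => /or4P[] /eqP ->;
  by [constructor 1|constructor 2|constructor 3|constructor 4].
Qed.

Let matches4 (a b : bool) M :
  M e1.1.1 = a -> M e2.1.1 = ~~ a -> M e3.1.1 = b -> M e4.1.1 = ~~ b ->
  matches X (if a then e1 else e2) (if b then e3 else e4) M.
Proof.
move=> m1 m2 m3 m4 g /mem4 gX; have := uniqX; rewrite /= !inE !negb_or.
case/and4P=> /and3P[/negbTE n12 /negbTE n13 /negbTE n14] /andP[/negbTE n23 /negbTE n24] /negbTE n34 _.
by case: gX => ->; rewrite ?m1 ?m2 ?m3 ?m4; case: (a); case: (b);
  rewrite ?eqxx ?orbT //= ?n12 ?n13 ?n14 ?n23 ?n24 ?n34 // 1?[e2 == e1]eq_sym 1?[e3 == e1]eq_sym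
   1?[e3 == e2]eq_sym 1?[e4 == e1]eq_sym 1?[e4 == e2]eq_sym 1?[e4 == e3]eq_sym
   ?n12 ?n13 ?n14 ?n23 ?n24 ?n34.
Qed.

Let misses4 M : M e1.1.1 + M e2.1.1 = 0 -> M e3.1.1 + M e4.1.1 = 0 -> misses X M.
Proof.
move=> h1 h2 g /mem4[] ->; move: h1 h2;
by case: (M e1.1.1); case: (M e2.1.1); case: (M e3.1.1); case: (M e4.1.1).
Qed.

(** With [i] prescribed and only the crossing class [l] kept, the matching either contains the new
    edge and no cut edge, or covers each of [p] and [q] by a cut edge. In the first case the hit of
    [l] is genuine only if the new edge does not carry [l]. *)
Lemma step_internal l i x y :
  A x -> A y -> (i, x, y) \in GA \/ (i, y, x) \in GA -> unspanned c x y G ->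
  exists M, [/\ M i, half A GA X (fun j => ~~ crosses X j) M &
   (misses X M /\ (~~ sep l -> 0 < l -> crosses X l -> hit c l M (GA ++ X))) \/
   ((0 < l -> crosses X l -> hit c l M (GA ++ X)) /\
    exists e f, [/\ e \in [:: e1; e2], f \in [:: e3; e4] & matches X e f M])].
Proof.
move=> Ax Ay iA uc; have [a [b [i0 [[aW bW] [Aa Ab] ab i0B]]]] := aux.
have [s [ns0 s_ok K_ok]] := keep_ok l.
move: mem4 matches4 misses4 ns0 s_ok K_ok; move: sp; rewrite /sep /X.
case: e1 => [[k1 u1] w1]; case: e2 => [[k2 u2] w2]; case: e3 => [[k3 u3] w3]; case: e4 => [[k4 u4] w4] /=.
move=> sp' _ mat mis ns0 s_ok K_ok.
have dG := @relabel_dg W G A GA GB _ _ _ _ _ _ _ _ _ _ _ _ a b i0 wG sp' Aa Ab i0B c (pred1 l) s.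
have [||M [[Mi MA] Mh Mp Mq Mc]] := @side_solve W G A GA GB _ _ _ _ _ _ _ _ _ _ _ _ a b i0 wG nt3
   sp' cA cB aW bW Aa Ab ab i0B n c (pred1 l) s IH rc sz s_ok K_ok i x y.
- by apply: has_edge_mem; rewrite !mem_cat; case: iA => ->; [left|right].
- move=> j j0; rewrite (dG j x) // (dG j y) //; case: ifP => _; [by left|exact: uc].
exists M; split=> //.
case: (boolP (M i0)) => m0.
  left; split; first by apply: mis; move: Mp Mq; rewrite m0; clear; lia.
  move=> ns l0 cl; have [//|[_ sl]] := Mc l l0 cl (eqxx l); exfalso.
  by rewrite -sl (ns0 ns) in l0.
right; split; first by move=> l0 cl; have [//|[]] := Mc l l0 cl (eqxx l); rewrite (negbTE m0).
rewrite (negbTE m0) in Mp Mq.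
have := mat (M k1) (M k3) M; set e := if _ then _ else _; set f := if _ then _ else _ => h.
exists e, f; split; rewrite /e /f ?inE; try by case: ifP; rewrite eqxx ?orbT.
by apply: h => //; move: Mp Mq; case: (M k1); case: (M k2); case: (M k3); case: (M k4).
Qed.

(** Prescribing [e1] covers [p], which rules out the new edge and leaves [e3] or [e4] for [q],
    without control over which. Only the class [l] is kept at [p], so it is the one that the end of
    [e1] in [A] must avoid. *)
Lemma step_crossing l : (0 < l -> crosses X l -> dg (cl c l) e1.1.2 G = 0) ->
  exists M, [/\ half A GA X (fun j => ~~ crosses X j) M,
   0 < l -> crosses X l -> hit c l M (GA ++ X) & matches X e1 e3 M \/ matches X e1 e4 M].
Proof.
move=> ul; have [a [b [i0 [[aW bW] [Aa Ab] ab i0B]]]] := aux.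
have [s [ns0 s_ok K_ok]] := keep_ok l.
move: mem4 matches4 misses4 s_ok K_ok ul; move: sp; rewrite /sep /X.
case: e1 => [[k1 u1] w1]; case: e2 => [[k2 u2] w2]; case: e3 => [[k3 u3] w3]; case: e4 => [[k4 u4] w4] /=.
move=> sp' _ mat mis s_ok K_ok ul.
have dG := @relabel_dg W G A GA GB _ _ _ _ _ _ _ _ _ _ _ _ a b i0 wG sp' Aa Ab i0B c (pred1 l) s.
have dP := @relabel_p W G A GA GB _ _ _ _ _ _ _ _ _ _ _ _ a b i0 wG nt3 sp' cA cB aW bW Aa Ab ab i0B c (pred1 l) s s_ok.
have Au1 : A u1 by have [] := sp_X sp' (mem_head _ _).
have [||M [[Mi MA] Mh Mp Mq Mc]] := @side_solve W G A GA GB _ _ _ _ _ _ _ _ _ _ _ _ a b i0 wG nt3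
   sp' cA cB aW bW Aa Ab ab i0B n c (pred1 l) s IH rc sz s_ok K_ok k1 u1 a.
- by apply: has_edge_mem; rewrite !mem_cat !inE eqxx orbT; left.
- move=> j j0; rewrite dG // dP //; case: (boolP (crossing _ _ _ _ _ _ _ _ _ _ _ _ _ _)) => cj /=; last by right.
  by case: (eqVneq j l) => [jl|_]; [left; subst j; apply: ul|right].
have m0 : M i0 = false by move: Mp; rewrite Mi; case: (M i0); case: (M k2).
have m2 : M k2 = false by move: Mp; rewrite Mi; case: (M i0); case: (M k2).
exists M; split=> //.
  by move=> l0 cl; have [//|[]] := Mc l l0 cl (eqxx l); rewrite m0.
have := mat true (M k3) M Mi m2; rewrite m0 in Mq; case m3: (M k3).
  by move=> h; left; apply: h => //; move: Mq; rewrite m3; case: (M k4).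
by move=> h; right; apply: h => //; move: Mq; rewrite m3; case: (M k4).
Qed.

(** Prescribing the new edge leaves out all cut edges. Each pair has equal labels, so the new edge
    needs no label. A crossing class can be kept unless it carries all four cut edges, for then it
    would meet both ends of the prescribed edge. *)
Lemma step_missing : c e1.1.1 = c e2.1.1 -> c e3.1.1 = c e4.1.1 ->
  exists M, misses X M /\
    half A GA X (fun j => ~~ crosses X j || ~~ ((c e1.1.1 == c e3.1.1) && (j == c e1.1.1))) M.
Proof.
move=> c12 c34; have [a [b [i0 [[aW bW] [Aa Ab] ab i0B]]]] := aux.
pose K j := ~~ ((c e1.1.1 == c e3.1.1) && (j == c e1.1.1)).
have K_ok j : 0 < j -> crosses X j -> K j ->
  ((c e1.1.1 == j) + (c e2.1.1 == j) + (0 == j) = 0 \/ (c e1.1.1 == j) + (c e2.1.1 == j) + (0 == j) = 2) /\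
  ((c e3.1.1 == j) + (c e4.1.1 == j) + (0 == j) = 0 \/ (c e3.1.1 == j) + (c e4.1.1 == j) + (0 == j) = 2).
  move=> j0 _ _; rewrite -c12 -c34 (ltn_eqF j0).
  by case: (c e1.1.1 == j); case: (c e3.1.1 == j); split; auto.
move: mem4 matches4 misses4 K_ok; rewrite /K {K}; move: sp c12 c34; rewrite /sep /X.
case: e1 => [[k1 u1] w1]; case: e2 => [[k2 u2] w2]; case: e3 => [[k3 u3] w3]; case: e4 => [[k4 u4] w4] /=.
move=> sp' c12 c34 _ mat mis K_ok; pose K : pred nat := fun j => ~~ ((c k1 == c k3) && (j == c k1)).
have s_ok : 0 = 0 \/ crossing k1 u1 w1 k2 u2 w2 k3 u3 w3 k4 u4 w4 c 0 /\ K 0 by left.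
have dP := @relabel_p W G A GA GB _ _ _ _ _ _ _ _ _ _ _ _ a b i0 wG nt3 sp' cA cB aW bW Aa Ab ab i0B c K 0 s_ok.
have dQ := @relabel_q W G A GA GB _ _ _ _ _ _ _ _ _ _ _ _ a b i0 wG nt3 sp' cA cB aW bW Aa Ab ab i0B c K 0 s_ok.
have [||M [[Mi MA] Mh Mp Mq Mc]] := @side_solve W G A GA GB _ _ _ _ _ _ _ _ _ _ _ _ a b i0 wG nt3
   sp' cA cB aW bW Aa Ab ab i0B n c K 0 IH rc sz s_ok K_ok i0 a b.
- by apply: has_edge_mem; rewrite !mem_cat !inE eqxx !orbT; left.
- move=> j j0; rewrite dP // dQ // -c12 -c34 (ltn_eqF j0).
  case: (boolP (crossing _ _ _ _ _ _ _ _ _ _ _ _ _ _)) => cj /=; last by left.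
  rewrite /K ![c _ == j]eq_sym; case: (eqVneq j (c k1)) => [->|n1] /=; last by left; case: ifP.
  by case: (eqVneq (c k1) (c k3)) => [_|n3]; [left|right].
exists M; split; first by apply: mis; move: Mp Mq; rewrite Mi; clear; lia.
split=> // j j0 /orP[cj|Kj] pj; first exact: Mh.
case: (boolP (crossing k1 u1 w1 k2 u2 w2 k3 u3 w3 k4 u4 w4 c j)) => cj; last exact: Mh.
by have [//|[_ z]] := Mc j j0 cj Kj; rewrite -z in j0.
Qed.
End Side.
End Steps.

Lemma flipK : involutive flip. Proof. by case=> [[k u] w]. Qed.

Lemma cnt_flip M X : cnt M (map flip X) = cnt M X.
Proof. exact: esum_flip. Qed.

Lemma crosses_flip c X j : crosses c (map flip X) j = crosses c X j.
Proof. by rewrite /crosses cnt_flip. Qed.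

Lemma agree_misses X M1 M2 : misses X M1 -> misses (map flip X) M2 ->
  forall g, g \in X -> M1 g.1.1 = M2 g.1.1.
Proof.
move=> h1 h2 [[k u] w] gX; rewrite (negbTE (h1 _ gX)).
by have := h2 _ (map_f flip gX); case: (M2 k).
Qed.

Lemma agree_matches X e f M1 M2 : matches X e f M1 -> matches (map flip X) (flip e) (flip f) M2 ->
  forall g, g \in X -> M1 g.1.1 = M2 g.1.1.
Proof.
move=> h1 h2 [[k u] w] gX; rewrite (h1 _ gX).
by have := h2 _ (map_f flip gX); rewrite !(inj_eq (can_inj flipK)) => ->.
Qed.

Lemma perm_mem_cons (T : eqType) (x : T) s : x \in s -> exists s', perm_eq (x :: s') s.
Proof. by move=> xs; exists (rem x s); rewrite perm_sym; apply: perm_to_rem. Qed.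

Ltac permt := apply/permP => ?; rewrite /=; clear; lia.

(** * Solving across a 4-edge-cut *)

Section Cut4.
Variables (n : nat) (W : seq nat) (G : seq edge) (c : nat -> nat).
Hypotheses (IH : solvable_upto n) (wG : wf W G) (nt3 : NT3 W G) (rc : reg c G).
Hypothesis sz : 2 * size W + nlab c G <= n.+1.

Lemma combine A GA GB X i x y M1 M2 : splits A G GA GB X ->
  half W G c A GA X (fun j => ~~ crosses c X j) M1 ->
  half W G c (predC A) GB (map flip X) (fun j => ~~ crosses c X j) M2 ->
  (forall g, g \in X -> M1 g.1.1 = M2 g.1.1) ->
  (exists u v, (i, u, v) \in GA ++ X) -> M1 i ->
  (forall j, 0 < j -> crosses c X j -> hit c j M1 (GA ++ X) \/ hit c j M2 (GB ++ map flip X)) ->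
  solvable W G i x y c.
Proof.
move=> sp [p1 h1] [p2 h2] agr [u [v iA]] Mi hX.
have [|M [pM MA MB]] := glue sp (M1 := M1) (M2 := M2) wG p1 p2.
  by move=> k a b /agr.
exists M; split=> //; first by rewrite (MA _ _ _ iA).
have leA f : cnt f (GA ++ X) <= cnt f G.
  by rewrite (eqg_cnt _ (sp_eq sp)) !cnt_cat; clear; lia.
have leB f : cnt f (GB ++ X) <= cnt f G.
  by rewrite (eqg_cnt _ (sp_eq sp)) !cnt_cat; clear; lia.
have hB j : hit c j M2 (GB ++ map flip X) -> hit c j M2 (GB ++ X).
  by rewrite /hit !cnt_cat cnt_flip.
move=> j j0; rewrite (eqg_cnt _ (sp_eq sp)) !cnt_cat => cj.
have toA : hit c j M1 (GA ++ X) -> hit c j M G by apply: hit_sub MA leA.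
have toB : hit c j M2 (GB ++ map flip X) -> hit c j M G by move/hB; apply: hit_sub MB leB.
case: (boolP (crosses c X j)) => cX; first by case: (hX j j0 cX).
have {}cX0 : cnt (cl c j) X = 0 by apply/eqP; rewrite -leqn0 leqNgt.
case: (posnP (cnt (cl c j) GA)) => hA; last by apply/toA/h1 => //; rewrite cnt_cat cX0 addn0.
by apply/toB/h2 => //; rewrite cnt_cat cnt_flip cX0; move: cj; rewrite hA cX0 addn0.
Qed.

Lemma hit_matched c' k u w j M X GA : (k, u, w) \in X -> M k -> c' k = j -> hit c' j M (GA ++ X).
Proof.
move=> kX Mk cj; rewrite /hit cnt_cat; apply: leq_trans (leq_addl _ _).
by apply: mem_cnt kX _; rewrite Mk cj eqxx.
Qed.

Lemma off_other k u w l j : (k, u, w) \in G \/ (k, w, u) \in G -> c k = l -> 0 < l -> 0 < j -> l != j ->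
  2 <= size W -> dg (cl c j) u G = 0.
Proof.
move=> kG ck l0 j0 lj sW; have [H e] := has_edge_mem kG.
have [k1 [u1 [k2 [u2 [H' e']]]]] := pull3 wG sW e.
have E := eqg_trans e (eqg_cons _ e').
move: (rc u l0) (rc u j0); rewrite !(deg3 wG E) /cl ck eqxx (negbTE lj) /=.
by case: (eqVneq (c k1) l) => [->|_]; case: (eqVneq (c k2) l) => [->|_]; rewrite ?(negbTE lj) //=;
  case: (c k1 == j); case: (c k2 == j); clear; lia.
Qed.

Section Sides.
Variables (A : pred nat) (GA GB : seq edge) (cA : 3 <= count A W) (cB : 3 <= count (predC A) W).

Let cBC : 3 <= count (predC (predC A)) W.
Proof. by rewrite (eq_count (a2 := A)) // => v; rewrite /= negbK. Qed.

Let sW : 2 <= size W.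
Proof. by rewrite -(count_predC A W); move: cA; clear; lia. Qed.

Let half_flip X R M : half W G c (predC A) GB (map flip X) (fun j => ~~ crosses c (map flip X) j || R j) M ->
  half W G c (predC A) GB (map flip X) (fun j => ~~ crosses c X j) M.
Proof. by move=> [h1 h2]; split=> // j j0 cj; apply: h2; rewrite // crosses_flip cj. Qed.

Lemma half_perm A' GA' X Y R M : perm_eq X Y -> half W G c A' GA' X R M -> half W G c A' GA' Y R M.
Proof.
move=> p [h1 h2]; split=> // j j0 Rj; rewrite /hit !cnt_cat /cnt -!(esum_perm _ p) -!esum_cat.
exact: h2.
Qed.

Lemma crosses_perm X Y j : perm_eq X Y -> crosses c X j = crosses c Y j.
Proof. by move=> p; rewrite /crosses /cnt (esum_perm _ p). Qed.

Lemma half_eq A' GA' X R R' M : (forall j, R j = R' j) -> half W G c A' GA' X R M -> half W G c A' GA' X R' M.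
Proof. by move=> e [h1 h2]; split=> // j j0 Rj; apply: h2; rewrite // e. Qed.

Lemma matches_perm X Y e f M : perm_eq X Y -> matches X e f M -> matches Y e f M.
Proof. by move=> p h g; rewrite -(perm_mem p); apply: h. Qed.

Lemma misses_perm X Y M : perm_eq X Y -> misses X M -> misses Y M.
Proof. by move=> p h g; rewrite -(perm_mem p); apply: h. Qed.

Lemma hit_perm X Y GA' j M : perm_eq X Y -> hit c j M (GA' ++ X) = hit c j M (GA' ++ Y).
Proof. by move=> p; rewrite /hit !cnt_cat /cnt (esum_perm _ p). Qed.

(* As the edge [(i, x, y)] is unlabelled, only one label crosses the cut, and the side of [x] hits it. *)
Lemma cut4_across X i x y l : splits A G GA GB X -> (i, x, y) \in X -> size X = 4 ->
  (forall j, 0 < j -> crosses c X j -> j = l) -> (0 < l -> crosses c X l -> dg (cl c l) x G = 0) ->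
  solvable W G i x y c.
Proof.
move=> sp0 iX s4 uq xl; have [X' pX] := perm_mem_cons iX.
have := perm_size pX; rewrite s4 /=.
case: X' pX => [//|a [//|b [//|d [|//]]]] pX _.
have sp := splits_perm _ sp0; rewrite perm_sym in pX; move/(_ _ pX): sp => sp.
have {}uq j : 0 < j -> crosses c [:: (i, x, y); a; b; d] j -> j = l.
  by rewrite -(crosses_perm _ pX); apply: uq.
have {}xl : 0 < l -> crosses c [:: (i, x, y); a; b; d] l -> dg (cl c l) x G = 0.
  by rewrite -(crosses_perm _ pX); apply: xl.
move=> {sp0 iX s4 X pX}; set e := (i, x, y) in sp uq xl *.
pose X := [:: e; a; b; d].
have run g1 g2 g3 : perm_eq X [:: e; g1; g2; g3] ->
   exists M g, [/\ g \in [:: g2; g3], half W G c A GA X (fun j => ~~ crosses c X j) M,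
     (0 < l -> crosses c X l -> hit c l M (GA ++ X)) & matches X e g M].
  move=> p; have [|M [h1 h2 h3]] := step_crossing IH wG nt3 rc sz (splits_perm p sp) cA cB (l := l).
    by rewrite -(crosses_perm _ p).
  rewrite perm_sym in p.
  have h1' := half_perm p h1; have h1'' := half_eq (fun j => congr1 negb (crosses_perm j p)) h1'.
  rewrite (hit_perm _ _ _ p) (crosses_perm _ p) in h2.
  by case: h3 => /(matches_perm p) h3; [exists M, g2|exists M, g3]; rewrite !inE eqxx ?orbT.
have fin M1 g M2 : half W G c A GA X (fun j => ~~ crosses c X j) M1 ->
    (0 < l -> crosses c X l -> hit c l M1 (GA ++ X)) -> matches X e g M1 ->
    half W G c (predC A) GB (map flip X) (fun j => ~~ crosses c X j) M2 ->
    matches (map flip X) (flip e) (flip g) M2 -> solvable W G i x y c.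
  move=> h1 h2 h3 h4 h5.
  apply: (combine x y sp h1 h4 (agree_matches h3 h5)).
  - by exists x, y; rewrite mem_cat mem_head orbT.
  - by have := h3 e (mem_head _ _); rewrite eqxx.
  by move=> j j0 cj; rewrite -(uq j j0 cj) in h2; left; apply: h2.
(* The first side can end with [e] and [g1] or with [e] and [g2]. Pairing [e] with [f] on the other
   side forces its second cut edge to be [g1] or [g2], so one of the two choices fits. With [l := 0]
   no crossing class is kept there. *)
have two g1 g2 f M1 M2 : perm_eq X [:: e; f; g1; g2] ->
    half W G c A GA X (fun j => ~~ crosses c X j) M1 ->
    (0 < l -> crosses c X l -> hit c l M1 (GA ++ X)) -> matches X e g1 M1 ->
    half W G c A GA X (fun j => ~~ crosses c X j) M2 ->
    (0 < l -> crosses c X l -> hit c l M2 (GA ++ X)) -> matches X e g2 M2 -> solvable W G i x y c.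
  move=> p h1 h2 h3 h1' h2' h3'.
  have sp' := splits_sym (splits_perm p sp); rewrite perm_sym in p.
  have [//|M [q1 _ q3]] := step_crossing IH wG nt3 rc sz sp' cB cBC (l := 0).
  have q1' : half W G c (predC A) GB (map flip X) (fun j => ~~ crosses c X j) M.
    apply: half_perm (perm_map flip p) _; apply: half_eq q1 => j.
    by rewrite -(crosses_perm _ p) -(crosses_flip _ [:: e; f; g1; g2]).
  have mp := matches_perm (perm_map flip p).
  by case: q3 => /mp q3; [apply: (fin M1 g1 M)|apply: (fin M2 g2 M)].
(* The first run produces a partner of [e]; pairing [e] with that partner in the second run forces a
   different one. *)
have [M1 [g1 [g1m h1 h2 h3]]] := run a b d (perm_refl _).
have rest u v w : perm_eq X [:: e; u; v; w] -> matches X e u M1 -> solvable W G i x y c.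
  move=> p h3'; have [M2 [g [+ q1 q2 q3]]] := run u v w p.
  rewrite !inE => /orP[] /eqP gE; subst g.
    apply: (two u v w M1 M2) => //; apply: perm_trans p _; permt.
  apply: (two u w v M1 M2) => //; apply: perm_trans p _; permt.
move: g1m h3; rewrite !inE => /orP[] /eqP -> h3.
  apply: (rest b a d) h3; permt.
apply: (rest d a b) h3; permt.
Qed.

(* Two pairings of the cut edges at [p] and [q] make the first side offer [{v, s}] or [{v, s2}] as the
   matched cut edges, or none; the other side, with [v] prescribed and paired with the fourth cut
   edge, realizes one of these two.  The first side hits the label of [e1], [e2], the other one that
   of [e3], [e4]. *)
Lemma cut4_inside e1 e2 e3 e4 i x y :
  let X := [:: e1; e2; e3; e4] in
  splits A G GA GB X -> A x -> A y -> (i, x, y) \in GA \/ (i, y, x) \in GA -> unspanned c x y G ->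
  c e1.1.1 = c e2.1.1 -> c e3.1.1 = c e4.1.1 -> (c e1.1.1 = 0 -> c e3.1.1 = 0) ->
  solvable W G i x y c.
Proof.
move=> X sp Ax Ay iA uc c12 c34 c13.
set lam := c e1.1.1 in c12 c13; set mu := c e3.1.1 in c34 c13.
have iAX : exists u v, (i, u, v) \in GA ++ X.
  by case: iA => h; [exists x, y|exists y, x]; rewrite mem_cat h.
have cr j : 0 < j -> crosses c X j -> j = lam \/ j = mu.
  move=> j0; rewrite /crosses => /cnt_mem[k [u [w [kX /eqP <-]]]].
  move: kX; rewrite !inE => /or4P[] /eqP E; [left|left|right|right];
  have := congr1 (fun g => c g.1.1) E; rewrite /= => ->; first [done|by rewrite c12|by rewrite c34].
have clam : crosses c X lam.
  by rewrite /crosses; case E: e1 => [[k u] w]; apply: (@mem_cnt _ _ k u w); rewrite /X ?E ?mem_head //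
    /cl /lam E eqxx.
(* A first half that avoids the cut is completed by prescribing the new edge on the other side. This
   hits every crossing class except one carrying all four cut edges, which the first half must
   hit. *)
have miss M1 : half W G c A GA X (fun j => ~~ crosses c X j) M1 -> M1 i -> misses X M1 ->
   (lam = mu -> 0 < lam -> hit c lam M1 (GA ++ X)) -> solvable W G i x y c.
  move=> h1 Mi m1 hl.
  have [//|//|M2 [m2 h2]] := step_missing IH wG nt3 rc sz (splits_sym sp) cB cBC.
  pose R j := ~~ ((lam == mu) && (j == lam)).
  have h2' : half W G c (predC A) GB (map flip X) (fun j => ~~ crosses c X j) M2.
    by apply: (@half_flip X R).
  have m2' : misses (map flip X) M2 := m2.
  apply: (combine x y sp h1 h2' (agree_misses m1 m2')) => // j j0 cj.
  case: (boolP ((lam == mu) && (j == lam))) => [/andP[/eqP lm /eqP jl]|n1].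
    by left; subst j; apply: hl.
  right; apply: (proj2 h2) => //; first by apply/orP; right.
  by rewrite cnt_cat (cnt_flip _ X); apply: leq_trans cj (leq_addl _ _).
have [M1 [Mi h1 out]] := step_internal IH wG nt3 rc sz sp cA cB lam Ax Ay iA uc.
case: out => [[m1 hl]|[hl [e [f [em fm m1]]]]].
  by apply: (miss M1) => // _ l0; apply: hl => //; rewrite /sep -/lam c12 !eqxx.
have [e' [f' p]] : exists e' f', perm_eq X [:: e; f; e'; f'].
  move: em fm; rewrite !inE => /orP[] /eqP -> /orP[] /eqP ->.
  - by exists e2, e4; permt.
  - by exists e2, e3; permt.
  - by exists e1, e4; permt.
  - by exists e1, e3; permt.
have [M2 [Mi2 h2 out2]] := step_internal IH wG nt3 rc sz (splits_perm p sp) cA cB lam Ax Ay iA uc.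
have pS : perm_eq [:: e; f; e'; f'] X by rewrite perm_sym.
have cXp := crosses_perm lam pS.
have {}h2 : half W G c A GA X (fun j => ~~ crosses c X j) M2.
  by apply: half_eq (half_perm pS h2) => j; rewrite (crosses_perm _ pS).
have ce : c e.1.1 = lam by move: em; rewrite !inE => /orP[] /eqP ->; rewrite -?c12.
have cf : c f.1.1 = mu by move: fm; rewrite !inE => /orP[] /eqP ->; rewrite -?c34.
case: out2 => [[m2 hl2]|[hl2 [v [s2 [vm s2m m2]]]]].
  apply: (miss M2) => //; first exact: misses_perm pS m2.
  move=> lm l0; rewrite -(hit_perm _ _ _ pS); apply: hl2; rewrite ?cXp //.
  by rewrite /sep ce cf lm eqxx.
rewrite (hit_perm _ _ _ pS) cXp in hl2.
have {}m2 := matches_perm pS m2.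
have fin v' s' M M' : half W G c A GA X (fun j => ~~ crosses c X j) M -> M i ->
   (0 < lam -> hit c lam M (GA ++ X)) -> matches X v' s' M -> v' \in X ->
   half W G c (predC A) GB (map flip X) (fun j => ~~ crosses c X j) M' ->
   (c v'.1.1 = mu \/ (0 < mu -> crosses c X mu -> hit c mu M' (GB ++ map flip X))) ->
   matches (map flip X) (flip v') (flip s') M' -> solvable W G i x y c.
  move=> q1 q2 q3 q4 v'X q5 q6 q7; apply: (combine x y sp q1 q5 (agree_matches q4 q7)) => //.
  move=> j j0 cj; case: (cr j j0 cj) => jE; subst j; first by left; apply: q3.
  case: q6 => [cv|h]; last by right; apply: h.
  left; case E: v' v'X cv => [[k u] w] v'X cv; apply: (hit_matched GA v'X) => //.
  by have := q4 _ v'X; rewrite E eqxx.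
have [s [f4 [q m1']]] : exists s f4, perm_eq X [:: v; f4; s; s2] /\ matches X v s M1.
  have mC a b : matches X a b M1 -> matches X b a M1.
    by move=> h g gX; rewrite orbC; apply: h.
  have main a b : perm_eq [:: e; f; e'; f'] [:: a; b; e'; f'] ->
     exists f4, perm_eq X [:: a; f4; b; s2].
    move=> pab; move: s2m; rewrite !inE => /orP[] /eqP ->.
      exists f'; apply: perm_trans p (perm_trans pab _); permt.
    by exists e'; apply: perm_trans p (perm_trans pab _); permt.
  move: vm; rewrite !inE => /orP[] /eqP ->.
    by have [f4 h] := main e f (perm_refl _); exists f, f4; split.
  have [|f4 h] := main f e; first by permt.
  by exists e, f4; split=> //; apply: mC.
have vX : v \in X by rewrite (perm_mem q) mem_head.
(* If [v] carries [mu], its presence in the matching hits [mu], and the value 0 asks nothing more of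
   the other side. Otherwise [v] carries [lam], so its end is off [mu] and [mu] can be kept. *)
pose lB := if c v.1.1 == mu then 0 else mu.
have qS : perm_eq [:: v; f4; s; s2] X by rewrite perm_sym.
have [|M' [r1 r2 r3]] := step_crossing IH wG nt3 rc sz (splits_sym (splits_perm q sp)) cB cBC (l := lB).
  rewrite /lB; case: eqP => // cv mu0 _; case E: v vX cv => [[k u] w] /= vX cv.
  have cv' : c k = lam.
    have := perm_mem p v; rewrite E vX !inE => /esym.
    move: vm; rewrite E !inE => /orP[] /eqP E'; first by rewrite -ce -E'.
    by case: cv; rewrite -cf -E'.
  have kG : (k, w, u) \in G \/ (k, u, w) \in G.
    have kX : (k, u, w) \in GA ++ GB ++ X by rewrite !mem_cat vX !orbT.
    have [H e0] := mem_eqg kX.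
    by case: (eqg_mem (eqg_trans (sp_eq sp) e0)); [right|left].
  apply: (off_other kG cv' _ mu0) => //.
    by rewrite lt0n; apply/eqP => l0; rewrite (c13 l0) in mu0.
  by apply/eqP => lm; apply: cv; rewrite cv' lm.
have r1' : half W G c (predC A) GB (map flip X) (fun j => ~~ crosses c X j) M'.
  apply: half_perm (perm_map flip qS) _; apply: half_eq r1 => j.
  by rewrite -(crosses_perm _ qS) -(crosses_flip _ [:: v; f4; s; s2]).
have r2' : c v.1.1 = mu \/ (0 < mu -> crosses c X mu -> hit c mu M' (GB ++ map flip X)).
  move: r2; rewrite /lB; case: eqP => [|_ r2]; first by left.
  right=> mu0 cm; rewrite -(hit_perm _ _ _ (perm_map flip qS)); apply: r2 => //.
  by rewrite -[[:: _; _; _; _]]/(map flip [:: v; f4; s; s2]) crosses_flip (crosses_perm _ qS).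
have mp := matches_perm (perm_map flip qS).
case: r3 => /mp r3.
  by apply: (fin v s M1 M') => // l0; apply: hl.
by apply: (fin v s2 M2 M') => // l0; apply: hl2.
Qed.
End Sides.
End Cut4.

(** Every class contains an even number of the four edges, so equal labels can be paired off; a
    labelled pair, if any, is put first. *)
Lemma pair_labels X c : size X = 4 -> (forall j, 0 < j -> exists m, cnt (cl c j) X = 2 * m) ->
  exists e1 e2 e3 e4, [/\ perm_eq X [:: e1; e2; e3; e4], c e1.1.1 = c e2.1.1,
    c e3.1.1 = c e4.1.1 & c e1.1.1 = 0 -> c e3.1.1 = 0].
Proof.
move=> s4 ev; case: (boolP (has (fun e : edge => 0 < c e.1.1) X)) => h; last first.
  have z e : e \in X -> c e.1.1 = 0.
    by move=> eX; apply/eqP; rewrite -leqn0 leqNgt; apply: contra h => h; apply/hasP; exists e.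
  case: X s4 z {ev h} => [|e1 [|e2 [|e3 [|e4 [|//]]]]] // _ z.
  by exists e1, e2, e3, e4; split=> //; rewrite ?z // !inE eqxx ?orbT.
have /hasP[e1 e1X c1] := h; have [X1 p1] := perm_mem_cons e1X.
have cX P Y : cnt P Y = count (fun e : edge => P e.1.1) Y.
  by elim: Y => // -[[k u] w] Y IHY; rewrite cntE IHY.
have evX j : 0 < j -> exists m, count (fun e : edge => c e.1.1 == j) X = 2 * m.
  by move=> j0; have [m hm] := ev j j0; exists m; rewrite -hm cX.
have [e2 e2X1 c2] : exists2 e2, e2 \in X1 & c e2.1.1 == c e1.1.1.
  apply/hasP; rewrite has_count; have [m] := evX _ c1; rewrite -(permP p1) /= eqxx.
  by case: (count _ X1) => // h0; exfalso; move: h0; clear; lia.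
have [X2 p2] := perm_mem_cons e2X1.
have p3 : perm_eq X [:: e1, e2 & X2].
  by rewrite perm_sym; apply: perm_trans p1; rewrite perm_cons.
have := perm_size p3; rewrite s4; case: X2 p2 p3 => [//|e3 [//|e4 [|//]]] _ p _.
exists e1, e2, e3, e4; split=> //; [by rewrite (eqP c2)| |by move=> z; rewrite z in c1].
have cc j : 0 < j -> (c e3.1.1 == j) = (c e4.1.1 == j).
  move=> j0; have [m] := evX j j0; rewrite (permP p) /= (eqP c2).
  by case: (c e1.1.1 == j); case: (c e3.1.1 == j); case: (c e4.1.1 == j) => //=; clear; lia.
case: (posnP (c e3.1.1)) => [z|p3]; last by have := cc _ p3; rewrite eqxx => /esym/eqP.
by case: (posnP (c e4.1.1)) => [->|p4] //; have := cc _ p4; rewrite eqxx => /eqP.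
Qed.

(** * The induction for cubic graphs *)

Section Cubic.
Variables (n : nat) (W : seq nat) (G : seq edge) (c : nat -> nat).
Hypotheses (IH : solvable_upto n) (wG : wf W G) (nt3 : NT3 W G) (rc : reg c G).
Hypothesis sz : 2 * size W + nlab c G <= n.+1.

Lemma solve_cut4 A i x y : has_edge G i x y -> unspanned c x y G ->
  cut xpredT A G <= 4 -> 3 <= count A W -> 3 <= count (predC A) W -> solvable W G i x y c.
Proof.
move=> e uc cA4 cA cB.
have swap_uc x' y' : unspanned c x' y' G -> unspanned c y' x' G.
  by move=> h j j0; have [] := h j j0; [right|left].
have swap_e x' y' : has_edge G i x' y' -> has_edge G i y' x'.
  by case=> H h; exists H; apply: eqg_trans h (eqg_flip _ _ _ _).
have cutX A' GA GB X : cut xpredT A' G <= 4 -> 3 <= count A' W -> 3 <= count (predC A') W ->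
    splits A' G GA GB X -> size X = 4.
  move=> {}cA4 {}cA {}cB sp; have sX : cut xpredT A' G = size X.
    by rewrite (cut_split sp); elim: (X) => // -[[k u] w] X' IHX; rewrite cntE IHX.
  rewrite -sX; apply/eqP; rewrite eqn_leq cA4 ltnNge; apply/negP => /nt3[].
    by rewrite leqNgt cA.
  by rewrite leqNgt cB.
have inside A' x' y' : cut xpredT A' G <= 4 -> 3 <= count A' W -> 3 <= count (predC A') W ->
   has_edge G i x' y' -> unspanned c x' y' G -> A' x' -> A' y' -> solvable W G i x' y' c.
  move=> {}cA4 {}cA {}cB [H {}e] {}uc Ax Ay.
  have [GA [GB [X sp]]] := split_exists A' G.
  have s4 := cutX _ _ _ _ cA4 cA cB sp.
  have [e1 [e2 [e3 [e4 [p c12 c34 c13]]]]] := pair_labels s4 (fun j => cross_even sp wG rc (j := j)).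
  have sp' := splits_perm p sp; have := edge_side sp' e Ax; rewrite Ay => iA.
  exact: (cut4_inside IH wG nt3 rc sz cA cB sp').
have main A' x' y' l : cut xpredT A' G <= 4 -> 3 <= count A' W -> 3 <= count (predC A') W ->
   has_edge G i x' y' -> A' x' -> ~~ A' y' ->
   (forall j, 0 < j -> 0 < cut (cl c j) A' G -> j = l) ->
   (0 < l -> dg (cl c l) x' G = 0) -> solvable W G i x' y' c.
  move=> {}cA4 {}cA {}cB [H {}e] Ax /negbTE Ay uq xl.
  have [GA [GB [X sp]]] := split_exists A' G; have s4 := cutX _ _ _ _ cA4 cA cB sp.
  have := edge_side sp e Ax; rewrite Ay => iX.
  apply: (cut4_across IH wG nt3 rc sz cA cB sp iX s4 (l := l)) => [j j0|l0 _]; last exact: xl.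
  by rewrite /crosses -(cut_split sp); apply: uq.
have uniq_cross A' j l x' y' : cut xpredT A' G <= 4 -> has_edge G i x' y' -> A' x' -> ~~ A' y' ->
   unspanned c x' y' G -> 0 < j -> 0 < l ->
   0 < cut (cl c j) A' G -> 0 < cut (cl c l) A' G -> j = l.
  move=> {}cA4 [H {}e] Ax /negbTE Ay {}uc j0 l0.
  have [GA [GB [X sp]]] := split_exists A' G.
  have := edge_side sp e Ax; rewrite Ay => iX; have ci := unspanned0 e uc.
  rewrite !(cut_split sp).
  have [m hm] := cross_even sp wG rc j0; have [m' hm'] := cross_even sp wG rc l0.
  rewrite hm hm' => m0 m0'; apply/eqP/negPn/negP => jl.
  have : 0 < cnt (cl c 0) X by apply: mem_cnt iX _; rewrite /cl ci.
  suff : cnt (cl c j) X + cnt (cl c l) X + cnt (cl c 0) X <= cnt xpredT X.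
    by rewrite -(cut_split sp xpredT); move: cA4 hm hm' m0 m0'; clear; lia.
  rewrite -!esumD; apply: leq_esum => k u w; rewrite /cl.
  case: (eqVneq (c k) j) => [->|_]; first by rewrite (negbTE jl) (gtn_eqF j0).
  by case: (eqVneq (c k) l) => [->|_]; [rewrite (gtn_eqF l0)|case: (c k == 0)].
have cA4C : cut xpredT (predC A) G <= 4 by rewrite cutC.
have cBC : 3 <= count (predC (predC A)) W.
  by rewrite (eq_count (a2 := A)) // => v; rewrite /= negbK.
have across x' y' : has_edge G i x' y' -> unspanned c x' y' G ->
   A x' -> ~~ A y' -> solvable W G i x' y' c.
  move=> {}e {}uc Ax Ay.
  case: (classic (exists2 l, 0 < l & 0 < cut (cl c l) A G)) => [[l l0 cutl]|none]; last first.
    apply: (main A x' y' 0) => // j j0 cj; by case: none; exists j.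
  have uq j : 0 < j -> 0 < cut (cl c j) A G -> j = l.
    by move=> j0 cj; apply: (uniq_cross A j l x' y').
  case: (uc l l0) => d0; first by apply: (main A x' y' l).
  suff: solvable W G i y' x' c by [].
  apply: (main (predC A) y' x' l) => //=; rewrite ?Ay ?Ax //; first exact: swap_e.
  by move=> j j0; rewrite cutC; apply: uq.
case Ax: (A x); case Ay: (A y).
- exact: (inside A).
- by apply: across; rewrite ?Ax ?Ay.
- suff: solvable W G i y x c by [].
  by apply: across; rewrite ?Ax ?Ay; [apply: swap_e|apply: swap_uc| |].
- by apply: (inside (predC A)); rewrite //= ?Ax ?Ay.
Qed.
End Cubic.

(** Cuts of size 3 are treated before those of size 4 because closing up a side of a 4-edge-cut
    relies on [NT3]. Cuts range over all predicates on [nat], so their existence is decided by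
    excluded middle. The number of vertices is even, which leaves 2, 4 and 6 below 8. *)
Theorem cubic_solvable n : solvable_upto n.
Proof.
elim: n => [|n IH] W G i x y c sz wG e rc uc; have [H eH] := e.
  by have [xW _] := wf_mem wG eH; move: sz xW; case: (W).
case: (classic (exists A, [/\ cut xpredT A G <= 3, 3 <= count A W & 3 <= count (predC A) W])).
  by move=> [A [h1 h2 h3]]; apply: (solve_cut3 IH wG rc sz e uc h1).
move=> no3; have nt3 : NT3 W G.
  move=> A c3; case: (leqP (count A W) 2) => h1; first by left.
  case: (leqP (count (predC A) W) 2) => h2; first by right.
  by case: no3; exists A.
case: (classic (exists A, [/\ cut xpredT A G <= 4, 3 <= count A W & 3 <= count (predC A) W])).
  by move=> [A [h1 h2 h3]]; apply: (solve_cut4 IH wG nt3 rc sz e uc h1).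
move=> no4; have nt : NT W G.
  move=> A c4; case: (leqP (count A W) 2) => h1; first by left.
  case: (leqP (count (predC A) W) 2) => h2; first by right.
  by case: no4; exists A.
case: (leqP 8 (size W)) => s8; first exact: (core IH wG nt s8 sz rc eH uc).
have [m hm] := wf_size_even wG; have [xW _] := wf_mem wG eH.
have := xW; rewrite -index_mem hm; move: s8; rewrite hm.
case: m hm => [|[|[|[|m]]]] hm; rewrite ?ltnn //.
- by move=> _ _; apply: (base2 wG eH uc hm).
- by move=> _ _; apply: (base4 wG rc eH uc hm).
- by move=> _ _; apply: (base6 wG rc eH uc nt hm).
by move=> h; exfalso; move: h; clear; lia.
Qed.

End CubicGraphs.

(** * Replacing vertices of degree [3t] by gadgets *)

Lemma sum_eq1 n (P : pred nat) m : (forall i, i < n -> P i = (i == m)) ->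
  \sum_(i <- iota 0 n) P i = (m < n).
Proof.
move=> h; rewrite (eq_big_seq (fun i => (i == m) : nat)) => [|i]; last first.
  by rewrite mem_iota add0n => /h ->.
elim: n {h} => [|n IH]; first by rewrite big_nil.
by rewrite -addn1 iotaD big_cat big_seq1 IH add0n /=; clear; lia.
Qed.

Lemma sum_eq0 n (P : pred nat) : (forall i, i < n -> P i = false) -> \sum_(i <- iota 0 n) P i = 0.
Proof. by move=> h; rewrite big1_seq // => i /= ; rewrite mem_iota add0n => /h ->. Qed.

Section Gadget.
Variables (V E : finType) (src tgt : E -> V) (D : {set E}) (t : V -> nat) (c : E -> nat).
Notation inc := (incident src tgt).

(* A vertex with [t v = 1] is the single node [Cn v].  Otherwise its gadget is a cubic graph on the
   [2 * t v] nodes [Yn v i] whose [3 * t v] edges are subdivided by the nodes [Sn v i]; for the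
   [k]-th label at [v], the nodes [Sn v (2 * k)] and [Sn v (2 * k).+1] are adjacent to [Wn v k], which is
   adjacent to [Pn v k].  The edges with that label attach to [Pn v k], the unlabelled ones to the
   remaining [Sn v i]. *)
Definition node := (V * (nat * nat))%type.
Definition Cn (v : V) : node := (v, (0, 0)).
Definition Sn (v : V) (i : nat) : node := (v, (1, i)).
Definition Yn (v : V) (i : nat) : node := (v, (2, i)).
Definition Pn (v : V) (i : nat) : node := (v, (3, i)).
Definition Wn (v : V) (i : nat) : node := (v, (4, i)).

Definition labs v : seq nat := undup [seq c e | e <- enum D & inc e v && (0 < c e)].
Definition frees v : seq E := [seq e <- enum D | inc e v && (c e == 0)].
Definition att e v : node := if t v == 1 then Cn v else
  if c e == 0 then Sn v (2 * size (labs v) + index e (frees v)) else Pn v (index (c e) (labs v)).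

(** The cubic graph being subdivided is the cycle through [Yn v 0], [Yn v 1], and so on, with every
    second edge doubled: [Sn v i] for [i < 2 * t v] subdivide the cycle, the remaining [t v] of them
    the doubled edges. *)
Definition gad v : seq (node * node) := if t v == 1 then [::] else
  let I := iota 0 (2 * t v) in let J := iota 0 (t v) in let K := iota 0 (size (labs v)) in
  [seq (Sn v i, Yn v i) | i <- I] ++ [seq (Sn v i, Yn v (i.+1 %% (2 * t v))) | i <- I] ++
  [seq (Sn v (2 * t v + i), Yn v (2 * i)) | i <- J] ++
  [seq (Sn v (2 * t v + i), Yn v (2 * i).+1) | i <- J] ++
  [seq (Pn v k, Wn v k) | k <- K] ++
  [seq (Sn v (2 * k), Wn v k) | k <- K] ++ [seq (Sn v (2 * k).+1, Wn v k) | k <- K].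

Definition plus v : seq node := if t v == 1 then [:: Cn v] else
  [seq Sn v i | i <- iota 0 (3 * t v)] ++ [seq Pn v k | k <- iota 0 (size (labs v))].
Definition minus v : seq node := if t v == 1 then [::] else
  [seq Yn v i | i <- iota 0 (2 * t v)] ++ [seq Wn v k | k <- iota 0 (size (labs v))].

Hypothesis loop : loopless src tgt.
Hypothesis t1 : forall v, 0 < t v.
Hypothesis degD : forall v, \sum_(e in D) inc e v = 3 * t v.
Hypothesis labD : forall j v, 0 < j -> let d := \sum_(e in D) (inc e v && (c e == j)) in d = 0 \/ d = 2.

Lemma uniq_labs v : uniq (labs v). Proof. exact: undup_uniq. Qed.
Lemma uniq_frees v : uniq (frees v). Proof. by rewrite filter_uniq ?enum_uniq. Qed.

Lemma mem_labs v j : j \in labs v -> 0 < j /\ exists e, [/\ e \in D, inc e v & c e = j].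
Proof.
rewrite mem_undup => /mapP[e]; rewrite mem_filter mem_enum => /andP[/andP[ev ce] eD] ->.
by split=> //; exists e.
Qed.

Lemma in_labs v e : e \in D -> inc e v -> 0 < c e -> c e \in labs v.
Proof. by move=> eD ev ce; rewrite mem_undup map_f // mem_filter ev ce mem_enum. Qed.

Lemma in_frees v e : (e \in frees v) = [&& e \in D, inc e v & c e == 0].
Proof. by rewrite mem_filter mem_enum andbC. Qed.

Lemma labs_sum v j : j \in labs v -> \sum_(e in D) (inc e v && (c e == j)) = 2.
Proof.
move=> /mem_labs[j0 [e [eD ev ce]]]; have [] := labD v j0 => // /eqP.
by rewrite sum_nat_eq0 => /forallP/(_ e); rewrite eD ev ce eqxx.
Qed.

Lemma frees_labs v : size (frees v) + 2 * size (labs v) = 3 * t v.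
Proof.
have -> : 2 * size (labs v) = \sum_(e in D) (inc e v && (0 < c e)).
  have -> : 2 * size (labs v) = \sum_(j <- labs v) \sum_(e in D) (inc e v && (c e == j)).
    rewrite -[in LHS](count_predT (labs v)) -iter_addn_0 -big_const_seq; apply: eq_big_seq => j jL.
    by rewrite labs_sum.
  rewrite exchange_big /=; apply: eq_bigr => e eD; case: (boolP (inc e v)) => ev /=; last first.
    by rewrite big1.
  case: (posnP (c e)) => [-> |c0].
    by rewrite big1_seq // => j /= /mem_labs[j0 _]; rewrite eq_sym (gtn_eqF j0).
  rewrite (bigD1_seq (c e)) ?uniq_labs ?in_labs //= eqxx big1 ?addn0 // => j.
  by rewrite eq_sym => /negbTE ->.
have -> : size (frees v) = \sum_(e in D) (inc e v && (c e == 0)).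
  by rewrite size_filter -sum1_count big_mkcond /= -big_enum.
rewrite -big_split -degD; apply: eq_bigr => e _ /=.
by case: (inc e v); case: (c e).
Qed.

Definition star v z := \sum_(e in D) (inc e v && (att e v == z)).

Lemma star_S v i : t v != 1 -> i < 3 * t v -> star v (Sn v i) = (2 * size (labs v) <= i).
Proof.
move=> /negbTE tv iv; rewrite /star /att tv.
rewrite (eq_bigr (fun e => (e \in frees v) && (e == nth e (frees v) (i - 2 * size (labs v))) &&
   (2 * size (labs v) <= i) : nat)); last first.
  move=> e eD; rewrite in_frees eD /=; case: (boolP (inc e v)) => ev //=.
  case: (posnP (c e)) => [ce|c0] /=; last by rewrite !xpair_eqE /= andbF.
  have ef : e \in frees v by rewrite in_frees eD ev ce eqxx.
  rewrite /Sn !xpair_eqE !eqxx /=; case: leqP => h; rewrite ?andbF ?andbT; last first.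
    by apply/eqP; move: h; clear; lia.
  have -> : (2 * size (labs v) + index e (frees v) == i) = (index e (frees v) == i - 2 * size (labs v)).
    by move: h; clear; lia.
  congr (nat_of_bool _); apply/eqP/eqP => [<-|{1}->]; first by rewrite nth_index.
  rewrite index_uniq ?uniq_frees //; move: iv h; rewrite -(frees_labs v); clear => h1 h2; rewrite ltn_subLR // addnC //.
case: (leqP (2 * size (labs v)) i) => h; last by rewrite big1 // => e _; rewrite andbF.
have iF : i - 2 * size (labs v) < size (frees v) by rewrite ltn_subLR // addnC frees_labs.
case Ef: (frees v) iF => [//|e0 s] iF; rewrite -Ef in iF *.
have e1F := mem_nth e0 iF; set e1 := nth e0 _ _ in e1F.
have := e1F; rewrite in_frees => /and3P[e1D _ _].
have nE e : nth e (frees v) (i - 2 * size (labs v)) = e1 by apply: set_nth_default.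
rewrite (bigD1 e1) //= e1F nE eqxx big1 // => e /andP[_ ne].
by rewrite nE (negbTE ne) andbF.
Qed.

Lemma star_P v k : t v != 1 -> k < size (labs v) -> star v (Pn v k) = 2.
Proof.
move=> /negbTE tv kv; rewrite -(labs_sum (mem_nth 0 kv)) /star /att tv; apply: eq_bigr => e eD.
case: (boolP (inc e v)) => ev //=; case: (posnP (c e)) => [ce|c0].
  rewrite ce !xpair_eqE /= andbF.
  by have [j0 _] := mem_labs (mem_nth 0 kv); rewrite (ltn_eqF j0).
rewrite /Pn !xpair_eqE !eqxx /=; congr nat_of_bool.
have cL := in_labs eD ev c0; apply/eqP/eqP => [<-|->]; first by rewrite nth_index.
by rewrite index_uniq ?uniq_labs.
Qed.

Lemma star_C v : t v = 1 -> star v (Cn v) = 3.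
Proof.
move=> tv; transitivity (3 * t v); last by rewrite tv.
rewrite -degD; apply: eq_bigr => e _.
by rewrite /att tv eqxx eqxx andbT.
Qed.

Lemma att_plus e v : e \in D -> inc e v -> att e v \in plus v.
Proof.
move=> eD ev; rewrite /att /plus; case: ifP => _; first by rewrite inE.
rewrite mem_cat; case: (posnP (c e)) => [ce|c0].
  rewrite map_f // mem_iota add0n.
  have : index e (frees v) < size (frees v) by rewrite index_mem in_frees eD ev ce eqxx.
  by rewrite -(frees_labs v); clear; lia.
by rewrite map_f ?orbT // mem_iota add0n index_mem in_labs.
Qed.

Definition pd z (L : seq (node * node)) := \sum_(q <- L) ((q.1 == z) + (q.2 == z)).

Lemma pd_cat z L1 L2 : pd z (L1 ++ L2) = pd z L1 + pd z L2.
Proof. exact: big_cat. Qed.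

Lemma pd_map z n (f g : nat -> node) : pd z [seq (f i, g i) | i <- iota 0 n] =
  \sum_(i <- iota 0 n) (f i == z) + \sum_(i <- iota 0 n) (g i == z).
Proof. by rewrite /pd big_map big_split. Qed.

Lemma sum_node v (f : nat -> nat) n a b m :
  \sum_(i <- iota 0 n) ((v, (a, f i)) == (v, (b, m)) :> node) =
  if a == b then \sum_(i <- iota 0 n) (f i == m) else 0.
Proof.
case: eqP => [->|/eqP ab]; first by apply: eq_bigr => i _; rewrite !xpair_eqE !eqxx.
by apply: sum_eq0 => i _; rewrite !xpair_eqE (negbTE ab) andbF.
Qed.

Lemma sum_id n m : \sum_(i <- iota 0 n) (i == m) = (m < n). Proof. exact: sum_eq1. Qed.

Lemma sum_shift d n m : \sum_(i <- iota 0 n) (d + i == m) = (d <= m < d + n).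
Proof.
case: (leqP d m) => h /=; first by rewrite (@sum_eq1 _ _ (m - d)) => [|i _]; move: h; clear; lia.
by apply: sum_eq0 => i _; move: h; clear; lia.
Qed.

Lemma sum_even n m : \sum_(i <- iota 0 n) (2 * i == m) = (~~ odd m && (m < 2 * n)).
Proof.
case: (boolP (odd m)) => h /=; first by apply: sum_eq0 => i _; move: h; clear; lia.
by rewrite (@sum_eq1 _ _ m./2) => [|i _]; move: h; clear; lia.
Qed.

Lemma sum_odd n m : \sum_(i <- iota 0 n) ((2 * i).+1 == m) = (odd m && (m < 2 * n)).
Proof.
case: (boolP (odd m)) => h /=; last by apply: sum_eq0 => i _; move: h; clear; lia.
by rewrite (@sum_eq1 _ _ m./2) => [|i _]; move: h; clear; lia.
Qed.

Lemma sum_rot n m : \sum_(i <- iota 0 n) (i.+1 %% n == m) = (m < n).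
Proof.
case: (leqP n m) => h.
  apply: sum_eq0 => i lin; apply/negbTE; rewrite neq_ltn; apply/orP; left.
  by apply: leq_trans h; rewrite ltn_mod; move: lin; clear; lia.
have small i : i < n -> i.+1 %% n = if i.+1 == n then 0 else i.+1.
  move=> lin; case: eqP => [->|/eqP ne]; first by rewrite modnn.
  by rewrite modn_small // ltn_neqAle ne.
case: m h => [|m] h.
  rewrite (@sum_eq1 _ _ n.-1) => [|i lin]; first by move: h; clear; lia.
  by rewrite small //; case: (eqVneq i.+1 n); move: h; clear; lia.
rewrite (@sum_eq1 _ _ m) => [|i lin]; first by move: h; clear; lia.
by rewrite small //; case: (eqVneq i.+1 n); move: h; clear; lia.
Qed.

Lemma gad_S v i : t v != 1 -> i < 3 * t v -> pd (Sn v i) (gad v) = 2 + (i < 2 * size (labs v)).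
Proof.
move=> /negbTE tv iv; rewrite /gad tv !pd_cat !pd_map /Sn /Yn /Pn /Wn !sum_node /=.
by rewrite !sum_id !sum_shift sum_even sum_odd; move: iv; clear; lia.
Qed.

Lemma gad_Y v i : t v != 1 -> i < 2 * t v -> pd (Yn v i) (gad v) = 3.
Proof.
move=> /negbTE tv iv; rewrite /gad tv !pd_cat !pd_map /Sn /Yn /Pn /Wn !sum_node /=.
by rewrite !sum_id sum_rot sum_even sum_odd; move: iv; clear; lia.
Qed.

Lemma gad_P v i : t v != 1 -> i < size (labs v) -> pd (Pn v i) (gad v) = 1.
Proof.
move=> /negbTE tv iv; rewrite /gad tv !pd_cat !pd_map /Sn /Yn /Pn /Wn !sum_node /=.
by rewrite !sum_id; move: iv; clear; lia.
Qed.

Lemma gad_W v i : t v != 1 -> i < size (labs v) -> pd (Wn v i) (gad v) = 3.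
Proof.
move=> /negbTE tv iv; rewrite /gad tv !pd_cat !pd_map /Sn /Yn /Pn /Wn !sum_node /=.
by rewrite !sum_id; move: iv; clear; lia.
Qed.

Lemma star0 v z : z \notin plus v -> star v z = 0.
Proof.
move=> zP; apply: big1 => e eD; case: (boolP (inc e v)) => ev //=.
by case: eqP => // ez; rewrite -ez att_plus in zP.
Qed.

Lemma deg_node v z : z \in plus v ++ minus v -> star v z + pd z (gad v) = 3.
Proof.
rewrite mem_cat /plus /minus; case: eqP => [tv|/eqP tv].
  by rewrite inE orbF => /eqP ->; rewrite star_C // /gad tv eqxx /pd big_nil.
have nz z' : z' \in minus v -> star v z' = 0.
  move=> zm; apply: star0; move: zm; rewrite /minus /plus (negbTE tv) !mem_cat => zm.
  apply/negP; move: zm => /orP[] /mapP[i _ ->] /orP[] /mapP[i' _ []] //.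
rewrite !mem_cat => /orP[/orP[]|/orP[]] /mapP[i]; rewrite mem_iota add0n => /= iv ->.
- by rewrite star_S // gad_S //; case: leqP; clear; lia.
- by rewrite star_P // gad_P.
- by rewrite gad_Y // nz // /minus (negbTE tv) mem_cat map_f // mem_iota.
- by rewrite gad_W // nz // /minus (negbTE tv) mem_cat orbC map_f // mem_iota.
Qed.

Lemma labs_le v : 2 * size (labs v) <= 3 * t v.
Proof. by rewrite -frees_labs leq_addl. Qed.

Lemma plus_node v z : z \in plus v -> z.1 = v /\ z.2.1 \in [:: 0; 1; 3].
Proof.
rewrite /plus; case: ifP => _; first by rewrite inE => /eqP ->.
by rewrite mem_cat => /orP[] /mapP[i _ ->].
Qed.

Lemma minus_node v z : z \in minus v -> z.1 = v /\ z.2.1 \notin [:: 0; 1; 3].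
Proof.
rewrite /minus; case: ifP => _ //.
by rewrite mem_cat => /orP[] /mapP[i _ ->].
Qed.

Lemma plus_in v v' z : z \in plus v' -> (z \in plus v) = (v' == v).
Proof.
move=> zP; case: (eqVneq v' v) => [<-|/eqP vv]; first by rewrite zP.
by apply/negP => /plus_node[zv _]; have [zv' _] := plus_node zP; case: vv; rewrite -zv.
Qed.

Lemma minus_in v v' z : z \in minus v' -> (z \in minus v) = (v' == v).
Proof.
move=> zP; case: (eqVneq v' v) => [<-|/eqP vv]; first by rewrite zP.
by apply/negP => /minus_node[zv _]; have [zv' _] := minus_node zP; case: vv; rewrite -zv.
Qed.

Lemma plus_minus v v' z : z \in plus v -> (z \in minus v') = false.
Proof. by move=> /plus_node[_ h]; apply/negP => /minus_node[_]; rewrite h. Qed.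

Lemma minus_plus v v' z : z \in minus v -> (z \in plus v') = false.
Proof. by move=> /minus_node[_ /negP h]; apply/negP => /plus_node[_]. Qed.

Lemma gad_ends v q : q \in gad v -> q.1 \in plus v /\ q.2 \in minus v.
Proof.
rewrite /gad /plus /minus; case: eqP => // _; have := labs_le v => ll.
have S i : i < 3 * t v -> Sn v i \in [seq Sn v i | i <- iota 0 (3 * t v)] ++ [seq Pn v k | k <- iota 0 (size (labs v))].
  by move=> h; rewrite mem_cat map_f // mem_iota.
have P i : i < size (labs v) -> Pn v i \in [seq Sn v i | i <- iota 0 (3 * t v)] ++ [seq Pn v k | k <- iota 0 (size (labs v))].
  by move=> h; rewrite mem_cat orbC map_f // mem_iota.
have Y i : i < 2 * t v -> Yn v i \in [seq Yn v i | i <- iota 0 (2 * t v)] ++ [seq Wn v k | k <- iota 0 (size (labs v))].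
  by move=> h; rewrite mem_cat map_f // mem_iota.
have W i : i < size (labs v) -> Wn v i \in [seq Yn v i | i <- iota 0 (2 * t v)] ++ [seq Wn v k | k <- iota 0 (size (labs v))].
  by move=> h; rewrite mem_cat orbC map_f // mem_iota.
rewrite !mem_cat => /or4P[||| /or4P[]] /mapP[i]; rewrite mem_iota add0n => /= iv -> /=; split;
  rewrite -mem_cat; first [apply: S|apply: Y|apply: P|apply: W] => //; move: iv ll (t1 v); clear; try lia.
Qed.

Lemma size_plus v : size (plus v) = t v + size (minus v).
Proof.
rewrite /plus /minus; case: eqP => [-> //|_]; rewrite !size_cat !size_map !size_iota; clear; lia.
Qed.

Lemma uniq_nodes v : uniq (plus v ++ minus v).
Proof.
have inj (f : nat -> node) n : injective f -> uniq [seq f i | i <- iota 0 n].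
  by move=> h; rewrite map_inj_uniq ?iota_uniq.
have iS : injective (Sn v) by move=> i j [].
have iP : injective (Pn v) by move=> i j [].
have iY : injective (Yn v) by move=> i j [].
have iW : injective (Wn v) by move=> i j [].
rewrite cat_uniq; apply/and3P; split.
- rewrite /plus; case: ifP => // _; rewrite cat_uniq !inj //= andbT.
  by apply/hasPn => z /mapP[i _ ->]; apply/mapP => -[].
- by apply/hasPn => z /minus_plus ->.
- rewrite /minus; case: ifP => // _; rewrite cat_uniq !inj //= andbT.
  by apply/hasPn => z /mapP[i _ ->]; apply/mapP => -[].
Qed.

Lemma att_node e v : (att e v).1 = v.
Proof. by rewrite /att; case: ifP => // _; case: ifP. Qed.

Definition code (z : node) : nat := pickle z.
Arguments code : simpl never.
Lemma code_eq z z' : (code z == code z') = (z == z').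
Proof. exact: (inj_eq (pcan_inj (@pickleK _))). Qed.

(** Old edges have their ranks below [#|E|] as identifiers; gadget edges are numbered from [#|E|]
    on. *)
Fixpoint number N (L : seq (node * node)) : seq edge :=
  if L is q :: L' then (N, code q.1, code q.2) :: number N.+1 L' else [::].

Definition rk (e : E) : nat := enum_rank e.
Definition ext : seq edge := [seq (rk e, code (att e (src e)), code (att e (tgt e))) | e <- enum D].
Definition gads := flatten [seq gad v | v <- enum V].
Definition Gs : seq edge := ext ++ number #|E| gads.
Definition nodes := flatten [seq plus v ++ minus v | v <- enum V].
Definition Ws : seq nat := [seq code z | z <- nodes].

Lemma rk_inj : injective rk. Proof. by move=> e f /ord_inj/enum_rank_inj. Qed.
Lemma rk_lt e : rk e < #|E|. Proof. exact: ltn_ord. Qed.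

Lemma esum_ext f : esum f ext = \sum_(e in D) f (rk e) (code (att e (src e))) (code (att e (tgt e))).
Proof. by rewrite -big_enum /ext; elim: (enum D) => [|e s IH]; rewrite ?big_nil // big_cons -IH. Qed.

Lemma esum_number f N L : esum (fun _ u w => f u w) (number N L) = \sum_(q <- L) f (code q.1) (code q.2).
Proof. by elim: L N => [|q L IH] N; rewrite ?big_nil // big_cons -(IH N.+1). Qed.

Lemma number_mem N L k u w : (k, u, w) \in number N L ->
  N <= k /\ exists2 q, q \in L & u = code q.1 /\ w = code q.2.
Proof.
elim: L N => // q L IH N; rewrite inE => /orP[/eqP[-> -> ->]|/IH[Nk [q' qL qE]]].
  by split=> //; exists q; rewrite ?mem_head.
by split; [apply: ltnW|exists q'; rewrite ?inE ?qL ?orbT].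
Qed.

Lemma number_ids N L k : cnt (pred1 k) (number N L) <= (N <= k).
Proof.
elim: L N => // q L IH N; rewrite cntE; have := IH N.+1; set m := cnt _ _; move: m => m.
by rewrite /pred1 /=; case: (eqVneq N k); clear; lia.
Qed.

Lemma gads_mem q : q \in gads -> exists v, q \in gad v.
Proof. by move=> /flatten_mapP[v _ h]; exists v. Qed.

Lemma ext_mem k u w : (k, u, w) \in ext -> exists e, [/\ e \in D, k = rk e,
  u = code (att e (src e)) & w = code (att e (tgt e))].
Proof. by case/mapP => e; rewrite mem_enum => eD [-> -> ->]; exists e. Qed.

Lemma nodes_mem v z : z \in plus v ++ minus v -> z \in nodes.
Proof. by move=> zv; apply/flatten_mapP; exists v; rewrite ?mem_enum. Qed.

Lemma nodes_inv z : z \in nodes -> z \in plus z.1 ++ minus z.1.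
Proof.
move=> /flatten_mapP[v _ zv]; suff -> : z.1 = v by [].
by move: zv; rewrite mem_cat => /orP[/plus_node[]|/minus_node[]].
Qed.

Lemma code_Ws z : (code z \in Ws) = (z \in nodes).
Proof. by rewrite mem_map //; apply: (pcan_inj (@pickleK _)). Qed.

Lemma inc_src e : inc e (src e). Proof. by rewrite /incident eqxx. Qed.
Lemma inc_tgt e : inc e (tgt e). Proof. by rewrite /incident eqxx orbT. Qed.

Lemma Gs_ends k u w : (k, u, w) \in Gs -> u \in Ws /\ w \in Ws.
Proof.
rewrite mem_cat => /orP[/ext_mem[e [eD _ -> ->]]|/number_mem[_ [q /gads_mem[v /gad_ends[q1 q2]] [-> ->]]]].
  rewrite !code_Ws; split.
    by apply: (@nodes_mem (src e)); rewrite mem_cat att_plus ?inc_src.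
  by apply: (@nodes_mem (tgt e)); rewrite mem_cat att_plus ?inc_tgt.
by rewrite !code_Ws; split; apply: (@nodes_mem v); rewrite mem_cat ?q1 ?q2 ?orbT.
Qed.

Lemma pd_other v z : z.1 != v -> pd z (gad v) = 0.
Proof.
move=> zv; rewrite /pd big1_seq // => q /= /gad_ends[/plus_node[h1 _] /minus_node[h2 _]].
by case: eqP => [h|_]; [rewrite -h h1 eqxx in zv|case: eqP => [h|//]; rewrite -h h2 eqxx in zv].
Qed.

Lemma pd_gads z : pd z gads = pd z (gad z.1).
Proof.
rewrite /pd /gads big_flatten big_map /= (bigD1_seq z.1) ?mem_enum ?enum_uniq //=.
rewrite [X in _ + X]big1 ?addn0 // => v vz; apply: (@pd_other v z); by rewrite eq_sym.
Qed.

Lemma star_ends (P : pred E) z : \sum_(e in D) ((P e && (att e (src e) == z)) + (P e && (att e (tgt e) == z))) =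
  \sum_(e in D) (P e && (inc e z.1 && (att e z.1 == z))).
Proof.
apply: eq_bigr => e _; case: (P e) => //=; rewrite /incident.
have st := loop e; have a := att_node e.
have E1 x : (att e x == z) = (x == z.1) && (att e z.1 == z).
  by case: (eqVneq x z.1) => [->//|/eqP ne]; apply/eqP => h; apply: ne; rewrite -h a.
rewrite (E1 (src e)) (E1 (tgt e)); case: (eqVneq (src e) z.1) => [h|_] //=; rewrite ?orbF.
by rewrite -h [tgt e == _]eq_sym (negbTE st) addn0.
Qed.

Lemma deg_Gs z : z \in nodes -> deg (code z) Gs = 3.
Proof.
move=> zn; rewrite /dg esum_cat esum_ext (esum_number (fun u w => (u == code z) + (w == code z))).
under [X in X + _]eq_bigr do rewrite !code_eq.
under [X in _ + X]eq_bigr do rewrite !code_eq.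
rewrite -[X in _ + X]/(pd z gads) pd_gads (star_ends xpredT).
exact: deg_node (nodes_inv zn).
Qed.

Lemma uniq_Ws : uniq Ws.
Proof.
rewrite map_inj_uniq; last exact: (pcan_inj (@pickleK _)).
rewrite /nodes; have := enum_uniq V; elim: (enum V) => //= v s IH /andP[vs us].
rewrite cat_uniq uniq_nodes IH // andbT; apply/hasPn => z /flatten_mapP[v' v's].
rewrite !mem_cat => zv'; have zv : z.1 = v' by case/orP: zv' => [/plus_node[]|/minus_node[]].
apply/negP => /orP[/plus_node[h _]|/minus_node[h _]]; by rewrite -h zv v's in vs.
Qed.

Lemma ids_Gs k : cnt (pred1 k) Gs <= 1.
Proof.
rewrite cnt_cat; have := number_ids #|E| gads k.
have -> : cnt (pred1 k) ext = \sum_(e in D) (rk e == k) by apply: (esum_ext (fun k' _ _ => k' == k)).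
case: (pickP [pred e in D | rk e == k]) => [e /andP[eD /eqP ek]|no].
  rewrite (bigD1 e) //= ek eqxx big1 => [|f /andP[_ ne]].
    have kE : k < #|E| by rewrite -ek rk_lt.
    by rewrite [#|E| <= k]leqNgt kE leqn0 => /eqP ->.
  by apply/eqP; rewrite eqb0 -ek (inj_eq rk_inj).
rewrite big1 => [|e eD]; first by move=> h; apply: leq_trans h (leq_b1 _).
by have := no e; rewrite /= eD /= => ->.
Qed.

(* A perfect matching uses [t v] of the edges of [G] at the gadget of [v], because the gadget is
   bipartite with [t v] more nodes on the side to which these edges are attached. *)
Lemma pm_degree M v : pm Ws M Gs -> \sum_(e in D) (M (rk e) && inc e v) = t v.
Proof.
(* A perfect matching covers each node once, so a set of nodes is counted by the ends of matching
   edges in it. Applied to both sides of the gadget, the inner edges cancel. *)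
move=> pM; have wgt Z : uniq Z -> {subset Z <= nodes} ->
    size Z = esum (fun k u w => (M k && (u \in map code Z)) + (M k && (w \in map code Z))) Gs.
  move=> uZ sZ; have -> : size Z = \sum_(z <- Z) dg M (code z) Gs.
    rewrite -sum1_size; apply: eq_big_seq => z zZ; rewrite pM //.
    by rewrite code_Ws sZ.
  elim: Gs => [|[[k u] w] G IH]; first by rewrite big1_eq.
  rewrite /= -IH; under eq_bigr do rewrite dgE.
  rewrite big_split /=; congr (_ + _); case: (M k) => /=; last by rewrite big1.
  have one u' : \sum_(z <- Z) (u' == code z) = (u' \in map code Z).
    elim: Z uZ {sZ IH} => [|z Z IH] /=; first by rewrite big_nil.
    move=> /andP[zZ uZ]; rewrite big_cons IH // inE; case: (eqVneq u' (code z)) => //= ->.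
    by rewrite mem_map ?(negbTE zZ) //; apply: (pcan_inj (@pickleK _)).
  by rewrite big_split /= !one.
have sub_p : {subset plus v <= nodes}.
  by move=> z zv; apply: (@nodes_mem v); rewrite mem_cat zv.
have sub_m : {subset minus v <= nodes}.
  by move=> z zv; apply: (@nodes_mem v); rewrite mem_cat zv orbT.
have := uniq_nodes v; rewrite cat_uniq => /and3P[up _ um].
have := size_plus v; rewrite (wgt _ up sub_p) (wgt _ um sub_m) !esum_cat.
have mc z Z : (code z \in map code Z) = (z \in Z).
  by rewrite mem_map //; apply: (pcan_inj (@pickleK _)).
rewrite !esum_ext => h; apply/eqP; rewrite -(eqn_add2r (esum (fun k u w => (M k && (u \in map code (minus v)))
  + (M k && (w \in map code (minus v)))) (number #|E| gads))); apply/eqP.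
rewrite [X in _ = t v + (X + _)]big1 ?add0n in h => [|e eD]; last first.
  by rewrite !mc !(plus_minus _ (att_plus eD _)) ?inc_src ?inc_tgt // andbF.
rewrite -h; congr (_ + _).
  apply: eq_bigr => e eD; rewrite !mc !(plus_in _ (att_plus eD _)) ?inc_src ?inc_tgt //.
  rewrite /incident; case: (M (rk e)) => //=; case: (eqVneq (src e) v) => [h'|_] //=.
  by rewrite -h' eq_sym (negbTE (loop e)).
apply: eq_esum => k u w /number_mem[_ [q /gads_mem[v' /gad_ends[q1 q2]] [-> ->]]].
by rewrite !mc (plus_in _ q1) (minus_in _ q2) (plus_minus _ q1) (minus_plus _ q2) !andbF addn0.
Qed.

Lemma term_le n (F : nat -> nat) i : i < n -> F i <= \sum_(i <- iota 0 n) F i.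
Proof. by move=> h; rewrite (bigD1_seq i) ?iota_uniq ?mem_iota //= leq_addr. Qed.

Lemma two_terms_le n (F : nat -> nat) i j : i < n -> j < n -> i != j ->
  F i + F j <= \sum_(i <- iota 0 n) F i.
Proof.
move=> h h' ij; rewrite (bigD1_seq i) ?iota_uniq ?mem_iota //= leq_add2l.
by rewrite big_mkcond (bigD1_seq j) ?iota_uniq ?mem_iota //= eq_sym ij leq_addr.
Qed.

Lemma path_changes (g : nat -> bool) a n :
  (g a != g (a + n)) <= \sum_(i <- iota a n) (g i != g i.+1).
Proof.
elim: n a => [|n IH] a; first by rewrite addn0 eqxx.
rewrite big_cons; have := IH a.+1; rewrite addSnnS.
by case: (g a); case: (g a.+1); case: (g (a + n.+1)) => //=; clear; lia.
Qed.

(** * Cuts inside a single gadget *)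

Section Core.
Variables (B : pred node) (v : V).
Hypothesis tv : 1 < t v.
Let n := 2 * t v.
Let S i := B (Sn v i).
Let Y i := B (Yn v i).
Let P i := B (Pn v i).
Let W i := B (Wn v i).
Let l := size (labs v).

Definition ic := \sum_(q <- gad v) (B q.1 != B q.2).
Let core := \sum_(i <- iota 0 n) ((S i != Y i) + (S i != Y (i.+1 %% n))) +
  \sum_(i <- iota 0 (t v)) ((S (n + i) != Y (2 * i)) + (S (n + i) != Y (2 * i).+1)).
Let pairs := \sum_(k <- iota 0 l) ((P k != W k) + (S (2 * k) != W k) + (S (2 * k).+1 != W k)).

Let icE : ic = core + pairs.
Proof.
by rewrite /ic /gad (gtn_eqF tv) !big_cat !big_map /core /pairs !big_split /= !addnA.
Qed.

(** One edge never suffices to divide the core: a change of side along the cycle of [Yn] nodes has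
    to be undone further on, and an [Sn] node that disagrees with them cuts both of its edges. *)
Let core_const : core <= 1 -> exists b, (forall i, i < 3 * t v -> S i = b) /\ (forall i, i < n -> Y i = b).
Proof.
move=> c1; have n0 : 0 < n by rewrite /n; move: tv; clear; lia.
have Yc i : i < n -> Y i = Y 0.
  move=> lin; apply/eqP/negPn/negP => ne; pose g i := Y (i %% n).
  suff : 2 <= core by rewrite leqNgt ltnS c1.
  apply: leq_trans (leq_addr _ _).
  apply: leq_trans (_ : \sum_(i <- iota 0 n) (g i != g i.+1) <= _); last first.
    rewrite !big_seq; apply: leq_sum => j; rewrite mem_iota add0n => /= jn.
    by rewrite /g (modn_small jn); case: (S j); case: (Y j); case: (Y _).
  rewrite -[n in iota 0 n](subnKC (ltnW lin)) iotaD big_cat add0n /=.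
  have := path_changes g 0 i; have := path_changes g i (n - i).
  rewrite subnKC ?(ltnW lin) // add0n /g modnn (modn_small lin) mod0n (negbTE ne) eq_sym (negbTE ne) /=.
  by set s1 := \sum_(_ <- _) _; set s2 := \sum_(_ <- _) _; clear; lia.
exists (Y 0); split=> // i i3; apply/eqP/negPn/negP => ne.
suff : 2 <= core by rewrite leqNgt ltnS c1.
case: (ltnP i n) => lin.
  apply: leq_trans (leq_addr _ _); apply: leq_trans (term_le _ lin).
  by rewrite !Yc // ?ltn_mod // ne.
have i't : i - n < t v by move: lin i3; rewrite /n; clear; lia.
apply: leq_trans (leq_addl _ _); apply: leq_trans (term_le _ i't).
by rewrite subnKC // !Yc ?ne // /n; move: i't; clear; lia.
Qed.

(** The neighbours of [Yn v i] are all [Sn] nodes: [Sn v i], its predecessor on the cycle, and the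
    one of index [2 * t v + i./2] on the doubled edge. All three edges are cut. *)
Let core_Y b i : (forall i, i < 3 * t v -> S i = ~~ b) -> i < n -> Y i = b -> 3 <= core.
Proof.
move=> Sb lin Yi; have n0 : 0 < n by move: lin; case: (n).
have bb : (~~ b != b) = true by case: (b).
rewrite /core !big_split /=.
have h1 : 0 < \sum_(i <- iota 0 n) (S i != Y i).
  by apply: leq_trans (term_le _ lin); rewrite Yi Sb ?bb //; move: lin; rewrite /n; clear; lia.
have h2 : 0 < \sum_(i <- iota 0 n) (S i != Y (i.+1 %% n)).
  pose j := if i == 0 then n.-1 else i.-1.
  have jn : j < n by rewrite /j; case: (i == 0); move: n0 lin; clear; lia.
  have ji : j.+1 %% n = i.
    rewrite /j; case: eqP => [->|]; first by rewrite prednK ?modnn.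
    by case: (i) lin => // i' h _; rewrite modn_small.
  by apply: leq_trans (term_le _ jn); rewrite ji Yi Sb ?bb //; move: jn; rewrite /n; clear; lia.
have i2 : i./2 < t v by move: lin; rewrite /n; clear; lia.
have Si : S (n + i./2) = ~~ b by apply: Sb; move: i2; rewrite /n; clear; lia.
have h3 : 0 < \sum_(i <- iota 0 (t v)) (S (n + i) != Y (2 * i)) + \sum_(i <- iota 0 (t v)) (S (n + i) != Y (2 * i).+1).
  case: (boolP (odd i)) => oi.
    apply: leq_trans (leq_addl _ _); apply: leq_trans (term_le _ i2).
    by have -> : (2 * i./2).+1 = i; [move: oi; clear; lia|rewrite Yi Si bb].
  apply: leq_trans (leq_addr _ _); apply: leq_trans (term_le _ i2).
  by have -> : 2 * i./2 = i; [move: oi; clear; lia|rewrite Yi Si bb].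
by move: h1 h2 h3; set s1 := \sum_(_ <- _) _; set s2 := \sum_(_ <- _) _;
  set s3 := \sum_(_ <- _) _; set s4 := \sum_(_ <- _) _; clear; lia.
Qed.

Let node_cases z : z \in plus v ++ minus v -> [\/ exists2 i, i < 3 * t v & z = Sn v i,
  exists2 i, i < l & z = Pn v i, exists2 i, i < n & z = Yn v i | exists2 i, i < l & z = Wn v i].
Proof.
rewrite /plus /minus (gtn_eqF tv) !mem_cat => /orP[/orP[]|/orP[]] /mapP[i];
  rewrite mem_iota add0n => /= iv ->;
  by [constructor 1; exists i|constructor 2; exists i|constructor 3; exists i|constructor 4; exists i].
Qed.

(* If only one edge of a gadget is cut, it separates a single node [Pn v k] from the rest. *)
Lemma ic_cases : [\/ exists b, forall z, z \in plus v ++ minus v -> B z = b, 2 <= ic |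
  1 <= ic /\ exists j b, j \in labs v /\
    forall e, e \in D -> inc e v -> B (att e v) = (c e == j) (+) b].
Proof.
case: (leqP 2 ic) => [|ic1]; first by constructor 2.
have c1 : core <= 1 by move: ic1; rewrite icE; clear; lia.
have p1 : pairs <= 1 by move: ic1; rewrite icE; clear; lia.
have [b [Sb Yb]] := core_const c1.
have S2 k : k < l -> S (2 * k) = b /\ S (2 * k).+1 = b.
  by move=> kl; split; apply: Sb; move: (labs_le v) kl; rewrite /l; clear; lia.
have Wb k : k < l -> W k = b.
  move=> kl; have := leq_trans (term_le _ kl) p1; have [-> ->] := S2 k kl.
  by case: (P k); case: (W k); case: (b).
case: (boolP (has (fun k => P k != b) (iota 0 l))) => hP; last first.
  constructor 1; exists b => z /node_cases[] [i il ->]; rewrite -?/(S i) -?/(Y i) -?/(W i); auto.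
  apply/eqP; apply/negPn; apply: contra hP => h; apply/hasP; exists i => //.
  by rewrite mem_iota.
have /hasP[k] := hP; rewrite mem_iota add0n => /= kl Pk; constructor 3; split.
  rewrite icE; apply: leq_trans (leq_addl _ _); apply: leq_trans (term_le _ kl).
  by rewrite (Wb k kl) Pk.
exists (nth 0 (labs v) k), b; split; first exact: mem_nth.
move=> e eD ev; rewrite /att (gtn_eqF tv); case: (posnP (c e)) => [ce|c0].
  rewrite ce; have [j0 _] := mem_labs (mem_nth 0 kl); rewrite (ltn_eqF j0) /=.
  apply: Sb; have : index e (frees v) < size (frees v) by rewrite index_mem in_frees eD ev ce.
  by rewrite -(frees_labs v); clear; lia.
have cL := in_labs eD ev c0; have il : index (c e) (labs v) < l by rewrite index_mem.
case: (eqVneq (c e) (nth 0 (labs v) k)) => [->|ne] /=.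
  by rewrite index_uniq ?uniq_labs // -/(P k); move: Pk; case: (P k); case: (b).
apply/eqP/negPn/negP => Pi; have := two_terms_le (fun k => (P k != W k) + (S (2 * k) != W k) + (S (2 * k).+1 != W k)) il kl.
rewrite -/pairs (Wb _ il) (Wb _ kl) Pk {1}/P Pi /= => h.
have : 2 <= pairs by apply: leq_trans (h _); [clear; lia|apply: contraNneq ne => <-; rewrite nth_index].
by rewrite leqNgt ltnS p1.
Qed.

(** A part of the gadget not containing any node that carries old edges is separated by at least
    three edges. If it contains an [Sn] node, the path from there to a [Pn] node is cut outside the
    core, and the core is either cut twice or lies wholly in the part. Otherwise a [Yn] or [Wn] node
    of the part has all its edges cut. *)
Lemma ic_no_dangling b : (forall k, k < l -> P k = ~~ b) -> (forall i, 2 * l <= i < 3 * t v -> S i = ~~ b) ->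
  (exists2 z, z \in plus v ++ minus v & B z = b) -> 3 <= ic.
Proof.
move=> Pb Sb [z zv Bz]; rewrite icE.
have bb : (~~ b != b) = true by case: (b).
have full : core <= 1 -> (exists2 i, i < 3 * t v & S i = b) -> 3 <= pairs.
  move=> c1 [i i3 Si]; have [b' [Sb' _]] := core_const c1.
  have {Sb'} Sb' j : j < 3 * t v -> S j = b by move=> j3; rewrite Sb' // -(Sb' i).
  (* All [3 * t v >= 6] nodes [Sn] are taken by labels, so there are at least three labels, and each
     of them contributes a cut edge. *)
  have l2 : 3 * t v <= 2 * l.
    rewrite leqNgt; apply/negP => h; have := Sb (2 * l); rewrite leqnn h Sb' // => /(_ isT).
    by case: (b).
  apply: leq_trans (_ : \sum_(k <- iota 0 l) 1 <= _).
    by rewrite sum1_size size_iota; move: l2 tv; clear; lia.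
  rewrite /pairs !big_seq; apply: leq_sum => k; rewrite mem_iota add0n => /= kl.
  rewrite Pb // !Sb'; try by move: kl (labs_le v); rewrite /l; clear; lia.
have split2 : 0 < pairs -> (exists2 i, i < 3 * t v & S i = b) -> 3 <= core + pairs.
  move=> p0 hS; case: (leqP core 1) => c1; last by move: p0 c1; clear; lia.
  by apply: leq_trans (full c1 hS) (leq_addl _ _).
have hS i : i < 3 * t v -> S i = b -> 3 <= core + pairs.
  move=> i3 Si; apply: split2; last by exists i.
  have il : i < 2 * l.
    by rewrite ltnNge; apply/negP => h; have := Sb i; rewrite h i3 Si => /(_ isT); case: (b).
  have kl : i./2 < l by move: il; clear; lia.
  apply: leq_trans (term_le _ kl); rewrite Pb //.
  case: (boolP (odd i)) => oi.
    by have -> : (2 * i./2).+1 = i; [move: oi; clear; lia|rewrite Si; case: (W _); case: (S _); case: (b)].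
  by have -> : 2 * i./2 = i; [move: oi; clear; lia|rewrite Si; case: (W _); case: (b); case: (S _)].
case: (boolP (has (fun i => S i == b) (iota 0 (3 * t v)))) => [/hasP[i]|nS].
  by rewrite mem_iota add0n => /= i3 /eqP; apply: hS.
have {nS} nS i : i < 3 * t v -> S i = ~~ b.
  move=> i3; have : S i != b by apply: contra nS => h; apply/hasP; exists i; rewrite ?mem_iota.
  by case: (S i); case: (b).
have [[i il zE]|[i il zE]|[i il zE]|[i il zE]] := node_cases zv; rewrite zE in Bz.
- exact: hS il Bz.
- by have := Pb i il; rewrite /P Bz; case: (b).
- by apply: leq_trans (core_Y nS il Bz) (leq_addr _ _).
apply: leq_trans (leq_addl _ _); apply: leq_trans (term_le _ il).
by rewrite Pb // !nS ?/W ?Bz ?bb //; move: il (labs_le v); rewrite /l; clear; lia.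
Qed.
End Core.

Hypothesis dig : forall v z e f, e \in D -> f \in D -> e != f -> 0 < c e -> c f = c e ->
  inc e v -> inc f v -> inc e z -> inc f z -> v = z.
Hypothesis nf : forall v z, v != z -> \sum_(e in D) [&& inc e v, inc e z & c e == 0] <= 3.

(** In the next hypothesis [Z] collects deleted vertices. They stand for the gadgets divided by a
    cut; each of these costs at least one gadget edge, and [size Z] accounts for it. *)
Definition avoids (Z : seq V) e := ~~ has (inc e) Z.
Hypothesis ec : forall (Z : seq V) (A : pred V) u w, size Z <= 2 -> u \notin Z -> w \notin Z ->
  A u -> ~~ A w -> 3 <= size Z + \sum_(e in D) (avoids Z e && (A (src e) != A (tgt e))).

Lemma other_end v e : inc e v -> exists x, [/\ x != v, inc e x &
  forall f : V -> bool, (f (src e) != f (tgt e)) = (f v != f x)].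
Proof.
case/orP => /eqP <-; [exists (tgt e)|exists (src e)]; split=> //; rewrite ?inc_src ?inc_tgt //.
- by rewrite eq_sym loop.
- by move=> f; rewrite eq_sym.
Qed.

Lemma pos_sum (P : pred E) : 0 < \sum_(e in D) P e -> exists2 e, e \in D & P e.
Proof.
move=> h; case: (pickP [pred e in D | P e]) => [e /andP[eD Pe]|no]; first by exists e.
by move: h; rewrite big1 // => e eD; have := no e; rewrite /= eD /= => ->.
Qed.

Lemma sum_pos (P : pred E) e : e \in D -> P e -> 0 < \sum_(e in D) P e.
Proof. by move=> eD Pe; rewrite (bigD1 e) //= Pe. Qed.

Lemma inc_two e v x z : inc e v -> inc e x -> inc e z -> v != x -> z = v \/ z = x.
Proof.
rewrite /incident => /orP[] /eqP h1 /orP[] /eqP h2 /orP[] /eqP h3; rewrite -?h1 -?h2 -?h3 ?eqxx //; auto.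
Qed.

Lemma two_labelled v j : j \in labs v ->
  exists e f, [/\ e \in D, f \in D, e != f, inc e v && (c e == j) & inc f v && (c f == j)].
Proof.
move=> jL; have s2 := labs_sum jL; have [|e eD Pe] := pos_sum (P := fun e => inc e v && (c e == j)).
  by rewrite s2.
move: s2; rewrite (bigD1 e) //= Pe => s2.
case: (pickP [pred f in D | (f != e) && (inc f v && (c f == j))]) => [f /and3P[fD fe Pf]|no].
  by exists e, f; split=> //; rewrite eq_sym.
by move: s2; rewrite big1 // => f /andP[fD fe]; have := no f; rewrite /= fD fe /= => ->.
Qed.

Lemma labelled_away v z j : v != z -> j \in labs v ->
  exists e, [/\ e \in D, inc e v, c e = j & ~~ inc e z].
Proof.
move=> vz jL; have [j0 _] := mem_labs jL.
have [e [f [eD fD ef /andP[ev /eqP ce] /andP[fv /eqP cf]]]] := two_labelled jL.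
case: (boolP (inc e z)) => ez; last by exists e.
case: (boolP (inc f z)) => fz; last by exists f.
by move: vz; rewrite (dig eD fD ef _ _ ev fv ez fz) ?eqxx ?ce ?cf.
Qed.

Lemma many_other v j : 1 < t v -> j \in labs v -> 4 <= \sum_(e in D) (inc e v && (c e != j)).
Proof.
move=> tv jL; have := degD v; have := labs_sum jL.
suff -> : \sum_(e in D) inc e v = \sum_(e in D) (inc e v && (c e == j)) + \sum_(e in D) (inc e v && (c e != j)).
  by move=> ->; move: tv; set s := \sum_(_ in _) _; clear; lia.
by rewrite -big_split; apply: eq_bigr => e _; case: (inc e v); case: (c e == j).
Qed.

(** At least four edges at [v] are outside the class [j]. A second class at [v] has an edge avoiding
    [z]; without a second class all of them are unlabelled, and [nf] lets only three go to [z]. *)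
Lemma other_away v z j : v != z -> 1 < t v -> j \in labs v ->
  exists e, [/\ e \in D, inc e v, c e != j & ~~ inc e z].
Proof.
move=> vz tv jL.
case: (pickP [pred e in D | [&& inc e v, c e != j & ~~ inc e z]]) => [e /and4P[]|no].
  by exists e.
case: (boolP (has (predC1 j) (labs v))) => [/hasP[j' j'L /= ne]|].
  have [e [eD ev ce ez]] := labelled_away vz j'L.
  by have := no e; rewrite /= eD ev ce ez ne.
rewrite has_predC negbK => /allP all_j.
have := many_other tv jL; rewrite leqNgt ltnS => /negP[]; apply: leq_trans (nf vz).
apply: leq_sum => e eD; have := no e; rewrite /= eD /=; case: (boolP (inc e v)) => ev //=.
case: eqP => //= cj /negbT; rewrite negbK => ez; rewrite ez /=.
case: (posnP (c e)) => // c0; have /all_j := in_labs eD ev c0; by rewrite /= => /eqP.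
Qed.

(** * 3-edge-connectivity of the expanded graph *)

Section Cut.
Variable B : pred node.
Notation Ext := (\sum_(e in D) (B (att e (src e)) != B (att e (tgt e)))).

Definition uni v b := all (fun z => B z == b) (plus v ++ minus v).
Definition unif v := uni v true || uni v false.

Lemma uni_att v b e : e \in D -> inc e v -> uni v b -> B (att e v) = b.
Proof. by move=> eD ev /allP h; apply/eqP/h; rewrite mem_cat att_plus. Qed.

Lemma not_unif_t v : ~~ unif v -> 1 < t v.
Proof.
move=> nu; have := t1 v; rewrite leq_eqVlt => /orP[/eqP tv|//]; case/negP: nu.
by rewrite /unif /uni /plus /minus -tv /= !andbT; case: (B _).
Qed.

Lemma not_unif_ic v : ~~ unif v -> 2 <= ic B v \/ 1 <= ic B v /\ exists j b, j \in labs v /\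
    forall e, e \in D -> inc e v -> B (att e v) = (c e == j) (+) b.
Proof.
move=> nu; have [[b h]||] := ic_cases B (not_unif_t nu); [|by left|by right].
by case/negP: nu; case: b h => h; apply/orP; [left|right]; apply/allP => z /h ->.
Qed.

Lemma not_unif_ic1 v : ~~ unif v -> 1 <= ic B v.
Proof. by move=> /not_unif_ic[|[]] // h; apply: leq_trans h. Qed.

Lemma ic_sum s : uniq s -> \sum_(v <- s) ic B v <= \sum_v ic B v.
Proof.
by move=> us; rewrite (big_uniq _ us) [X in _ <= X](bigID (mem s)) /= leq_addr.
Qed.

Lemma ext_away v z e : e \in D -> inc e v -> ~~ inc e z ->
  (forall x, x != v -> x != z -> uni x (~~ B (att e v))) -> 0 < Ext.
Proof.
move=> eD ev ez h; have [x [xv ex fx]] := other_end ev.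
have xz : x != z by apply: contraNneq ez => <-.
apply: (sum_pos eD); rewrite (fx (fun v => B (att e v))).
by rewrite (uni_att eD ex (h x xv xz)); case: (B _).
Qed.

Lemma ext_one v a : (forall x, x != v -> uni x a) ->
  Ext >= \sum_(e in D) (inc e v && (B (att e v) != a)).
Proof.
move=> h; apply: leq_sum => e eD; case: (boolP (inc e v)) => //= ev.
have [x [xv ex fx]] := other_end ev; rewrite (fx (fun v => B (att e v))).
by rewrite (uni_att eD ex (h x xv)).
Qed.

(** On undivided gadgets a cut of the nodes is a cut of [V], to which [ec] applies with the divided
    gadgets as deleted vertices. *)
Lemma ext_ec (Z : seq V) u w : size Z <= 2 -> (forall x, x \notin Z -> unif x) -> u \notin Z -> w \notin Z ->
  uni u true -> ~~ uni w true -> 3 <= size Z + Ext.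
Proof.
move=> s2 uZ uN wN uT wT; apply: leq_trans (ec (A := fun v => uni v true) s2 uN wN uT wT) _.
rewrite leq_add2l; apply: leq_sum => e eD; case: (boolP (avoids Z e)) => //= aZ.
have val x : inc e x -> B (att e x) = uni x true.
  move=> ex; have xZ : x \notin Z by apply: contra aZ => xZ; apply/hasP; exists x.
  case: (boolP (uni x true)) => h; first exact: uni_att eD ex h.
  by apply: (uni_att eD ex); have := uZ x xZ; rewrite /unif (negbTE h).
by rewrite !val ?inc_src ?inc_tgt.
Qed.

Lemma const_or (Z : seq V) : (forall x, x \notin Z -> unif x) ->
  (exists u w, [/\ u \notin Z, w \notin Z, uni u true & ~~ uni w true]) \/
  exists a, forall x, x \notin Z -> uni x a.
Proof.
move=> uZ; case: (pickP [pred u | (u \notin Z) && uni u true]) => [u /andP[uN uT]|no1].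
  case: (pickP [pred w | (w \notin Z) && ~~ uni w true]) => [w /andP[wN wT]|no2].
    by left; exists u, w.
  right; exists true => x xZ; have := no2 x; by rewrite /= xZ /= => /negbFE.
right; exists false => x xZ; have := no1 x; have := uZ x xZ; rewrite /unif /= xZ /=.
by move=> /orP[->|].
Qed.

(* Two gadgets, each cut in one edge: without [dig] and [nf] all further edges of one of them might
   go to the other. *)
Lemma cut_two v z : v != z -> ~~ unif v -> ~~ unif z -> 3 <= Ext + \sum_v ic B v.
Proof.
move=> vz nv nz; have i_v := not_unif_ic1 nv; have i_z := not_unif_ic1 nz.
case: (pickP [pred y | [&& y != v, y != z & ~~ unif y]]) => [y /and3P[yv yz ny]|no].
  have := @ic_sum [:: y; v; z]; rewrite /= !inE negb_or yv yz vz => /(_ isT).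
  rewrite !big_cons big_nil; have := not_unif_ic1 ny; move: i_v i_z.
  by set s := \sum_(_ <- _) _; set x := Ext; clear; lia.
have uZ x : x \notin [:: v; z] -> unif x.
  rewrite !inE negb_or => /andP[xv xz]; have := no x; by rewrite /= xv xz /= => /negbFE.
have two : ic B v + ic B z <= \sum_v ic B v.
  by have := @ic_sum [:: v; z]; rewrite /= !inE vz !big_cons big_nil addn0 => /(_ isT).
case: (not_unif_ic nv) => [v2|[_ [j [b [jL jb]]]]].
  by move: two v2 i_z; set s := \sum_(_ <- _) _; set x := Ext; clear; lia.
suff : 0 < Ext by move: two i_v i_z; set s := \sum_(_ <- _) _; set x := Ext; clear; lia.
case: (const_or uZ) => [[u [w [uN wN uT wT]]]|[a ha]].
  by have := ext_ec (isT : size [:: v; z] <= 2) uZ uN wN uT wT.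
have {}ha x : x != v -> x != z -> uni x a by move=> xv xz; apply: ha; rewrite !inE negb_or xv.
(* The gadget of [v] is divided into the node of class [j] and the rest. Whichever part is opposite
   to [a] has an old edge avoiding [z], and this edge is cut. *)
case: (eqVneq a b) => ab.
  have [e [eD ev ce ez]] := labelled_away vz jL; apply: (ext_away eD ev ez) => x xv xz.
  by rewrite jb // ce eqxx /= negbK -ab ha.
have [e [eD ev ce ez]] := other_away vz (not_unif_t nv) jL; apply: (ext_away eD ev ez) => x xv xz.
by rewrite jb // (negbTE ce) /=; have := ha x xv xz; case: (a) (b) ab => -[].
Qed.

(** If the other gadgets lie on both sides, [ec] gives two old edges besides a gadget edge. Suppose
    that they all lie on side [a]. With two gadget edges cut, one old edge suffices, and if there is
    none, [ic_no_dangling] applies. If only the node of a class is split off, the two edges of that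
    class or the at least four others are cut. *)
Lemma cut_one v : ~~ unif v -> (forall x, x != v -> unif x) -> 3 <= Ext + \sum_v ic B v.
Proof.
move=> nv uN; have tv := not_unif_t nv.
have one : ic B v <= \sum_v ic B v by have := @ic_sum [:: v] isT; rewrite big_seq1.
have i1 := not_unif_ic1 nv.
have uZ x : x \notin [:: v] -> unif x by rewrite inE; apply: uN.
case: (const_or uZ) => [[u [w [uv wv uT wT]]]|[a ha]].
  have := ext_ec (isT : size [:: v] <= 2) uZ uv wv uT wT.
  by move: one i1; set s := \sum_(_ <- _) _; set x := Ext; clear => /=; lia.
have {}ha x : x != v -> uni x a by move=> xv; apply: ha; rewrite inE.
have xt := ext_one ha.
case: (not_unif_ic nv) => [v2|[_ [j [b [jL jb]]]]].
  case: (posnP (\sum_(e in D) (inc e v && (B (att e v) != a)))) => [x0|x0]; last first.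
    by move: one v2 xt x0; set s := \sum_(_ <- _) _; set x := Ext; set y := \sum_(_ in _) _; clear; lia.
  apply: leq_trans (leq_addl _ _); apply: leq_trans one; apply: (ic_no_dangling tv (b := ~~ a)).
  - move=> k kl; rewrite negbK; have : 0 < star v (Pn v k).
      by rewrite star_P // (gtn_eqF tv).
    move=> /pos_sum[e eD /andP[ev /eqP ek]]; apply/eqP/negPn/negP => ne.
    by move/eqP: x0; rewrite sum_nat_eq0 => /forallP/(_ e); rewrite eD ev ek ne.
  - move=> i /andP[il i3]; rewrite negbK; have : 0 < star v (Sn v i).
      by rewrite star_S // ?(gtn_eqF tv) // il.
    move=> /pos_sum[e eD /andP[ev /eqP ek]]; apply/eqP/negPn/negP => ne.
    by move/eqP: x0; rewrite sum_nat_eq0 => /forallP/(_ e); rewrite eD ev ek ne.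
  case: (boolP (uni v a)) => [h|/allPn[z zv Bz]].
    by case/negP: nv; rewrite /unif; case: (a) h => -> //; rewrite orbT.
  by exists z => //; move: Bz; case: (B z); case: (a).
suff : 2 <= \sum_(e in D) (inc e v && (B (att e v) != a)).
  by move: xt one i1; set s := \sum_(_ <- _) _; set x := Ext; set y := \sum_(_ in _) _; clear; lia.
case: (eqVneq a b) => ab.
  rewrite -(labs_sum jL); apply: leq_sum => e eD; case: (boolP (inc e v)) => ev //=.
  by rewrite jb //; case: (c e == j) => //=; rewrite -ab; case: (a).
apply: leq_trans (isT : 2 <= 4) _; apply: leq_trans (many_other tv jL) _; apply: leq_sum => e eD; case: (boolP (inc e v)) => ev //=.
by rewrite jb //; case: (c e == j) => //=; rewrite eq_sym ab.
Qed.

Lemma cut_nodes u w : u \in nodes -> w \in nodes -> B u -> ~~ B w -> 3 <= Ext + \sum_v ic B v.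
Proof.
move=> un wn Bu Bw; case: (pickP [pred v | ~~ unif v]) => [v /= nv|all_u].
  case: (pickP [pred z | (z != v) && ~~ unif z]) => [z /andP[zv nz]|no].
    by apply: (@cut_two v z); rewrite 1?eq_sym.
  by apply: (cut_one nv) => x xv; have := no x; rewrite /= xv /= => /negbFE.
have uZ x : x \notin [::] -> unif x by move=> _; have := all_u x => /= /negbFE.
apply: leq_trans (leq_addr _ _).
have uT : uni u.1 true.
  have := uZ u.1 isT => /orP[//|/allP/(_ u (nodes_inv un))]; by rewrite Bu.
have wT : ~~ uni w.1 true.
  by apply/negP => /allP/(_ w (nodes_inv wn)); rewrite (negbTE Bw).
exact: (ext_ec (Z := [::]) isT uZ isT isT uT wT).
Qed.
End Cut.

Lemma wf_Gs : wf Ws Gs.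
Proof.
split; [exact: uniq_Ws| |exact: ids_Gs|].
- move=> v; case: (boolP (v \in Ws)) => [/mapP[z zn ->]|vW]; first exact: deg_Gs.
  apply: esum0 => k u w /Gs_ends[uW wW].
  by do 2 (case: eqP => [h|_]; first by rewrite -h ?uW ?wW in vW).
move=> A u w /mapP[u' un ->] /mapP[w' wn ->] Au Aw.
apply: leq_trans (@cut_nodes (fun z => A (code z)) u' w' un wn Au Aw) _.
rewrite /cut esum_cat esum_ext (esum_number (fun u w => A u != A w)) leq_add2l.
by rewrite /gads big_flatten big_map big_enum.
Qed.

Lemma dg_Gs M z : dg M (code z) Gs = \sum_(e in D) (M (rk e) && (inc e z.1 && (att e z.1 == z))) +
  dg M (code z) (number #|E| gads).
Proof.
rewrite dg_cat; congr (_ + _); rewrite /dg esum_ext -star_ends.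
by apply: eq_bigr => e _; rewrite !code_eq.
Qed.

(** * From a perfect matching to a factor *)

Section Solve.
Variable e0 : E.
(* The label of [e0] is dropped, as [e0] hits it; then [e0] spans no label class. *)
Hypotheses (e0D : e0 \in D) (e0c : 0 < c e0 \/ forall e, e \in D -> c e = 0).

Let c' k := if [pick e | rk e == k] is Some e then (if c e == c e0 then 0 else c e) else 0.

Let c'_rk e : c' (rk e) = if c e == c e0 then 0 else c e.
Proof.
rewrite /c'; case: pickP => [f /eqP/rk_inj -> //|/(_ e)]; by rewrite eqxx.
Qed.

Let c'_new k : #|E| <= k -> c' k = 0.
Proof.
rewrite /c'; case: pickP => // e /eqP <-; by rewrite leqNgt rk_lt.
Qed.

Let hub_of j v := if t v == 1 then Cn v else Pn v (index j (labs v)).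

Let att_hub e v : 0 < c e -> att e v = hub_of (c e) v.
Proof. by rewrite /att /hub_of; case: (c e). Qed.

Let dg_label j z : 0 < j -> dg (cl c' j) (code z) Gs =
  if (j != c e0) && (hub_of j z.1 == z) then \sum_(e in D) (inc e z.1 && (c e == j)) else 0.
Proof.
move=> j0; rewrite dg_Gs [X in _ + X]esum0 ?addn0 => [|k u w /number_mem[kE _]]; last first.
  by rewrite /cl c'_new // (ltn_eqF j0).
rewrite (eq_bigr (fun e => if (j != c e0) && (hub_of j z.1 == z) then inc e z.1 && (c e == j) : nat else 0)).
  by case: ifP => // _; rewrite big1.
move=> e eD; rewrite /cl c'_rk; case: (eqVneq (c e) j) => [ej|ne]; last first.
  rewrite andbF if_same; case: (c e == c e0); last by rewrite (negbTE ne).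
  by rewrite (ltn_eqF j0).
rewrite -ej in j0 *; rewrite att_hub // andbT; case: (c e == c e0); first by rewrite (ltn_eqF j0).
by rewrite eqxx /=; case: (_ == z); rewrite ?andbT ?andbF.
Qed.

Lemma gadget_factor : exists F : {set E}, [/\ F \subset D, e0 \in F,
  forall v, \sum_(e in F) inc e v = t v,
  forall j, 0 < j -> (exists2 e, e \in D & c e = j) -> exists2 e, e \in F & c e = j &
  forall j v, 0 < j -> \sum_(e in F) (inc e v && (c e == j)) <= 1].
Proof.
have wG := wf_Gs.
have rG : reg c' Gs.
  move=> j n j0; case: (boolP (n \in Ws)) => [/mapP[z zn ->]|nW]; last by left; apply: dg_out wG nW.
  by rewrite dg_label //; case: ifP => _; [apply: labD|left].
pose v0 := src e0; have iv0 := inc_src e0.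
have x0 j : 0 < j -> dg (cl c' j) (code (att e0 v0)) Gs = 0.
  move=> j0; rewrite dg_label // att_node; case: ifP => // /andP[jc]; case: e0c => [c0|all0]; last first.
    by move=> _; apply: big1 => e eD; rewrite all0 // (ltn_eqF j0) andbF.
  (* If [t v0 = 1], the class of [e0] takes two of the three edges at the node and leaves no room
     for another; otherwise the node to which [e0] is attached serves the class of [e0] only. *)
  rewrite att_hub // /hub_of; case: (t v0 =P 1) => [tv _|_].
    have := labs_sum (in_labs e0D iv0 c0); have := degD v0; rewrite tv.
    have : \sum_(e in D) (inc e v0 && (c e == j)) + \sum_(e in D) (inc e v0 && (c e == c e0)) <=
      \sum_(e in D) inc e v0.
      rewrite -big_split; apply: leq_sum => e _; case: (inc e v0) => //=.
      by case: (eqVneq (c e) j) => [->|_]; [rewrite (negbTE jc)|case: (_ == _)].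
    by move=> h1 h2 h3; rewrite h2 h3 in h1; case: (labD v0 j0) => // h; rewrite h in h1.
  rewrite /Pn !xpair_eqE !eqxx /= => /eqP ij.
  have cL := in_labs e0D iv0 c0.
  have jL : j \in labs v0 by rewrite -index_mem ij index_mem.
  by move: jc; rewrite -(nth_index 0 jL) ij nth_index // eqxx.
have [|M [Me pM gM]] := @cubic_solvable _ Ws Gs (rk e0) (code (att e0 (src e0))) (code (att e0 (tgt e0))) c'
   (leqnn _) wG _ rG (fun j j0 => or_introl (x0 j j0)).
  apply: has_edge_mem; left; rewrite mem_cat; apply/orP; left.
  by apply/mapP; exists e0; rewrite ?mem_enum.
pose F := [set e in D | M (rk e)].
have sumF (P : pred E) : \sum_(e in F) P e = \sum_(e in D) (M (rk e) && P e).
  rewrite big_mkcond [RHS]big_mkcond; apply: eq_bigr => e _; rewrite inE.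
  by case: (e \in D); case: (M (rk e)).
exists F; split.
- by apply/subsetP => e; rewrite inE => /andP[].
- by rewrite inE e0D.
- by move=> v; rewrite sumF pm_degree.
- move=> j j0 [e eD ej]; case: (eqVneq j (c e0)) => [->|jc]; first by exists e0; rewrite // inE e0D.
  have extm : (rk e, code (att e (src e)), code (att e (tgt e))) \in Gs.
    by rewrite mem_cat; apply/orP; left; apply/mapP; exists e; rewrite ?mem_enum.
  have : hit c' j M Gs.
    by apply: gM => //; apply: mem_cnt extm _; rewrite /cl c'_rk ej (negbTE jc).
  move=> /cnt_mem[k [u [w [+ /andP[Mk /eqP ck]]]]]; rewrite mem_cat => /orP[|/number_mem[kE _]].
    move=> /ext_mem[f [fD kf _ _]]; exists f; first by rewrite inE fD -kf.
    move: ck; rewrite kf c'_rk; case: ifP => _ // ck; by rewrite -ck in j0.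
  by rewrite c'_new // in ck; rewrite -ck in j0.
move=> j v j0; rewrite sumF.
case: (posnP (\sum_(e in D) (M (rk e) && (inc e v && (c e == j))))) => [-> //|].
move=> /(@pos_sum (fun e => M (rk e) && (inc e v && (c e == j))))[e eD /and3P[Me' ev /eqP ej]].
have hP : att e v = hub_of j v by rewrite att_hub ej.
have hn : code (hub_of j v) \in Ws.
  by rewrite code_Ws -hP; apply: (@nodes_mem v); rewrite mem_cat att_plus.
have h1 : (hub_of j v).1 = v by rewrite -hP att_node.
rewrite -(pM _ hn) dg_Gs h1; apply: leq_trans (leq_addr _ _); apply: leq_sum => f fD.
case: (M (rk f)) => //=; case: (inc f v) => //=; case: (eqVneq (c f) j) => // fj.
by rewrite att_hub fj ?eqxx.
Qed.
End Solve.
End Gadget.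

(** * The factor *)

Section Multigraph.
Variables (V E : finType) (src tgt : E -> V).
Notation inc := (incident src tgt).
Hypothesis loop : loopless src tgt.

Lemma deg_inE (F : {set E}) v : deg_in src tgt F v = \sum_(e in F) inc e v.
Proof.
rewrite /deg_in -sum1_card big_mkcond [RHS]big_mkcond; apply: eq_bigr => e _.
by rewrite inE; case: (e \in F); case: (inc e v).
Qed.

Lemma two_in_sum (D : {set E}) (P : pred E) e f :
  e \in D -> f \in D -> e != f -> P e -> P f -> 2 <= \sum_(g in D) P g.
Proof.
move=> eD fD ef Pe Pf; rewrite (bigD1 e) //= Pe (bigD1 f) ?fD 1?eq_sym //= Pf.
by rewrite addnA leq_addr.
Qed.

Lemma inc_ends e v z : inc e v -> inc e z -> v != z -> forall x, inc e x = (x == v) || (x == z).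
Proof.
move=> ev ez vz x; apply/idP/idP => [ex|/orP[] /eqP -> //].
by have [->|->] := inc_two ev ez ex vz; rewrite eqxx ?orbT.
Qed.

Lemma inc_both e : inc e (src e) /\ inc e (tgt e) /\ src e != tgt e.
Proof. by rewrite !inc_src inc_tgt. Qed.

Lemma change_ends (A : V -> bool) e x y : inc e x -> inc e y -> x != y -> A x != A y ->
  A (src e) != A (tgt e).
Proof.
move=> ex ey xy Axy; have [es [et st]] := inc_both e.
have := inc_ends ex ey xy; move=> h; move: st.
move: es et; rewrite !h => /orP[] /eqP -> /orP[] /eqP ->; rewrite ?eqxx //.
by move=> _; rewrite eq_sym.
Qed.

(** * Mixed cuts of vertices and edges *)

Section Connectivity.
Hypothesis conn : three_connected src tgt.
Variable D : {set E}.
Hypothesis adjD : forall e, exists2 e', e' \in D & forall v, inc e' v = inc e v.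

(** By [adjD] every edge has a parallel copy in [D], so a path in the whole graph minus [Z] yields
    an edge of [D] that leaves [A]. *)
Lemma separated (Z : seq V) (A : pred V) u w : size Z <= 2 -> u \notin Z -> w \notin Z ->
  A u -> ~~ A w -> 0 < \sum_(e in D) (avoids src tgt Z e && (A (src e) != A (tgt e))).
Proof.
move=> sZ uZ wZ Au Aw; rewrite lt0n; apply/eqP => s0.
pose S := [set x in Z].
have sS : #|S| <= 2 by rewrite cardsE; apply: leq_trans (card_size _) sZ.
have uS : u \notin S by rewrite inE.
have wS : w \notin S by rewrite inE.
have := (proj2 conn) S sS u w uS wS.
set r := (fun x y => _) => cuw; have cl : closed r A.
  move=> x y /and3P[]; rewrite !inE => xZ yZ /existsP[e /andP[_ exy]].
  apply/eqP/negPn/negP => Axy; have xy : x != y by apply: contraNneq Axy => ->.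
  have [e' e'D ie'] := adjD e.
  have [ex ey] : inc e' x /\ inc e' y.
    by rewrite !ie' /incident; case/orP: exy => /andP[-> ->]; rewrite ?orbT.
  move/eqP: s0; rewrite sum_nat_eq0 => /forallP/(_ e'); rewrite e'D (change_ends ex ey xy Axy) andbT.
  rewrite eqb0 negbK => /hasP[z zZ ez]; have := inc_ends ex ey xy z.
  by rewrite ez => /esym/orP[] /eqP zE; rewrite zE ?(negbTE xZ) ?(negbTE yZ) in zZ.
have := closed_connect cl cuw; rewrite !unfold_in => h.
by rewrite -h Au in Aw.
Qed.

(** The induction trades a cut edge for the deletion of one of its ends, until two vertices are
    deleted and vertex connectivity applies. *)
Lemma small_cuts n (Z : seq V) (A : pred V) u w : size Z + n = 2 -> u \notin Z -> w \notin Z ->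
  A u -> ~~ A w -> n < \sum_(e in D) (avoids src tgt Z e && (A (src e) != A (tgt e))).
Proof.
elim: n Z u w => [|n IH] Z u w sZ uZ wZ Au Aw.
  by apply: (separated (u := u) (w := w)) => //; move: sZ; clear; lia.
have sZ2 : size Z <= 2 by rewrite -sZ leq_addr.
have [e eD /andP[eZ Ae]] := pos_sum (separated sZ2 uZ wZ Au Aw).
(* There are at least four vertices and [Z] has at most one element here, so a vertex besides [u],
   [w] and [Z] exists. The deleted end is taken on the side of [x], and this side still has a vertex
   afterwards. *)
have [x xP] : exists x, x \notin u :: w :: Z.
  apply/existsP; rewrite -negb_forall; apply/negP => /forallP all_in.
  have : #|V| <= size (u :: w :: Z).
    by apply: leq_trans (card_size _); apply: subset_leq_card; apply/subsetP => v _; exact: all_in.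
  by move: (proj1 conn) sZ => /=; clear; lia.
move: xP; rewrite !inE !negb_or => /and3P[xu xw xZ].
have step p : inc e p -> (exists u' w', [/\ u' \notin p :: Z, w' \notin p :: Z, A u' & ~~ A w']) ->
   n.+1 < \sum_(e in D) (avoids src tgt Z e && (A (src e) != A (tgt e))).
  move=> ep [u' [w' [uZ' wZ' Au' Aw']]].
  have := IH (p :: Z) u' w'; rewrite /= addSnnS => /(_ sZ uZ' wZ' Au' Aw') lt.
  rewrite (bigD1 e) //= eZ Ae add1n ltnS; apply: leq_trans lt _.
  rewrite (bigD1 e) //= [X in X + _](_ : _ = 0); last by rewrite /avoids /= ep.
  rewrite add0n; apply: leq_sum => f _; rewrite /avoids /= negb_or.
  by case: (inc f p) => //=; case: (_ && _).
have [es [et st]] := inc_both e.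
have [p [q [ep eq Ap Aq]]] : exists p q, [/\ inc e p, inc e q, A p & ~~ A q].
  case As: (A (src e)); case At: (A (tgt e)); rewrite As At // in Ae.
    by exists (src e), (tgt e); rewrite As At.
  by exists (tgt e), (src e); rewrite As At.
have ne a b : A a -> ~~ A b -> a != b by move=> Aa; apply: contraNneq => <-.
case Ax: (A x).
  have [u' [u'p u'Z Au']] : exists u', [/\ u' != p, u' \notin Z & A u'].
    by case: (eqVneq u p) => [<-|up]; [exists x; rewrite xu|exists u].
  apply: (step p ep); exists u', w; split=> //; first by rewrite inE negb_or u'p.
  by rewrite inE negb_or wZ eq_sym ne.
have [w' [w'q w'Z Aw']] : exists w', [/\ w' != q, w' \notin Z & ~~ A w'].
  by case: (eqVneq w q) => [<-|wq]; [exists x; rewrite xw Ax|exists w].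
apply: (step q eq); exists u, w'; split=> //; last by rewrite inE negb_or w'q.
by rewrite inE negb_or uZ ne.
Qed.

Lemma edge_cuts (Z : seq V) (A : pred V) u w : size Z <= 2 -> u \notin Z -> w \notin Z ->
  A u -> ~~ A w -> 3 <= size Z + \sum_(e in D) (avoids src tgt Z e && (A (src e) != A (tgt e))).
Proof.
move=> sZ uZ wZ Au Aw; have := small_cuts (subnKC sZ) uZ wZ Au Aw.
by set s := \sum_(_ in _) _; move: sZ; clear; lia.
Qed.
End Connectivity.

(** Two edges of the cycle with the same two ends exhaust the degrees there, so these ends form a
    component and the cycle has length 2. *)
Lemma cycle_no_digon C e f v z : is_cycle src tgt C -> 3 <= #|C| -> e \in C -> f \in C -> e != f ->
  inc e v -> inc f v -> inc e z -> inc f z -> v = z.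
Proof.
move=> [_ d2 con] c3 eC fC ef ev fv ez fz; apply/eqP/negPn/negP => vz.
have only x g : inc e x -> inc f x -> g \in C -> inc g x -> g = e \/ g = f.
  move=> ex fx gC gx; have xC : x \in verts_of src tgt C.
    by rewrite inE; apply/existsP; exists e; rewrite eC.
  have := d2 x xC; rewrite /deg_in => d.
  have sub : [set e; f] \subset [set e in C | inc e x].
    by apply/subsetP => h; rewrite !inE => /orP[] /eqP ->; rewrite ?eC ?fC ?ex ?fx.
  have /eqP E2 : [set e; f] == [set e in C | inc e x] by rewrite eqEcard sub d cards2 ef.
  have : g \in [set e; f] by rewrite E2 inE gC.
  by rewrite !inE => /orP[] /eqP; [left|right].
have cl : closed (adj_in src tgt C) (pred2 v z).
  have one x y : adj_in src tgt C x y -> (x == v) || (x == z) -> (y == v) || (y == z).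
    move=> /existsP[g /andP[gC gxy]] xvz.
    have [gx gy] : inc g x /\ inc g y.
      by rewrite /incident; case/orP: gxy => /andP[-> ->]; rewrite ?orbT.
    have gef : g = e \/ g = f by case/orP: xvz => /eqP xE; subst x; apply: (only _ _ _ _ gC gx).
    by case: gef => gE; subst g; [rewrite -(inc_ends ev ez vz)|rewrite -(inc_ends fv fz vz)].
  move=> x y xy; apply/idP/idP => /= [|yvz]; first exact: one.
  apply: one yvz; move: xy => /existsP[g /andP[gC gxy]]; apply/existsP; exists g.
  by rewrite gC /= orbC.
have vC : v \in verts_of src tgt C by rewrite inE; apply/existsP; exists e; rewrite eC.
suff : C \subset [set e; f].
  by move/subset_leq_card; rewrite cards2 ef; move: c3; case: #|C| => [|[|[|]]].
apply/subsetP => g gC; have gV : src g \in verts_of src tgt C.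
  by rewrite inE; apply/existsP; exists g; rewrite gC inc_src.
have := closed_connect cl (con _ _ vC gV); rewrite !inE eqxx /= => /esym/orP[] /eqP h.
  have gv : inc g v by rewrite -h inc_src.
  by have [->|->] := only v g ev fv gC gv; rewrite ?inE eqxx ?orbT.
have gz : inc g z by rewrite -h inc_src.
  by have [->|->] := only z g ez fz gC gz; rewrite ?inE eqxx ?orbT.
Qed.

Section Factor.
Hypothesis conn : three_connected src tgt.
Variable c : E -> nat.
Hypothesis labE : forall j v, 0 < j ->
  \sum_(e : E) (inc e v && (c e == j)) = 0 \/ \sum_(e : E) (inc e v && (c e == j)) = 2.
Hypothesis digE : forall v z e f, e != f -> 0 < c e -> c f = c e ->
  inc e v -> inc f v -> inc e z -> inc f z -> v = z.

(* Three of at least four parallel unlabelled edges are deleted from [D], and one of them is added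
   to the factor of the rest. *)
Lemma labelled_factor n (D : {set E}) (t : V -> nat) : #|D| <= n ->
  (forall v, 0 < t v) -> (forall v, \sum_(e in D) inc e v = 3 * t v) ->
  (forall e, 0 < c e -> e \in D) ->
  (forall e, exists2 e', e' \in D & forall v, inc e' v = inc e v) ->
  exists F : {set E}, [/\ F \subset D, forall v, \sum_(e in F) inc e v = t v,
    forall e, 0 < c e -> exists2 f, f \in F & c f = c e &
    forall j v, 0 < j -> \sum_(e in F) (inc e v && (c e == j)) <= 1].
Proof.
elim: n D t => [|n IH] D t sD t1 degD cD adjD.
  have [v _] : exists v : V, true by have := proj1 conn; case: (pickP V) => [v|] // h; rewrite (eq_card0 h).
  have := degD v; have := t1 v; rewrite (_ : D = set0) ?big_set0; first by clear; lia.
  by apply/eqP; rewrite -cards_eq0 -leqn0.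
case: (pickP [pred q : V * V | (q.1 != q.2) &&
    (3 < \sum_(e in D) [&& inc e q.1, inc e q.2 & c e == 0])]) => [[v z] /andP[/= vz big]|nf]; last first.
  have labD j v : 0 < j -> let d := \sum_(e in D) (inc e v && (c e == j)) in d = 0 \/ d = 2.
    move=> j0 /=; suff -> : \sum_(e in D) (inc e v && (c e == j)) = \sum_(e : E) (inc e v && (c e == j)) by exact: labE.
    rewrite big_mkcond; apply: eq_bigr => e _; case: ifP => // eD.
    by case: (eqVneq (c e) j) => [ej|]; [rewrite cD ?ej in eD|rewrite andbF].
  have dig v z e f : e \in D -> f \in D -> e != f -> 0 < c e -> c f = c e ->
    inc e v -> inc f v -> inc e z -> inc f z -> v = z by move=> _ _; exact: digE.
  have nf' v z : v != z -> \sum_(e in D) [&& inc e v, inc e z & c e == 0] <= 3.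
    by move=> vz; have := nf (v, z); rewrite /= vz /= => /negbT; rewrite -leqNgt.
  have [e0 e0D e0c] : exists2 e0, e0 \in D & 0 < c e0 \/ forall e, e \in D -> c e = 0.
    case: (pickP [pred e | 0 < c e]) => [e /= ce|none]; first by exists e; [apply: cD|left].
    have [v _] : exists v : V, true by have := proj1 conn; case: (pickP V) => [v|] // h; rewrite (eq_card0 h).
    have : 0 < \sum_(e in D) inc e v by rewrite degD muln_gt0 t1.
    move=> /(@pos_sum _ _ (fun e => inc e v))[e eD _]; exists e => //; right=> f _.
    by have := none f; rewrite /= lt0n => /negbFE/eqP.
  have [F [FD e0F dF hF mF]] := gadget_factor loop t1 degD labD dig nf' (edge_cuts conn adjD) e0D e0c.
  exists F; split=> // e ce; apply: hF => //; exists e => //; exact: cD.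
pose S := [set e in D | [&& inc e v, inc e z & c e == 0]].
have cS : 3 < #|S|.
  apply: leq_trans big _; rewrite -sum1_card big_mkcond [leqRHS]big_mkcond; apply: leq_sum => e _.
  by rewrite inE; case: (e \in D).
have endS e x : e \in S -> inc e x = (x == v) || (x == z).
  by rewrite inE => /and4P[_ ev ez _]; apply: inc_ends.
case ES: (enum S) => [|e1 [|e2 [|e3 [|e4 s]]]];
  try by move: cS; rewrite cardE ES.
have uS : uniq [:: e1, e2, e3, e4 & s] by rewrite -ES enum_uniq.
have inS e : e \in [:: e1, e2, e3, e4 & s] -> e \in S by rewrite -ES mem_enum.
pose S3 := [set e1; e2; e3].
have e1S : e1 \in S by apply: inS; rewrite !inE eqxx.
have e4S : e4 \in S by apply: inS; rewrite !inE eqxx !orbT.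
have S3S e : e \in S3 -> e \in S.
  by move=> eS; apply: inS; move: eS; rewrite !inE -orbA => /or3P[] ->; rewrite ?orbT.
have SD e : e \in S -> e \in D by rewrite inE => /andP[].
have Sc e : e \in S -> c e = 0 by rewrite inE => /and4P[_ _ _ /eqP].
move: uS; rewrite /= !inE !negb_or => /and4P[/and4P[n12 n13 n14 _] /and3P[n23 n24 _] /andP[n34 _] _].
have c3 : #|S3| = 3 by rewrite /S3 setUC cardsU1 !inE negb_or !(eq_sym e3) n13 n23 cards2 n12.
pose D' := D :\: S3; pose t' x := t x - ((x == v) || (x == z)).
have sumD (P : pred E) : \sum_(e in D) P e = \sum_(e in S3) P e + \sum_(e in D') P e.
  rewrite (bigID (mem S3)) /=; congr (_ + _); apply: eq_bigl => e; last by rewrite in_setD andbC.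
  by apply/andP/idP => [[]//|h]; split=> //; apply/SD/S3S.
(* Four edges at [x] give [3 * t x >= 4], so [t x] is at least 2 and [t'] stays positive. *)
have t2 x : (x == v) || (x == z) -> 2 <= t x.
  move=> xvz; suff : 4 <= 3 * t x by clear; lia.
  rewrite -degD; apply: leq_trans big _; apply: leq_sum => e eD.
  case: (boolP (inc e v)) => //= ev; case: (boolP (inc e z)) => //= ez.
  by rewrite (inc_ends ev ez vz) xvz; case: (_ == _).
have degD' x : \sum_(e in D') inc e x = 3 * t' x.
  have := sumD (fun e => inc e x); rewrite degD (eq_bigr (fun _ => (x == v) || (x == z) : nat)).
    rewrite sum_nat_const c3 /t'; have := t2 x; case: (_ || _) => [/(_ isT)|_] /=;
    by set sx := \sum_(_ in _) _; clear; lia.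
  by move=> e /S3S eS; rewrite (endS e x eS).
have [|||||F [FD dF hF mF]] := IH D' t'.
- have := cardsID S3 D; have -> : D :&: S3 = S3.
    by apply/setIidPr/subsetP => e /S3S/SD.
  by rewrite c3 -/D'; move: sD; clear; lia.
- by move=> x; rewrite /t'; have := t1 x; have := t2 x; case: (_ || _) => [/(_ isT)|_] /=; clear; lia.
- exact: degD'.
- by move=> e ce; rewrite inE cD // andbT; apply/negP => /S3S/Sc ce0; rewrite ce0 in ce.
- move=> e; have [e' e'D ie'] := adjD e; case: (boolP (e' \in S3)) => e'S; last by exists e'; rewrite ?in_setD ?e'S.
  (* The fourth edge survives as a representative of the deleted ones, so adjacency is preserved. *)
  exists e4; first by rewrite !inE (SD _ e4S) !(eq_sym e4) (negbTE n14) (negbTE n24) (negbTE n34).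
  by move=> x; rewrite -ie' (endS _ _ e4S) (endS _ _ (S3S _ e'S)).
have e1F : e1 \notin F by apply/negP => /(subsetP FD); rewrite !inE eqxx.
exists (e1 |: F); split.
- apply/subsetP => e; rewrite !inE => /orP[/eqP ->|/(subsetP FD)]; first exact: SD.
  by rewrite inE => /andP[].
- move=> x; rewrite big_setU1 //= dF (endS _ x e1S) /t'.
  by have := t1 x; case: (_ || _) => /=; clear; lia.
- by move=> e /hF[f fF cf]; exists f => //; rewrite !inE fF orbT.
move=> j x j0; rewrite big_setU1 //= (Sc _ e1S) (ltn_eqF j0) andbF add0n; exact: mF.
Qed.
End Factor.
End Multigraph.

Theorem theorem6p3 (V E : finType) (src tgt : E -> V) (t : nat)
  (O : {set {set E}}) :
  1 <= t ->
  loopless src tgt ->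
  three_connected src tgt ->
  regular src tgt (3 * t) ->
  (forall C, C \in O -> is_cycle src tgt C /\ 3 <= #|C|) ->
  (forall C D, C \in O -> D \in O -> C != D -> [disjoint C & D]) ->
  exists F : {set E}, is_factor src tgt t F /\
    forall C, C \in O -> F :&: C != set0 /\ is_matching src tgt (F :&: C).
Proof.
move=> t1 loop conn regG cyc disj.
(* The shift by one reserves the label 0 for edges on no cycle of [O]. *)
pose c e := if [pick C in O | e \in C] is Some C then (enum_rank C).+1 else 0 : nat.
have cP C e : C \in O -> (c e == (enum_rank C).+1) = (e \in C).
  move=> CO; rewrite /c; case: pickP => [C' /andP[C'O eC']|no]; last first.
    by have := no C; rewrite /= CO /= => ->.
  rewrite eqSS (inj_eq (@ord_inj _)) (inj_eq enum_rank_inj); case: (eqVneq C' C) => [<-|ne].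
    by rewrite eC'.
  by have := disjointFr (disj _ _ C'O CO ne) eC'.
have c0 e : 0 < c e -> exists2 C, C \in O & c e = (enum_rank C).+1.
  by rewrite /c; case: pickP => [C /andP[CO _] _|//]; exists C.
have labE j v : 0 < j -> \sum_(e : E) (incident src tgt e v && (c e == j)) = 0 \/
    \sum_(e : E) (incident src tgt e v && (c e == j)) = 2.
  move=> j0; case: (pickP [pred e | incident src tgt e v && (c e == j)]) => [e /andP[ev /eqP ej]|no].
    have [|C CO eC] := c0 e; first by rewrite ej.
    right; have [[_ d2 _] _] := cyc C CO; rewrite -(d2 v).
      rewrite deg_inE [RHS]big_mkcond; apply: eq_bigr => f _; rewrite -ej eC cP //.
      by case: (f \in C); rewrite ?andbT ?andbF.
    by rewrite inE; apply/existsP; exists e; rewrite ev -(cP _ _ CO) eC eqxx.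
  by left; rewrite big1 // => e _; have := no e; rewrite /= => ->.
have digE v z e f : e != f -> 0 < c e -> c f = c e -> incident src tgt e v -> incident src tgt f v ->
    incident src tgt e z -> incident src tgt f z -> v = z.
  move=> ef /c0[C CO eC] fc; have [cC c3] := cyc C CO.
  by apply: (cycle_no_digon cC c3) ef; rewrite -(cP _ _ CO) ?fc eC.
have [|||F [_ dF hF mF]] := @labelled_factor V E src tgt loop conn c labE digE #|[set: E]| [set: E] (fun=> t) (leqnn _) (fun=> t1).
- by move=> v; rewrite -deg_inE; apply: regG.
- by move=> e _; rewrite inE.
- by move=> e; exists e; rewrite ?inE.
exists F; split=> [v|C CO]; first by rewrite deg_inE.
have [[C0 _ _] _] := cyc C CO; split.
  have /set0Pn[e eC] := C0; have := hF e; have /eqP -> : c e == (enum_rank C).+1 by rewrite cP.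
  move=> /(_ isT)[f fF /eqP]; rewrite cP // => fC.
  by apply/set0Pn; exists f; rewrite inE fF.
move=> e f; rewrite !inE => /andP[eF eC] /andP[fF fC] ef; apply/negP => /existsP[v /andP[ev fv]].
have := mF (enum_rank C).+1 v isT; rewrite leqNgt => /negP[].
by apply: (two_in_sum eF fF ef); rewrite ?ev ?fv cP.
Qed.
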